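(* Let $0<q<1$, $(\alpha,\beta)\in\mathbb{R}\times\mathbb{R}_+$ (with $\mathbb{R}_+=\{x\in\mathbb{R}: x>0\}$), $\xi<0$, and let $u\in\mathbb{C}$ with $\mathrm{Re}\,u<0$. Then $$\frac{(\alpha u,\alpha/u;q)_\infty}{(\beta u,\beta/u;q)_\infty}=\frac{(\alpha\xi,\alpha/\xi;q)_\infty}{(\beta\xi,\beta/\xi;q)_\infty}\;{}_3\phi_2\left[\begin{array}{c}\alpha/\beta,\ \xi u,\ \xi/u\\ \alpha\xi,\ q\xi/\beta\end{array};\,q,\,q\right]+\frac{1}{2\pi i}\int_{-i\infty}^{i\infty}\frac{(\alpha v,\alpha/v,\xi u,\xi/u;q)_\infty}{(\beta v,\beta/v,\xi v,\xi/v;q)_\infty}\,\frac{(1-v^2)u}{(u-v)(uv-1)v}\,dv .$$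
   Context: Notation: $(x;q)_k=\prod_{j=0}^{k-1}(1-q^jx)$, $(x;q)_\infty=\prod_{j=0}^\infty(1-q^jx)$, and $(a_1,\ldots,a_m;q)_k=\prod_{i=1}^m(a_i;q)_k$ for $k\in\{0,1,2,\ldots\}\cup\{\infty\}$. The basic hypergeometric series is $${}_3\phi_2\left[\begin{array}{c}a_1,a_2,a_3\\ b_1,b_2\end{array};q,z\right]=\sum_{k=0}^\infty\frac{(a_1,a_2,a_3;q)_k}{(q,b_1,b_2;q)_k}\,z^k .$$ The integral is along the imaginary axis, in the upward direction. If $\alpha\xi=q^{-j}$ for some integer $j\ge0$, the product of $(\alpha\xi;q)_\infty$ with the series ${}_3\phi_2$ is understood termwise, with $(\alpha\xi;q)_\infty/(\alpha\xi;q)_k$ replaced by $(\alpha\xi q^k;q)_\infty$.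
   Formalization: The factor 1/(2πi) before the integral is replaced by 1/(4πi): u and 1/u both lie left of the imaginary axis, so the integral counts each contribution twice, and the printed identity fails, e.g. for α=0, β=1, u=−1, ξ=−2 and small q. *)

(* Defs.v *)
From Stdlib Require Export Reals List.
From Coquelicot Require Export Coquelicot.
Export ListNotations.
Open Scope R_scope.
Open Scope C_scope.

(** (x;q)_k *)
Fixpoint qpoch (q : R) (x : C) (k : nat) : C :=
  match k with
  | O => 1
  | S j => qpoch q x j * (1 - RtoC (q ^ j)%R * x)
  end.

(** (x;q)_oo; [lim] is the limit operator of the complete space C, meaningful
    because the partial products converge for every x when |q| < 1. *)
Definition qpoch_inf (q : R) (x : C) : C :=
  lim (T := C_CompleteNormedModule) (filtermap (qpoch q x) eventually).

(** (a_1, ..., a_m; q)_k and (a_1, ..., a_m; q)_oo *)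
Definition qpochs (q : R) (l : list C) (k : nat) : C :=
  fold_right Cmult 1 (map (fun a => qpoch q a k) l).

Definition qpochs_inf (q : R) (l : list C) : C :=
  fold_right Cmult 1 (map (qpoch_inf q) l).

(** [is_phi32 a1 a2 a3 b1 b2 q z s]: the 3phi2 series converges, with sum s. *)
Definition is_phi32 (a1 a2 a3 b1 b2 : C) (q : R) (z s : C) : Prop :=
  is_series (K := C_AbsRing) (V := C_NormedModule)
    (fun k => qpochs q [a1; a2; a3] k / qpochs q [RtoC q; b1; b2] k * Cpow z k)
    s.

(** [is_phi32_reg a1 a2 a3 b1 b2 q z s]: the product of (b1;q)_oo with the 3phi2
    series, taken termwise with (b1;q)_oo / (b1;q)_k read as (b1 q^k;q)_oo,
    converges to s.  It makes sense also when b1 = q^(-j). *)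
Definition is_phi32_reg (a1 a2 a3 b1 b2 : C) (q : R) (z s : C) : Prop :=
  is_series (K := C_AbsRing) (V := C_NormedModule)
    (fun k => qpochs q [a1; a2; a3] k / qpochs q [RtoC q; b2] k
              * qpoch_inf q (b1 * RtoC (q ^ k)%R) * Cpow z k)
    s.

(** [is_int_imag F l]: the integral of F(v) dv along the imaginary axis, upwards,
    i.e. of i F(i t) dt over t from -oo to +oo, converges to l.  The value of F at
    v = 0, where a formula may divide by zero, is irrelevant. *)
Definition is_int_imag (F : C -> C) (l : C) : Prop :=
  is_RInt_gen (V := C_R_NormedModule) (fun t : R => Ci * F (Ci * RtoC t))
    (Rbar_locally m_infty) (Rbar_locally p_infty) l.

(** The integral in the expansion of (alpha u, alpha/u)_oo / (beta u, beta/u)_oo.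
    The rational factor equals 1/(v-u) + 1/(v-1/u) - 1/v: it is the Cauchy kernel
    symmetrised under v -> 1/v, and it has residue 1 at both u and 1/u.  As these
    two points lie on the same side of the imaginary axis, the integral has to be
    normalised by 1/(4 pi i); with the Cauchy factor 1/(2 pi i) the contribution
    of u would be counted twice and the expansion would be false. *)
Definition integrand (q alpha beta xi : R) (u v : C) : C :=
  qpochs_inf q [alpha * v; alpha / v; xi * u; xi / u]
  / qpochs_inf q [beta * v; beta / v; xi * v; xi / v]
  * ((1 - v * v) * u / ((u - v) * (u * v - 1) * v)).

(* Main.v *)
Require Import Defs.
From Stdlib Require Import Lra Lia Psatz.

(** Put Y = v + 1/v and X = u + 1/u.  In these variables (a v, a/v; q)_k is the polynomial
    prod_j (1 + a^2 q^(2j) - a q^j Y), the integrand is symmetric under v -> 1/v, and v = i t gives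
    Y = i (t - 1/t), so that the imaginary axis is covered twice.  The expansion is then the Newton
    interpolation series of (alpha v, alpha/v)_oo / (beta v, beta/v)_oo at the nodes
    xi q^n + 1/(xi q^n), and the integral is the limit of the Hermite form
    1/(2 pi i) int f(Y) Phi_n(X)/Phi_n(Y) dY/(Y - X) of the interpolation error, where
    Phi_n(Y) = (xi v, xi/v; q)_n.

    No contour shift is needed.  Splitting the first factor of (alpha v, alpha/v)_oo linearly in
    terms of the factor of Phi_(n+1) at the n-th node gives a three-term recursion, satisfied by the
    error integrals and, in closed form, by the remainders of the series, which relates the cases
    (n+1, alpha), (n, alpha q) and (n+1, alpha q).  It is run downwards from alpha = beta, where the
    function is constant, to alpha = beta q^j; the limit j -> oo gives alpha = 0, and then small
    alpha, because the discrepancy is multiplied by a convergent product along alpha q^N; run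
    upwards it reaches every alpha for n large.  The case n = 0 and the constant function are
    Cauchy integrals of rational functions, obtained from partial fractions and the integral of
    1/(i t - p). *)

(** * Limits of complex sequences and infinite products *)

(** Signs carry the estimates. Since [beta > 0], the poles of the interpolated function have Re Y >
    0; since [xi < 0], the nodes have Re Y < 0, as does X. A factor 1 + a^2 - a Y has modulus at
    least 1 whenever a Re Y <= 0, so denominators stay away from 0 on the axis. The threshold beta
    q^2 for a small alpha comes from growth on the axis. With w = sqrt (1 + t^2), passing from one
    finite approximant of the quotient to the next costs a factor w and the Cauchy kernel gains one,
    so the quotient itself must supply w^(-2): two surplus factors in the denominator. The downward
    recursion divides by the value of the factor of alpha at a node, and that value can vanish when
    alpha < 0. It is positive for alpha = beta q^j, because the nodes are negative, so only this
    sequence is treated by division. For other small alpha the homogeneous relation between the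
    discrepancies at alpha and alpha q is used: it needs no division, but it needs their limit at
    alpha = 0, which the sequence beta q^j provides. *)

Definition cv (z : nat -> C) (l : C) : Prop :=
  is_lim_seq (fun n => Cmod (z n - l)) 0%R.

Lemma cv_squeeze (z : nat -> C) (l : C) (b : nat -> R) :
  (forall n, (Cmod (z n - l) <= b n)%R) -> is_lim_seq b 0%R -> cv z l.
Proof.
  intros H Hb. unfold cv.
  apply (is_lim_seq_le_le (fun _ => 0%R) _ b); auto.
  - intros n. split; [apply Cmod_ge_0 | apply H].
  - apply is_lim_seq_const.
Qed.

Lemma cv_ext (z w : nat -> C) (l : C) :
  (forall n, z n = w n) -> cv z l -> cv w l.
Proof.
  intros H. apply is_lim_seq_ext. intros n. now rewrite H.
Qed.

Lemma cv_const (l : C) : cv (fun _ => l) l.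
Proof.
  apply cv_squeeze with (fun _ => 0%R); [|apply is_lim_seq_const].
  intros n. replace (l - l) with (RtoC 0) by ring. rewrite Cmod_0. lra.
Qed.

Lemma cv_incr_1 (z : nat -> C) (l : C) : cv z l <-> cv (fun n => z (S n)) l.
Proof. exact (is_lim_seq_incr_1 (fun n => Cmod (z n - l)) 0%R). Qed.

Lemma cv_incr_n (z : nat -> C) (l : C) (N : nat) :
  cv z l <-> cv (fun n => z (n + N)%nat) l.
Proof. exact (is_lim_seq_incr_n (fun n => Cmod (z n - l)) N 0%R). Qed.

Lemma is_lim_seq_plus_0 (a b : nat -> R) :
  is_lim_seq a 0%R -> is_lim_seq b 0%R -> is_lim_seq (fun n => a n + b n)%R 0%R.
Proof.
  intros Ha Hb. replace (Finite 0) with (Finite (0 + 0)) by (f_equal; ring).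
  now apply is_lim_seq_plus'.
Qed.

Lemma is_lim_seq_scal_0 (a : nat -> R) (k : R) :
  is_lim_seq a 0%R -> is_lim_seq (fun n => k * a n)%R 0%R.
Proof.
  intros Ha. replace (Finite 0) with (Rbar_mult k 0%R) by (simpl; f_equal; ring).
  now apply is_lim_seq_scal_l.
Qed.

Lemma cv_plus (z w : nat -> C) (a b : C) :
  cv z a -> cv w b -> cv (fun n => z n + w n) (a + b).
Proof.
  intros Hz Hw.
  apply cv_squeeze with (fun n => Cmod (z n - a) + Cmod (w n - b))%R.
  - intros n. replace (z n + w n - (a + b)) with ((z n - a) + (w n - b)) by ring.
    apply Cmod_triangle.
  - now apply is_lim_seq_plus_0.
Qed.

Lemma cv_mult (z w : nat -> C) (a b : C) :
  cv z a -> cv w b -> cv (fun n => z n * w n) (a * b).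
Proof.
  intros Hz Hw.
  apply cv_squeeze with (fun n => Cmod (z n - a) * Cmod (w n - b) +
    (Cmod a * Cmod (w n - b) + Cmod b * Cmod (z n - a)))%R.
  - intros n.
    replace (z n * w n - a * b)
      with ((z n - a) * (w n - b) + (a * (w n - b) + b * (z n - a))) by ring.
    rewrite <- !Cmod_mult.
    eapply Rle_trans; [apply Cmod_triangle|].
    apply Rplus_le_compat_l, Cmod_triangle.
  - apply is_lim_seq_plus_0; [|apply is_lim_seq_plus_0; now apply is_lim_seq_scal_0].
    replace (Finite 0) with (Finite (0 * 0)) by (f_equal; ring).
    now apply is_lim_seq_mult'.
Qed.

Lemma cv_scal (c : C) (z : nat -> C) (a : C) :
  cv z a -> cv (fun n => c * z n) (c * a).
Proof. intros H. apply cv_mult; [apply cv_const|exact H]. Qed.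

Lemma cv_minus (z w : nat -> C) (a b : C) :
  cv z a -> cv w b -> cv (fun n => z n - w n) (a - b).
Proof.
  intros Hz Hw.
  replace (a - b) with (a + (- (1)) * b) by ring.
  apply cv_ext with (fun n => z n + (- (1)) * w n); [intros n; ring|].
  apply cv_plus; [exact Hz | now apply cv_scal].
Qed.

Lemma cv_Cmod (z : nat -> C) (l : C) :
  cv z l -> is_lim_seq (fun n => Cmod (z n)) (Cmod l).
Proof.
  intros H.
  apply is_lim_seq_le_le with (fun n => Cmod l - Cmod (z n - l))%R
     (fun n => Cmod l + Cmod (z n - l))%R.
  - intros n. split.
    + assert (E : Cmod l <= Cmod (z n) + Cmod (z n - l)).
      { replace l with (z n + - (z n - l)) at 1 by ring.
        eapply Rle_trans; [apply Cmod_triangle|]. rewrite Cmod_opp. lra. }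
      lra.
    + replace (z n) with (l + (z n - l)) at 1 by ring. apply Cmod_triangle.
  - replace (Finite (Cmod l)) with (Finite (Cmod l - 0)) by (f_equal; ring).
    apply is_lim_seq_minus'; [apply is_lim_seq_const|exact H].
  - replace (Finite (Cmod l)) with (Finite (Cmod l + 0)) by (f_equal; ring).
    apply is_lim_seq_plus'; [apply is_lim_seq_const|exact H].
Qed.

Lemma cv_le (z w : nat -> C) (a b : C) :
  (forall n, (Cmod (z n) <= Cmod (w n))%R) -> cv z a -> cv w b -> (Cmod a <= Cmod b)%R.
Proof.
  intros H Hz Hw.
  exact (is_lim_seq_le _ _ (Cmod a) (Cmod b) H (cv_Cmod _ _ Hz) (cv_Cmod _ _ Hw)).
Qed.

Lemma cv_le_const (z : nat -> C) (a : C) (M : R) :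
  (forall n, (Cmod (z n) <= M)%R) -> cv z a -> (Cmod a <= M)%R.
Proof.
  intros H Hz.
  exact (is_lim_seq_le _ _ (Cmod a) M H (cv_Cmod _ _ Hz) (is_lim_seq_const M)).
Qed.

Lemma cv_ge_const (z : nat -> C) (a : C) (M : R) :
  (forall n, (M <= Cmod (z n))%R) -> cv z a -> (M <= Cmod a)%R.
Proof.
  intros H Hz.
  exact (is_lim_seq_le _ _ M (Cmod a) H (is_lim_seq_const M) (cv_Cmod _ _ Hz)).
Qed.

Lemma cv_unique (z : nat -> C) (a b : C) : cv z a -> cv z b -> a = b.
Proof.
  intros Ha Hb.
  assert (H := cv_minus _ _ _ _ Ha Hb). apply cv_Cmod in H.
  assert (E : Finite (Cmod (a - b)) = Finite 0).
  { rewrite <- (is_lim_seq_unique _ _ H).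
    apply is_lim_seq_unique. apply is_lim_seq_ext with (fun _ => 0%R).
    - intros n. replace (z n - z n) with (RtoC 0) by ring. now rewrite Cmod_0.
    - apply is_lim_seq_const. }
  injection E as E. apply Cmod_eq_0 in E.
  replace a with ((a - b) + b) by ring. rewrite E. ring.
Qed.

Lemma cv_neq_0_eventually (z : nat -> C) (l : C) :
  cv z l -> l <> 0 -> exists N, z N <> 0.
Proof.
  intros H Hl.
  apply is_lim_seq_spec in H.
  apply Cmod_gt_0 in Hl.
  destruct (H (mkposreal _ Hl)) as [N HN]. exists N. intros E.
  specialize (HN N (le_n N)). simpl in HN. rewrite E in HN.
  replace (0 - l) with (- l) in HN by ring.
  rewrite Cmod_opp, Rminus_0_r, Rabs_pos_eq in HN by apply Cmod_ge_0. lra.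
Qed.

(** Inversion is 1-Lipschitz outside the unit disc. The bound 1 fits the denominators met later, all
    of modulus at least 1. *)
Lemma cv_inv (z : nat -> C) (l : C) :
  (forall n, (1 <= Cmod (z n))%R) -> cv z l -> cv (fun n => / z n) (/ l).
Proof.
  intros H Hz.
  assert (Hl : (1 <= Cmod l)%R) by (apply (cv_ge_const z); auto).
  apply cv_squeeze with (fun n => Cmod (z n - l)); [|exact Hz].
  intros n. specialize (H n).
  assert (z n <> 0) by (apply Cmod_gt_0; lra).
  assert (l <> 0) by (apply Cmod_gt_0; lra).
  replace (/ z n - / l) with (- (z n - l) / (z n * l)) by (field; auto).
  rewrite Cmod_div by (apply Cmult_neq_0; auto).
  rewrite Cmod_opp, Cmod_mult.
  assert (0 <= Cmod (z n - l)) by apply Cmod_ge_0.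
  assert (1 <= Cmod (z n) * Cmod l) by nra.
  apply Rle_div_l; nra.
Qed.

(** [cv] is stated through a real sequence of moduli so that real squeezing applies; this is the
    bridge to the filters used by series and by [lim]. *)
Lemma cv_filterlim (z : nat -> C) (l : C) :
  cv z l <-> filterlim z eventually (locally (T := C_NormedModule) l).
Proof.
  split.
  - intros H. apply (filterlim_locally_ball_norm (K := C_AbsRing) (U := C_NormedModule)).
    intros eps.
    apply is_lim_seq_spec in H. destruct (H eps) as [N HN].
    exists N. intros n Hn. specialize (HN n Hn).
    rewrite Rminus_0_r, Rabs_pos_eq in HN by apply Cmod_ge_0.
    exact HN.
  - intros H. apply is_lim_seq_spec. intros eps.
    apply (filterlim_locally_ball_norm (K := C_AbsRing) (U := C_NormedModule)) with (eps := eps) in H.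
    destruct H as [N HN]. exists N. intros n Hn. specialize (HN n Hn).
    rewrite Rminus_0_r, Rabs_pos_eq by apply Cmod_ge_0. exact HN.
Qed.

(** Same shape as the body of [qpoch_inf], so that [qpoch_inf q x] is [clim (qpoch q x)] by
    conversion. *)
Definition clim (z : nat -> C) : C :=
  lim (T := C_CompleteNormedModule) (filtermap z eventually).

Lemma clim_spec (z : nat -> C) (l : C) : cv z l -> cv z (clim z) /\ clim z = l.
Proof.
  intros H.
  assert (cv z (clim z)).
  { apply cv_filterlim in H. apply cv_filterlim.
    apply filterlim_locally. intros eps.
    apply (complete_cauchy (T := C_CompleteNormedModule) (filtermap z eventually)).
    - apply filtermap_proper_filter, eventually_filter.
    - intros e. exists l. apply (filterlim_locally (U := C_NormedModule)). exact H. }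
  split; [assumption|]. now apply (cv_unique z).
Qed.

(** The right side is the exact partial sum of the geometric series; with the factor [1 - q ^ k]
    kept, the induction on [k] closes. *)
Lemma geometric_tail_le (z : nat -> C) (K q : R) :
  (0 < q < 1)%R -> (forall n, (Cmod (z (S n) - z n) <= K * q ^ n)%R) ->
  forall k n, (Cmod (z (n + k)%nat - z n) <= K * q ^ n / (1 - q) * (1 - q ^ k))%R.
Proof.
  intros Hq H k n. induction k as [|k IH].
  - rewrite Nat.add_0_r. replace (z n - z n) with (RtoC 0) by ring.
    rewrite Cmod_0. simpl. lra.
  - rewrite Nat.add_succ_r.
    replace (z (S (n + k)) - z n) with ((z (S (n + k)) - z (n + k)%nat) + (z (n + k)%nat - z n)) by ring.
    eapply Rle_trans; [apply Cmod_triangle|].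
    specialize (H (n + k)%nat). rewrite pow_add in H.
    replace (K * q ^ n / (1 - q) * (1 - q ^ S k))%R
      with (K * (q ^ n * q ^ k) + K * q ^ n / (1 - q) * (1 - q ^ k))%R
      by (simpl; field; lra).
    lra.
Qed.

Lemma geometric_bound_nonneg (z : nat -> C) (K q : R) :
  (forall n, (Cmod (z (S n) - z n) <= K * q ^ n)%R) -> (0 <= K)%R.
Proof.
  intros H. specialize (H O). simpl in H.
  assert (0 <= Cmod (z 1%nat - z O)) by apply Cmod_ge_0. lra.
Qed.

Lemma is_lim_seq_scal_geom (K q : R) :
  (0 < q < 1)%R -> is_lim_seq (fun n => K * q ^ n)%R 0%R.
Proof.
  intros Hq. apply is_lim_seq_scal_0. apply is_lim_seq_geom.
  rewrite Rabs_pos_eq; lra.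
Qed.

Lemma geometric_cv (z : nat -> C) (K q : R) :
  (0 < q < 1)%R -> (forall n, (Cmod (z (S n) - z n) <= K * q ^ n)%R) ->
  cv z (clim z).
Proof.
  intros Hq H.
  assert (HK := geometric_bound_nonneg _ _ _ H).
  assert (HT := geometric_tail_le _ _ _ Hq H).
  assert (exists l, filterlim z eventually (locally (T := C_NormedModule) l)) as [l Hl].
  { apply (filterlim_locally_cauchy (U := C_CompleteNormedModule)). intros eps.
    assert (HL := is_lim_seq_scal_geom (K / (1 - q) * 2) q Hq).
    apply is_lim_seq_spec in HL. destruct (HL eps) as [N HN].
    exists (fun n => (N <= n)%nat). split; [exists N; auto|].
    assert (HB : forall n, (N <= n)%nat -> (Cmod (z n - z N) <= K * q ^ N / (1 - q))%R).
    { intros n Hn. replace n with (N + (n - N))%nat by lia.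
      eapply Rle_trans; [apply HT|].
      assert (0 <= q ^ (n - N)) by (apply pow_le; lra).
      assert (0 <= K * q ^ N / (1 - q)).
      { apply Rdiv_le_0_compat; [apply Rmult_le_pos; [lra|apply pow_le; lra] | lra]. }
      nra. }
    intros m n Hm Hn. apply C_NormedModule_mixin_compat1.
    replace (minus (z n) (z m)) with ((z n - z N) + - (z m - z N)) by (unfold minus, plus, opp; simpl; ring).
    eapply Rle_lt_trans; [apply Cmod_triangle|]. rewrite Cmod_opp.
    assert (E1 := HB m Hm). assert (E2 := HB n Hn).
    specialize (HN N (le_n N)). rewrite Rminus_0_r in HN.
    apply Rabs_lt_between in HN.
    replace (K / (1 - q) * 2 * q ^ N)%R with (K * q ^ N / (1 - q) + K * q ^ N / (1 - q))%R in HN by (field; lra).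
    lra. }
  apply cv_filterlim in Hl. now destruct (clim_spec _ _ Hl).
Qed.

(** Source of the domination estimates under the integral sign: it is applied at fixed [t] with a
    [K] that depends on [t], so that the dependence on [t] passes to the limit. *)
Lemma geometric_rate (z : nat -> C) (l : C) (K q : R) :
  (0 < q < 1)%R -> (forall n, (Cmod (z (S n) - z n) <= K * q ^ n)%R) -> cv z l ->
  forall n, (Cmod (z n - l) <= K / (1 - q) * q ^ n)%R.
Proof.
  intros Hq H Hl n.
  assert (HK := geometric_bound_nonneg _ _ _ H).
  apply (cv_le_const (fun k => z n - z (n + k)%nat)).
  - intros k.
    replace (z n - z (n + k)%nat) with (- (z (n + k)%nat - z n)) by ring.
    rewrite Cmod_opp.
    eapply Rle_trans; [apply (geometric_tail_le _ _ _ Hq H)|].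
    assert (0 <= q ^ k) by (apply pow_le; lra).
    assert (0 <= K * q ^ n / (1 - q)).
    { apply Rdiv_le_0_compat; [apply Rmult_le_pos; [lra|apply pow_le; lra] | lra]. }
    replace (K / (1 - q) * q ^ n)%R with (K * q ^ n / (1 - q))%R by (field; lra). nra.
  - apply cv_minus; [apply cv_const|].
    apply cv_ext with (fun k => z (k + n)%nat); [intros k; now rewrite Nat.add_comm|].
    now apply (cv_incr_n z l n).
Qed.

(** * Infinite products with geometrically small deviations from 1 *)

Fixpoint cprod (w : nat -> C) (n : nat) : C :=
  match n with O => 1 | S m => cprod w m * (1 + w m) end.

Lemma cprod_ext (w w' : nat -> C) (n : nat) :
  (forall j, w j = w' j) -> cprod w n = cprod w' n.
Proof. intros H. induction n; simpl; [easy|]. now rewrite IHn, H. Qed.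

Lemma cprod_split (w : nat -> C) (m n : nat) :
  cprod w (m + n) = cprod w m * cprod (fun j => w (m + j)%nat) n.
Proof.
  induction n as [|n IH].
  - rewrite Nat.add_0_r. simpl. ring.
  - rewrite Nat.add_succ_r. simpl. rewrite IH. ring.
Qed.

Lemma exp_le_1_plus (x : R) : (1 + x <= exp x)%R.
Proof.
  destruct (Req_dec x 0) as [->|H]; [rewrite exp_0; lra|].
  left. now apply exp_ineq1.
Qed.

Section Geometric_products.
Context (q : R) (hq : (0 < q < 1)%R).

(** The exponent is the partial sum of the bounds on [Cmod (w j)]. The induction needs this sharp
    form: one more factor adds [c * q ^ n] to the exponent, by 1 + x <= exp x. *)
Lemma cprod_minus_1_le_partial (w : nat -> C) (c : R) (n : nat) :
  (0 <= c)%R -> (forall j, (Cmod (w j) <= c * q ^ j)%R) ->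
  (Cmod (cprod w n - 1) <= exp (c * (1 - q ^ n) / (1 - q)) - 1)%R.
Proof.
  intros Hc H. induction n as [|n IH].
  - simpl. replace (1 - 1)%C with (RtoC 0) by ring. rewrite Cmod_0.
    replace (c * (1 - 1) / (1 - q))%R with 0%R by (field; lra). rewrite exp_0. lra.
  - simpl cprod.
    replace (cprod w n * (1 + w n) - 1)
      with ((cprod w n - 1) + ((cprod w n - 1) + 1) * w n) by ring.
    eapply Rle_trans; [apply Cmod_triangle|]. rewrite Cmod_mult.
    assert (T := Cmod_triangle (cprod w n - 1) 1). rewrite Cmod_1 in T.
    replace (c * (1 - q ^ S n) / (1 - q))%R
      with (c * (1 - q ^ n) / (1 - q) + c * q ^ n)%R by (simpl; field; lra).
    rewrite exp_plus.
    assert (E := exp_le_1_plus (c * q ^ n)).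
    specialize (H n).
    set (e := exp (c * (1 - q ^ n) / (1 - q))) in *.
    assert (0 < e) by apply exp_pos.
    assert (0 <= Cmod (w n)) by apply Cmod_ge_0.
    assert (0 <= Cmod (cprod w n - 1 + 1)) by apply Cmod_ge_0.
    assert (Cmod (cprod w n - 1 + 1) * Cmod (w n) <= e * (c * q ^ n)).
    { apply Rmult_le_compat; lra. }
    nra.
Qed.

Lemma cprod_minus_1_le (w : nat -> C) (c : R) (n : nat) :
  (0 <= c)%R -> (forall j, (Cmod (w j) <= c * q ^ j)%R) ->
  (Cmod (cprod w n - 1) <= exp (c / (1 - q)) - 1)%R.
Proof.
  intros Hc H. eapply Rle_trans; [apply (cprod_minus_1_le_partial w c n Hc H)|].
  assert (c * (1 - q ^ n) / (1 - q) <= c / (1 - q))%R.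
  { apply Rmult_le_compat_r; [left; apply Rinv_0_lt_compat; lra|].
    assert (0 <= q ^ n) by (apply pow_le; lra). nra. }
  destruct H0 as [H0| ->]; [|lra].
  apply exp_increasing in H0. lra.
Qed.

Lemma cprod_le (w : nat -> C) (c : R) (n : nat) :
  (0 <= c)%R -> (forall j, (Cmod (w j) <= c * q ^ j)%R) ->
  (Cmod (cprod w n) <= exp (c / (1 - q)))%R.
Proof.
  intros Hc H. assert (E := cprod_minus_1_le w c n Hc H).
  assert (T := Cmod_triangle (cprod w n - 1) 1). rewrite Cmod_1 in T.
  replace (cprod w n - 1 + 1) with (cprod w n) in T by ring. lra.
Qed.

Lemma cprod_step_le (w : nat -> C) (c : R) (n : nat) :
  (0 <= c)%R -> (forall j, (Cmod (w j) <= c * q ^ j)%R) ->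
  (Cmod (cprod w (S n) - cprod w n) <= exp (c / (1 - q)) * c * q ^ n)%R.
Proof.
  intros Hc H. simpl.
  replace (cprod w n * (1 + w n) - cprod w n) with (cprod w n * w n) by ring.
  rewrite Cmod_mult, Rmult_assoc.
  apply Rmult_le_compat; auto using Cmod_ge_0. now apply cprod_le.
Qed.

Lemma cprod_cv (w : nat -> C) (c : R) :
  (0 <= c)%R -> (forall j, (Cmod (w j) <= c * q ^ j)%R) -> cv (cprod w) (clim (cprod w)).
Proof.
  intros Hc H. apply geometric_cv with (exp (c / (1 - q)) * c)%R q; auto.
  intros n. now apply cprod_step_le.
Qed.

Lemma clim_cprod_minus_1_le (w : nat -> C) (c : R) :
  (0 <= c)%R -> (forall j, (Cmod (w j) <= c * q ^ j)%R) ->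
  (Cmod (clim (cprod w) - 1) <= exp (c / (1 - q)) - 1)%R.
Proof.
  intros Hc H. apply cv_le_const with (fun n => cprod w n - 1).
  - intros n. now apply cprod_minus_1_le.
  - apply cv_minus; [now apply cprod_cv with c|apply cv_const].
Qed.

Lemma clim_cprod_to_1 (w : nat -> nat -> C) (c : R) :
  (0 <= c)%R -> (forall N j, (Cmod (w N j) <= c * q ^ N * q ^ j)%R) ->
  cv (fun N => clim (cprod (w N))) 1.
Proof.
  intros Hc H.
  apply cv_squeeze with (fun N => exp (c / (1 - q) * q ^ N) - 1)%R.
  - intros N. replace (c / (1 - q) * q ^ N)%R with (c * q ^ N / (1 - q))%R by (field; lra).
    apply clim_cprod_minus_1_le; [|apply H].
    apply Rmult_le_pos; [lra|apply pow_le; lra].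
  - replace (Finite 0) with (Finite (exp 0 - 1)) by (rewrite exp_0; f_equal; ring).
    apply is_lim_seq_minus'; [|apply is_lim_seq_const].
    apply is_lim_seq_continuous; [apply derivable_continuous_pt, derivable_pt_exp|].
    now apply is_lim_seq_scal_geom.
Qed.

Lemma clim_cprod_split (w : nat -> C) (c : R) (m : nat) :
  (0 <= c)%R -> (forall j, (Cmod (w j) <= c * q ^ j)%R) ->
  clim (cprod w) = cprod w m * clim (cprod (fun j => w (m + j)%nat)).
Proof.
  intros Hc H. apply (cv_unique (cprod w)); [now apply cprod_cv with c|].
  apply (cv_incr_n _ _ m).
  apply cv_ext with (fun n => cprod w m * cprod (fun j => w (m + j)%nat) n).
  - intros n. now rewrite Nat.add_comm, cprod_split.
  - apply cv_scal. apply cprod_cv with c; auto.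
    intros j. eapply Rle_trans; [apply H|].
    rewrite pow_add.
    assert (0 < q ^ j) by (apply pow_lt; lra).
    assert (q ^ m <= 1) by (rewrite <- (pow1 m); apply pow_incr; lra).
    assert (0 < q ^ m) by (apply pow_lt; lra).
    apply Rmult_le_compat_l; nra.
Qed.

End Geometric_products.

(** * Symmetric q-shifted factorials *)

Lemma RtoC_neq_0 (x : R) : x <> 0%R -> RtoC x <> 0.
Proof. intros H E. apply H. now apply RtoC_inj. Qed.

Definition sfac (a : R) (Y : C) : C := 1 + a * a - a * Y.

Lemma sfac_joukowski (a : R) (v : C) :
  v <> 0 -> sfac a (v + / v) = (1 - a * v) * (1 - a / v).
Proof. intros H. unfold sfac. field. exact H. Qed.

(** Both [sfac a] and [sfac z] are affine in Y, and [sfac z] vanishes at z + 1/z; so the constant is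
    the value of [sfac a] there and [a / z] is the quotient of the slopes. This is the linear
    splitting behind the three-term recursion. *)
Lemma sfac_expand (a z : R) (Y : C) : z <> 0%R ->
  sfac a Y = RtoC ((1 - a * z) * (1 - a / z))%R + RtoC (a / z)%R * sfac z Y.
Proof.
  intros H. unfold sfac.
  rewrite RtoC_mult, !RtoC_minus, RtoC_div, RtoC_mult by auto.
  field. intros E. apply H. now apply RtoC_inj.
Qed.

Lemma sfac_0 (Y : C) : sfac 0 Y = 1.
Proof. unfold sfac. ring. Qed.

Lemma sfac_minus_1_le (a q : R) (Y : C) (j : nat) : (0 < q < 1)%R ->
  (Cmod (sfac (a * q ^ j) Y - 1) <= (a * a + Rabs a * Cmod Y) * q ^ j)%R.
Proof.
  intros hq. unfold sfac.
  replace (1 + RtoC (a * q ^ j) * RtoC (a * q ^ j) - RtoC (a * q ^ j) * Y - 1)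
    with (RtoC (a * q ^ j) * RtoC (a * q ^ j) + - (RtoC (a * q ^ j) * Y)) by ring.
  eapply Rle_trans; [apply Cmod_triangle|].
  rewrite Cmod_opp, !Cmod_mult, !Cmod_R, Rabs_mult.
  assert (0 < q ^ j) by (apply pow_lt; lra).
  assert (q ^ j <= 1) by (rewrite <- (pow1 j); apply pow_incr; lra).
  rewrite (Rabs_pos_eq (q ^ j)) by lra.
  assert (Rabs a * Rabs a = a * a)%R by (rewrite <- Rabs_mult; apply Rabs_pos_eq; nra).
  assert (Rabs a * q ^ j * (Rabs a * q ^ j) <= a * a * q ^ j)%R.
  { replace (Rabs a * q ^ j * (Rabs a * q ^ j))%R with (Rabs a * Rabs a * (q ^ j * q ^ j))%R by ring.
    rewrite H1. apply Rmult_le_compat_l; nra. }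
  nra.
Qed.

Lemma Cmod_ge_Re (z : C) (r : R) : (r <= Re z)%R -> (r <= Cmod z)%R.
Proof.
  intros H. eapply Rle_trans; [|apply re_le_Cmod].
  eapply Rle_trans; [exact H|apply Rle_abs].
Qed.

(** Already the real part, 1 + a^2 - a Re Y, is at least 1. *)
Lemma sfac_ge_1 (a : R) (Y : C) : (a * Re Y <= 0)%R -> (1 <= Cmod (sfac a Y))%R.
Proof.
  intros H. apply Cmod_ge_Re. unfold sfac, Re in *. simpl. nra.
Qed.

Section Products.
Context (q : R) (hq : (0 < q < 1)%R).

(** This is (a v, a/v; q)_n in the variable Y = v + 1/v. Writing each factor as 1 plus a deviation
    makes the estimates for [cprod] apply, and no preimage v of Y is required. *)
Definition spoch (a : R) (Y : C) (n : nat) : C :=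
  cprod (fun j => sfac (a * q ^ j) Y - 1) n.
Definition spoch_inf (a : R) (Y : C) : C := clim (spoch a Y).

Let dominating_constant (a : R) (Y : C) : (0 <= a * a + Rabs a * Cmod Y)%R.
Proof.
  assert (0 <= Rabs a) by apply Rabs_pos. assert (0 <= Cmod Y) by apply Cmod_ge_0. nra.
Qed.

Lemma spoch_S (a : R) (Y : C) (n : nat) :
  spoch a Y (S n) = spoch a Y n * sfac (a * q ^ n) Y.
Proof. unfold spoch. simpl. ring. Qed.

Lemma spoch_cv (a : R) (Y : C) : cv (spoch a Y) (spoch_inf a Y).
Proof.
  apply (cprod_cv q hq _ (a * a + Rabs a * Cmod Y)); auto.
  intros j. now apply sfac_minus_1_le.
Qed.

Lemma spoch_inf_split (a : R) (Y : C) (m : nat) :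
  spoch_inf a Y = spoch a Y m * spoch_inf (a * q ^ m) Y.
Proof.
  unfold spoch_inf at 1, spoch at 1.
  rewrite (clim_cprod_split q hq _ (a * a + Rabs a * Cmod Y) m); auto.
  2: now intros j; apply sfac_minus_1_le.
  unfold spoch at 1. f_equal. apply (cv_unique (spoch (a * q ^ m) Y)); [|apply spoch_cv].
  apply cv_ext with (cprod (fun j => sfac (a * q ^ (m + j)) Y - 1)).
  - intros n. apply cprod_ext. intros j. now rewrite pow_add, Rmult_assoc.
  - apply (cprod_cv q hq _ (a * a + Rabs a * Cmod Y)); auto.
    intros j. eapply Rle_trans; [now apply sfac_minus_1_le|].
    rewrite pow_add.
    assert (0 < q ^ j) by (apply pow_lt; lra).
    assert (0 < q ^ m) by (apply pow_lt; lra).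
    assert (q ^ m <= 1) by (rewrite <- (pow1 m); apply pow_incr; lra).
    apply Rmult_le_compat_l; [auto|nra].
Qed.

Lemma spoch_inf_head (a : R) (Y : C) :
  spoch_inf a Y = sfac a Y * spoch_inf (a * q) Y.
Proof.
  rewrite (spoch_inf_split a Y 1), spoch_S. unfold spoch. simpl.
  rewrite !Rmult_1_r. ring.
Qed.

Lemma spoch_0 (Y : C) (n : nat) : spoch 0 Y n = 1.
Proof.
  induction n as [|n IH]; [reflexivity|].
  rewrite spoch_S, IH, Rmult_0_l, sfac_0. ring.
Qed.

Lemma spoch_inf_0 (Y : C) : spoch_inf 0 Y = 1.
Proof.
  apply (cv_unique (spoch 0 Y)); [apply spoch_cv|].
  apply cv_ext with (fun _ => 1); [intros n; now rewrite spoch_0|apply cv_const].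
Qed.

Lemma spoch_inf_to_1 (a : R) (Y : C) : cv (fun N => spoch_inf (a * q ^ N) Y) 1.
Proof.
  apply (clim_cprod_to_1 q hq (fun N j => sfac (a * q ^ N * q ^ j) Y - 1)
    (a * a + Rabs a * Cmod Y)); auto.
  intros N j. rewrite (Rmult_assoc a), (Rmult_assoc _ (q ^ N)), <- pow_add.
  now apply sfac_minus_1_le.
Qed.

Lemma qpoch_cprod (x : C) (n : nat) :
  qpoch q x n = cprod (fun j => - (RtoC (q ^ j) * x)) n.
Proof. induction n; simpl; [easy|]. rewrite IHn. ring. Qed.

Lemma qpoch_factor_le (x : C) (j : nat) :
  (Cmod (- (RtoC (q ^ j) * x)) <= Cmod x * q ^ j)%R.
Proof.
  rewrite Cmod_opp, Cmod_mult, Cmod_R, Rabs_pos_eq by (apply pow_le; lra). lra.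
Qed.

Lemma qpoch_cv (x : C) : cv (qpoch q x) (qpoch_inf q x).
Proof.
  assert (H := cprod_cv q hq _ (Cmod x) (Cmod_ge_0 x) (qpoch_factor_le x)).
  apply (cv_ext _ (qpoch q x)) in H; [|intros n; now rewrite qpoch_cprod].
  now apply clim_spec in H.
Qed.

Lemma qpoch_le (x : C) (n : nat) : (Cmod (qpoch q x n) <= exp (Cmod x / (1 - q)))%R.
Proof.
  rewrite qpoch_cprod. apply cprod_le; auto using Cmod_ge_0, qpoch_factor_le.
Qed.

Lemma qpoch_split (x : C) (m n : nat) :
  qpoch q x (m + n) = qpoch q x m * qpoch q (x * RtoC (q ^ m)) n.
Proof.
  rewrite !qpoch_cprod, cprod_split. f_equal. apply cprod_ext.
  intros j. rewrite pow_add, RtoC_mult. ring.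
Qed.

Lemma qpoch_inf_split (x : C) (m : nat) :
  qpoch_inf q x = qpoch q x m * qpoch_inf q (x * RtoC (q ^ m)).
Proof.
  apply (cv_unique (qpoch q x)); [apply qpoch_cv|].
  apply (cv_incr_n _ _ m).
  apply cv_ext with (fun n => qpoch q x m * qpoch q (x * RtoC (q ^ m)) n).
  - intros n. now rewrite Nat.add_comm, qpoch_split.
  - apply cv_scal, qpoch_cv.
Qed.

Lemma qpoch_inf_head (x : C) : qpoch_inf q x = (1 - x) * qpoch_inf q (x * RtoC q).
Proof.
  rewrite (qpoch_inf_split x 1). simpl. rewrite Rmult_1_r. ring.
Qed.

Lemma qpoch_inf_0 : qpoch_inf q 0 = 1.
Proof.
  apply (cv_unique (qpoch q 0)); [apply qpoch_cv|].
  apply cv_ext with (fun _ => RtoC 1); [|apply cv_const].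
  induction n; simpl; [easy|]. rewrite <- IHn. ring.
Qed.

Lemma qpoch_inf_to_1 (x : C) : cv (fun N => qpoch_inf q (x * RtoC (q ^ N))) 1.
Proof.
  apply cv_ext with (fun N => clim (cprod (fun j => - (RtoC (q ^ j) * (x * RtoC (q ^ N)))))).
  - intros N. apply (cv_unique (qpoch q (x * RtoC (q ^ N)))); [|apply qpoch_cv].
    apply cv_ext with (cprod (fun j => - (RtoC (q ^ j) * (x * RtoC (q ^ N))))).
    + intros n. now rewrite qpoch_cprod.
    + apply (cprod_cv q hq _ (Cmod (x * RtoC (q ^ N)))); auto using Cmod_ge_0, qpoch_factor_le.
  - apply (clim_cprod_to_1 q hq _ (Cmod x)); [apply Cmod_ge_0|].
    intros N j. eapply Rle_trans; [apply qpoch_factor_le|].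
    rewrite Cmod_mult, Cmod_R, Rabs_pos_eq by (apply pow_le; lra). lra.
Qed.

Lemma qpoch_neq_0 (x : C) (n : nat) :
  (forall j, 1 - RtoC (q ^ j) * x <> 0) -> qpoch q x n <> 0.
Proof.
  intros H. induction n; simpl.
  - apply RtoC_neq_0. lra.
  - now apply Cmult_neq_0.
Qed.

(** The tails tend to 1, so some tail is nonzero; the finitely many factors in front of it are
    nonzero by hypothesis. *)
Lemma qpoch_inf_neq_0 (x : C) :
  (forall j, 1 - RtoC (q ^ j) * x <> 0) -> qpoch_inf q x <> 0.
Proof.
  intros H.
  destruct (cv_neq_0_eventually _ _ (qpoch_inf_to_1 x)) as [N HN].
  { apply RtoC_neq_0. lra. }
  rewrite (qpoch_inf_split x N). apply Cmult_neq_0; auto using qpoch_neq_0.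
Qed.

Lemma spoch_joukowski (a : R) (v : C) (n : nat) : v <> 0 ->
  spoch a (v + / v) n = qpoch q (a * v) n * qpoch q (a / v) n.
Proof.
  intros Hv. induction n as [|n IH].
  - unfold spoch. simpl. ring.
  - rewrite spoch_S, IH, sfac_joukowski by auto. simpl. rewrite RtoC_mult.
    unfold Cdiv. ring.
Qed.

Lemma spoch_inf_joukowski (a : R) (v : C) : v <> 0 ->
  spoch_inf a (v + / v) = qpoch_inf q (a * v) * qpoch_inf q (a / v).
Proof.
  intros Hv. apply (cv_unique (spoch a (v + / v))); [apply spoch_cv|].
  apply cv_ext with (fun n => qpoch q (a * v) n * qpoch q (a / v) n).
  - intros n. now rewrite spoch_joukowski.
  - apply cv_mult; apply qpoch_cv.
Qed.

Lemma spoch_ge_1 (a : R) (Y : C) (n : nat) :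
  (a * Re Y <= 0)%R -> (1 <= Cmod (spoch a Y n))%R.
Proof.
  intros H. induction n as [|n IH].
  - unfold spoch. simpl. rewrite Cmod_1. lra.
  - rewrite spoch_S, Cmod_mult.
    assert (1 <= Cmod (sfac (a * q ^ n) Y)).
    { apply sfac_ge_1. assert (0 < q ^ n) by (apply pow_lt; lra). nra. }
    nra.
Qed.

Lemma spoch_inf_ge_1 (a : R) (Y : C) :
  (a * Re Y <= 0)%R -> (1 <= Cmod (spoch_inf a Y))%R.
Proof.
  intros H. apply (cv_ge_const (spoch a Y)); [|apply spoch_cv].
  intros n. now apply spoch_ge_1.
Qed.

Lemma spoch_neq_0 (a : R) (Y : C) (n : nat) : (a * Re Y <= 0)%R -> spoch a Y n <> 0.
Proof. intros H. apply Cmod_gt_0. assert (E := spoch_ge_1 a Y n H). lra. Qed.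

Lemma spoch_inf_neq_0 (a : R) (Y : C) : (a * Re Y <= 0)%R -> spoch_inf a Y <> 0.
Proof. intros H. apply Cmod_gt_0. assert (E := spoch_inf_ge_1 a Y H). lra. Qed.

End Products.

(** * Growth on the imaginary axis *)

Definition axis (t : R) : C := (0%R, t).

Definition weight (t : R) : R := sqrt (1 + t * t).

Lemma weight_sqr (t : R) : (weight t * weight t = 1 + t * t)%R.
Proof. apply sqrt_sqrt. nra. Qed.

Lemma weight_pos (t : R) : (0 < weight t)%R.
Proof. apply sqrt_lt_R0. nra. Qed.

Lemma weight_ge_1 (t : R) : (1 <= weight t)%R.
Proof. assert (H := weight_sqr t). assert (P := weight_pos t). nra. Qed.

Lemma weight_ge_abs (t : R) : (Rabs t <= weight t)%R.
Proof.
  assert (H := weight_sqr t). assert (P := weight_pos t). apply Rabs_le. nra.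
Qed.

Lemma Cmod_sqr (z : C) : (Cmod z * Cmod z = fst z * fst z + snd z * snd z)%R.
Proof. unfold Cmod. rewrite sqrt_sqrt; simpl; nra. Qed.

Lemma Cmod_sqr_le (z w : C) :
  (fst z * fst z + snd z * snd z <= fst w * fst w + snd w * snd w)%R ->
  (Cmod z <= Cmod w)%R.
Proof.
  rewrite <- !Cmod_sqr. assert (0 <= Cmod z) by apply Cmod_ge_0.
  assert (0 <= Cmod w) by apply Cmod_ge_0. nra.
Qed.

Lemma sfac_axis (a t : R) : sfac a (axis t) = (1 + a * a, - (a * t))%R.
Proof. unfold sfac, axis. apply injective_projections; simpl; ring. Qed.

(** On the axis the squared modulus is (1 + a^2)^2 + a^2 t^2, increasing in |a|. This lets one fixed
    quotient dominate the quotients for all small parameters. *)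
Lemma sfac_axis_mono (a b t : R) : (Rabs a <= b)%R ->
  (Cmod (sfac a (axis t)) <= Cmod (sfac b (axis t)))%R.
Proof.
  intros H. apply Cmod_sqr_le. rewrite !sfac_axis. simpl.
  apply Rabs_le_between in H.
  assert (a * a <= b * b)%R by nra.
  assert (a * a * (t * t) <= b * b * (t * t))%R by (apply Rmult_le_compat_r; nra). nra.
Qed.

Lemma sfac_axis_minus_1_le (a t : R) :
  (Cmod (sfac a (axis t) - 1) <= (a * a + Rabs a) * weight t)%R.
Proof.
  assert (W := weight_ge_1 t). assert (T := weight_ge_abs t).
  replace (sfac a (axis t) - 1) with (RtoC (a * a) + - (a * axis t))
    by (unfold sfac; rewrite RtoC_mult; ring).
  eapply Rle_trans; [apply Cmod_triangle|].
  rewrite Cmod_opp, Cmod_mult, !Cmod_R.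
  replace (Cmod (axis t)) with (Rabs t).
  - rewrite Rabs_pos_eq by nra. assert (0 <= Rabs a) by apply Rabs_pos. nra.
  - unfold Cmod, axis. simpl. replace (0 * (0 * 1) + t * (t * 1))%R with (Rsqr t) by (unfold Rsqr; ring).
    symmetry. apply sqrt_Rsqr_abs.
Qed.

Lemma sfac_axis_le (a t : R) :
  (Cmod (sfac a (axis t)) <= (1 + a * a + Rabs a) * weight t)%R.
Proof.
  assert (W := weight_ge_1 t). assert (H := sfac_axis_minus_1_le a t).
  replace (sfac a (axis t)) with ((sfac a (axis t) - 1) + 1) by ring.
  eapply Rle_trans; [apply Cmod_triangle|]. rewrite Cmod_1. nra.
Qed.

Lemma sfac_axis_ge (a t : R) :
  (Rmin 1 (Rabs a) * weight t <= Cmod (sfac a (axis t)))%R.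
Proof.
  assert (P := weight_pos t). assert (E := weight_sqr t).
  assert (Q := Cmod_sqr (sfac a (axis t))). rewrite sfac_axis in Q at 3 4 5 6. simpl in Q.
  assert (0 <= Cmod (sfac a (axis t))) by apply Cmod_ge_0.
  assert (M1 := Rmin_l 1 (Rabs a)). assert (M2 := Rmin_r 1 (Rabs a)).
  assert (0 <= Rmin 1 (Rabs a)) by (apply Rmin_glb; [lra|apply Rabs_pos]).
  assert (A2 : (Rabs a * Rabs a = a * a)%R) by (rewrite <- Rabs_mult; apply Rabs_pos_eq; nra).
  set (m := Rmin 1 (Rabs a)) in *. set (z := Cmod (sfac a (axis t))) in *.
  assert (m * m <= 1)%R by nra.
  assert (m * m <= a * a)%R by nra.
  assert (m * m * (t * t) <= a * a * (t * t))%R by (apply Rmult_le_compat_r; nra).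
  apply Rsqr_incr_0_var; [|auto]. unfold Rsqr.
  replace (m * weight t * (m * weight t))%R with (m * m * (weight t * weight t))%R by ring.
  rewrite E, Q. nra.
Qed.

Lemma Cmod_axis_minus_ge (X : C) : Re X <> 0%R ->
  exists K, (0 < K)%R /\ forall t, (weight t <= K * Cmod (axis t - X))%R.
Proof.
  intros H. destruct X as [x y]. unfold Re in H. simpl in H.
  (* Chosen so that M x^2 = 2 x^2 + 2 y^2 + 1 and M >= 2. Then 1 + t^2 <= M (x^2 + (t - y)^2)
     follows from t^2 <= 2 (t - y)^2 + 2 y^2, which is (t - 2 y)^2 >= 0. *)
  set (M := (2 + (2 * (y * y) + 1) / (x * x))%R).
  assert (0 < x * x)%R by nra.
  assert (HM2 : (2 <= M)%R).
  { unfold M. assert (0 < (2 * (y * y) + 1) / (x * x))%R by (apply Rdiv_lt_0_compat; nra). lra. }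
  assert (HM : (0 < M)%R) by lra.
  exists (sqrt M). split; [now apply sqrt_lt_R0|].
  intros t.
  assert (P := weight_pos t). assert (E := weight_sqr t).
  assert (Q := Cmod_sqr (axis t - (x, y))). simpl in Q.
  assert (0 <= Cmod (axis t - (x, y))) by apply Cmod_ge_0.
  assert (S := sqrt_sqrt M (Rlt_le _ _ HM)). assert (S0 := sqrt_lt_R0 M HM).
  set (z := Cmod (axis t - (x, y))) in *.
  apply Rsqr_incr_0_var; [|nra]. unfold Rsqr.
  replace (sqrt M * z * (sqrt M * z))%R with (sqrt M * sqrt M * (z * z))%R by ring.
  rewrite S, Q, E.
  replace ((0 + - x) * (0 + - x) + (t + - y) * (t + - y))%R with (x * x + (t - y) * (t - y))%R by ring.
  assert (M * (x * x) = 2 * (x * x) + 2 * (y * y) + 1)%R by (unfold M; field; auto).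
  assert (0 <= (M - 2) * ((t - y) * (t - y)))%R by (apply Rmult_le_pos; [lra|apply Rle_0_sqr]).
  assert (0 <= (t - 2 * y) * (t - 2 * y))%R by apply Rle_0_sqr.
  rewrite Rmult_plus_distr_l, H2. nra.
Qed.

Lemma axis_minus_neq_0 (X : C) (t : R) : Re X <> 0%R -> axis t - X <> 0.
Proof.
  intros H E. apply H. apply (f_equal fst) in E. unfold Re. simpl in E. lra.
Qed.

(** * Newton coefficients *)

Fixpoint csum (f : nat -> C) (n : nat) : C :=
  match n with O => 0 | S m => csum f m + f m end.

Lemma csum_ext (f g : nat -> C) (n : nat) :
  (forall k, f k = g k) -> csum f n = csum g n.
Proof. intros H. induction n; simpl; [easy|]. now rewrite IHn, H. Qed.

Lemma csum_cv (f : nat -> nat -> C) (g : nat -> C) (n : nat) :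
  (forall k, cv (fun N => f N k) (g k)) -> cv (fun N => csum (f N) n) (csum g n).
Proof.
  intros H. induction n; simpl; [apply cv_const|]. now apply cv_plus.
Qed.

Section Coefficients.
Context (q beta xi : R) (hq : (0 < q < 1)%R) (hbeta : (0 < beta)%R) (hxi : (xi < 0)%R).

Lemma one_minus_nonpos_neq_0 (x : R) (j : nat) :
  (x <= 0)%R -> 1 - RtoC (q ^ j) * RtoC x <> 0.
Proof.
  intros H. rewrite <- RtoC_mult, <- RtoC_minus. apply RtoC_neq_0.
  assert (0 < q ^ j) by (apply pow_lt; lra). nra.
Qed.

Lemma qpoch_q_neq_0 (n : nat) : qpoch q q n <> 0.
Proof.
  apply qpoch_neq_0. intros j.
  rewrite <- RtoC_mult, <- RtoC_minus. apply RtoC_neq_0.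
  assert (0 < q ^ j) by (apply pow_lt; lra).
  assert (q ^ j <= 1) by (rewrite <- (pow1 j); apply pow_incr; lra). nra.
Qed.

Lemma qxi_div_beta_neg : (q * xi / beta < 0)%R.
Proof.
  unfold Rdiv. assert (0 < / beta) by now apply Rinv_0_lt_compat.
  assert (0 < q * (/ beta))%R by (apply Rmult_lt_0_compat; lra). nra.
Qed.

Lemma beta_div_xi_neg : (beta / xi < 0)%R.
Proof. unfold Rdiv. assert (/ xi < 0) by now apply Rinv_lt_0_compat. nra. Qed.

Lemma beta_mul_xi_neg : (beta * xi < 0)%R.
Proof. nra. Qed.

Definition node (n : nat) : R := (xi * q ^ n)%R.

Lemma node_neg (n : nat) : (node n < 0)%R.
Proof. unfold node. assert (0 < q ^ n) by (apply pow_lt; lra). nra. Qed.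

(* The value of [sfac a] at the [n]-th interpolation node. *)
Definition sfac_node (a : R) (n : nat) : R := ((1 - a * node n) * (1 - a / node n))%R.

(* [(a xi)_oo / (a xi)_k] is written as [(a xi q^k)_oo], which makes sense for every [a]. *)
Definition cof (a : R) (k : nat) : C :=
  qpoch_inf q (RtoC (a * xi * q ^ k)) * qpoch_inf q (RtoC (a / xi))
  / (qpoch_inf q (RtoC (beta * xi)) * qpoch_inf q (RtoC (beta / xi)))
  * (qpoch q (RtoC (a / beta)) k * RtoC (q ^ k)
     / (qpoch q (RtoC q) k * qpoch q (RtoC (q * xi / beta)) k)).

Lemma qpoch_inf_nonpos_neq_0 (x : R) : (x <= 0)%R -> qpoch_inf q (RtoC x) <> 0.
Proof. intros H. apply qpoch_inf_neq_0; auto. intros j. now apply one_minus_nonpos_neq_0. Qed.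

Lemma qpoch_nonpos_neq_0 (x : R) (n : nat) : (x <= 0)%R -> qpoch q (RtoC x) n <> 0.
Proof. intros H. apply qpoch_neq_0; auto. intros j. now apply one_minus_nonpos_neq_0. Qed.

Lemma qpoch_head_R (x : R) (n : nat) :
  qpoch q (RtoC x) (S n) = (1 - RtoC x) * qpoch q (RtoC (x * q)) n.
Proof.
  change (S n) with (1 + n)%nat. rewrite qpoch_split. simpl. rewrite Rmult_1_r, RtoC_mult. ring.
Qed.

Lemma qpoch_inf_head_R (x : R) :
  qpoch_inf q (RtoC x) = (1 - RtoC x) * qpoch_inf q (RtoC (x * q)).
Proof. rewrite RtoC_mult. now apply qpoch_inf_head. Qed.

Lemma cof_0_rec (a : R) : cof a 0 = RtoC (sfac_node a 0) * cof (a * q) 0.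
Proof.
  unfold cof, sfac_node, node.
  rewrite (qpoch_inf_head_R (a * xi * q ^ 0)), (qpoch_inf_head_R (a / xi)).
  replace (a * q / xi)%R with (a / xi * q)%R by (field; lra).
  replace (a * q * xi * q ^ 0)%R with (a * xi * q ^ 0 * q)%R by ring.
  assert (qpoch_inf q (RtoC (beta * xi)) <> 0)
    by (apply qpoch_inf_nonpos_neq_0; left; apply beta_mul_xi_neg).
  assert (qpoch_inf q (RtoC (beta / xi)) <> 0)
    by (apply qpoch_inf_nonpos_neq_0; left; apply beta_div_xi_neg).
  simpl. rewrite !Rmult_1_r, (RtoC_mult (1 - _)), !RtoC_minus. field.
  split; auto.
Qed.

(** What comparison of coefficients predicts from [ratio a = sfac a * ratio (a * q)]: expanding
    [sfac a] at the k-th node sends the k-th basis product to a multiple of itself plus [a / node k]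
    times the next one. The proof is a direct verification. *)
Lemma cof_S_rec (a : R) (k : nat) :
  cof a (S k) = RtoC (sfac_node a (S k)) * cof (a * q) (S k)
                + RtoC (a / node k) * cof (a * q) k.
Proof.
  unfold cof, sfac_node, node.
  rewrite (qpoch_inf_head_R (a * xi * q ^ S k)), (qpoch_inf_head_R (a / xi)).
  replace (a * q / xi)%R with (a / xi * q)%R by (field; lra).
  replace (a * q * xi * q ^ S k)%R with (a * xi * q ^ S k * q)%R by ring.
  replace (a * q * xi * q ^ k)%R with (a * xi * q ^ S k)%R by (simpl; ring).
  rewrite (qpoch_inf_head_R (a * xi * q ^ S k)).
  rewrite (qpoch_head_R (a / beta)).
  replace (a * q / beta)%R with (a / beta * q)%R by (field; lra).
  change (qpoch q (RtoC (a / beta * q)) (S k))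
    with (qpoch q (RtoC (a / beta * q)) k * (1 - RtoC (q ^ k) * RtoC (a / beta * q))).
  change (qpoch q (RtoC q) (S k)) with (qpoch q (RtoC q) k * (1 - RtoC (q ^ k) * RtoC q)).
  change (qpoch q (RtoC (q * xi / beta)) (S k))
    with (qpoch q (RtoC (q * xi / beta)) k * (1 - RtoC (q ^ k) * RtoC (q * xi / beta))).
  assert (H1 : qpoch_inf q (RtoC (beta * xi)) <> 0)
    by (apply qpoch_inf_nonpos_neq_0; left; apply beta_mul_xi_neg).
  assert (H2 : qpoch_inf q (RtoC (beta / xi)) <> 0)
    by (apply qpoch_inf_nonpos_neq_0; left; apply beta_div_xi_neg).
  assert (H3 := qpoch_q_neq_0 k).
  assert (H4 : qpoch q (RtoC (q * xi / beta)) k <> 0)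
    by (apply qpoch_nonpos_neq_0; left; apply qxi_div_beta_neg).
  assert (H5 : 1 - RtoC (q ^ k) * RtoC (q * xi / beta) <> 0)
    by (apply one_minus_nonpos_neq_0; left; apply qxi_div_beta_neg).
  assert (H6 : 1 - RtoC (q ^ k) * RtoC q <> 0).
  { intros E. apply (qpoch_q_neq_0 (S k)). simpl. rewrite E. ring. }
  (* After the heads of the products have been split off, the remaining products are opaque atoms,
     and with z for [q ^ k] the claim is an identity of rational functions. *)
  generalize dependent (qpoch q (RtoC (q * xi / beta)) k).
  generalize dependent (qpoch q (RtoC q) k).
  generalize dependent (qpoch_inf q (RtoC (beta * xi))).
  generalize dependent (qpoch_inf q (RtoC (beta / xi))).
  generalize (qpoch q (RtoC (a / beta * q)) k).
  generalize (qpoch_inf q (RtoC (a / xi * q))).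
  generalize (qpoch_inf q (RtoC (a * xi * q ^ S k * q))).
  intros c1 c2 c3 d1 D1 d2 D2 d3 D3 d4 D4.
  assert (Z : (q ^ k <> 0)%R) by (apply pow_nonzero; lra).
  assert (B : (beta <> 0)%R) by lra. assert (X : (xi <> 0)%R) by lra.
  assert (Q : (q <> 0)%R) by lra.
  simpl pow. generalize dependent (q ^ k)%R. intros z H5 H6 Z.
  assert (RtoC z <> 0) by now apply RtoC_neq_0.
  assert (RtoC beta <> 0) by now apply RtoC_neq_0.
  assert (RtoC xi <> 0) by now apply RtoC_neq_0.
  assert (RtoC q <> 0) by now apply RtoC_neq_0.
  assert (q * z <> 0)%R by (apply Rmult_integral_contrapositive; auto).
  assert (xi * (q * z) <> 0)%R by (apply Rmult_integral_contrapositive; auto).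
  assert (xi * z <> 0)%R by (apply Rmult_integral_contrapositive; auto).
  rewrite RtoC_div, !RtoC_mult in H5 by auto.
  repeat (rewrite ?RtoC_mult, ?RtoC_minus, ?RtoC_div by auto).
  field.
  repeat split; auto.
  - intros E. apply H5.
    transitivity ((RtoC beta - RtoC z * (RtoC q * RtoC xi)) / RtoC beta); [field; auto|].
    rewrite E. unfold Cdiv. ring.
Qed.

Lemma cof_beta_0 : cof beta 0 = 1.
Proof.
  unfold cof. simpl. rewrite Rmult_1_r.
  assert (H1 : qpoch_inf q (RtoC (beta * xi)) <> 0)
    by (apply qpoch_inf_nonpos_neq_0; left; apply beta_mul_xi_neg).
  assert (H2 : qpoch_inf q (RtoC (beta / xi)) <> 0)
    by (apply qpoch_inf_nonpos_neq_0; left; apply beta_div_xi_neg).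
  field. auto.
Qed.

(** The factor (1; q)_(k+1) vanishes, as it must: for [a = beta] the interpolated function is the
    constant 1. *)
Lemma cof_beta_S (k : nat) : cof beta (S k) = 0.
Proof.
  unfold cof. rewrite (qpoch_head_R (beta / beta)).
  replace (beta / beta)%R with 1%R by (field; lra).
  replace (1 - RtoC 1) with (RtoC 0) by ring. unfold Cdiv. ring.
Qed.

Lemma qpoch_shift_cv (x : R) (k : nat) : cv (fun N => qpoch q (RtoC (x * q ^ N)) k) 1.
Proof.
  induction k as [|k IH]; simpl; [apply cv_const|].
  replace (RtoC 1) with (1 * (1 - RtoC (q ^ k) * 0)) at 1 by ring.
  apply cv_mult; [exact IH|].
  apply cv_minus; [apply cv_const|]. apply cv_scal.
  apply cv_squeeze with (fun N => Rabs x * q ^ N)%R; [|now apply is_lim_seq_scal_geom].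
  intros N. rewrite <- RtoC_minus, Rminus_0_r, Cmod_R, Rabs_mult.
  rewrite (Rabs_pos_eq (q ^ N)) by (apply pow_le; lra). lra.
Qed.

Lemma qpoch_inf_shift_cv (x : R) : cv (fun N => qpoch_inf q (RtoC (x * q ^ N))) 1.
Proof.
  apply cv_ext with (fun N => qpoch_inf q (RtoC x * RtoC (q ^ N))).
  - intros N. now rewrite RtoC_mult.
  - now apply qpoch_inf_to_1.
Qed.

Lemma qpoch_0 (k : nat) : qpoch q 0 k = 1.
Proof. induction k; simpl; [easy|]. rewrite IHk. ring. Qed.

Lemma cof_shift_cv (a : R) (k : nat) : cv (fun N => cof (a * q ^ N) k) (cof 0 k).
Proof.
  unfold cof.
  replace (0 * xi * q ^ k)%R with 0%R by ring.
  replace (0 / xi)%R with 0%R by (field; lra).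
  replace (0 / beta)%R with 0%R by (field; lra).
  rewrite qpoch_inf_0, qpoch_0 by auto.
  unfold Cdiv. apply cv_mult; (apply cv_mult; [apply cv_mult|apply cv_const]).
  - apply cv_ext with (fun N => qpoch_inf q (RtoC (a * xi * q ^ k * q ^ N))).
    + intros N. do 2 f_equal. ring.
    + apply qpoch_inf_shift_cv.
  - apply cv_ext with (fun N => qpoch_inf q (RtoC (a / xi * q ^ N))).
    + intros N. do 2 f_equal. field. lra.
    + apply qpoch_inf_shift_cv.
  - apply cv_ext with (fun N => qpoch q (RtoC (a / beta * q ^ N)) k).
    + intros N. f_equal. f_equal. field. lra.
    + apply qpoch_shift_cv.
  - apply cv_const.
Qed.

Definition ratio (a : R) (Y : C) : C := spoch_inf q a Y / spoch_inf q beta Y.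

(* Remainder of the Newton interpolation of [ratio a] at the first [n] nodes. *)
Definition remainder (n : nat) (a : R) (X : C) : C :=
  ratio a X - csum (fun k => cof a k * spoch q xi X k) n.

Lemma ratio_head (a : R) (Y : C) : ratio a Y = sfac a Y * ratio (a * q) Y.
Proof. unfold ratio. rewrite (spoch_inf_head q hq a Y). unfold Cdiv. ring. Qed.

Lemma sfac_expand_node (a : R) (n : nat) (Y : C) :
  sfac a Y = RtoC (sfac_node a n) + RtoC (a / node n) * sfac (node n) Y.
Proof. apply sfac_expand. assert (H := node_neg n). lra. Qed.

Lemma remainder_rec (n : nat) (a : R) (X : C) :
  remainder (S n) a X =
    RtoC (a / node n) * sfac (node n) X * remainder n (a * q) X
    + RtoC (sfac_node a n) * remainder (S n) (a * q) X.
Proof.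
  unfold remainder. rewrite (ratio_head a).
  (* The terms below the last one are multiplied by the whole of [sfac a]. Of the last term only the
     part at the node survives, because its linear part would land on [spoch q xi X (S n)], beyond
     the truncation. This causes the drop from [S n] to [n] in the recursion. *)
  assert (E : csum (fun k => cof a k * spoch q xi X k) (S n) =
    sfac a X * csum (fun k => cof (a * q) k * spoch q xi X k) n
    + RtoC (sfac_node a n) * (cof (a * q) n * spoch q xi X n)).
  { induction n as [|n IH].
    - simpl. rewrite cof_0_rec. unfold spoch. simpl. ring.
    - change (csum (fun k => cof a k * spoch q xi X k) (S (S n)))
        with (csum (fun k => cof a k * spoch q xi X k) (S n) + cof a (S n) * spoch q xi X (S n)).
      rewrite IH, cof_S_rec.
      change (csum (fun k => cof (a * q) k * spoch q xi X k) (S n))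
        with (csum (fun k => cof (a * q) k * spoch q xi X k) n + cof (a * q) n * spoch q xi X n).
      rewrite (spoch_S q), (sfac_expand_node a n). fold (node n). ring. }
  rewrite E.
  change (csum (fun k => cof (a * q) k * spoch q xi X k) (S n))
    with (csum (fun k => cof (a * q) k * spoch q xi X k) n + cof (a * q) n * spoch q xi X n).
  rewrite (sfac_expand_node a n). ring.
Qed.

Lemma remainder_shift_cv (n : nat) (a : R) (X : C) :
  cv (fun N => remainder n (a * q ^ N) X) (remainder n 0 X).
Proof.
  unfold remainder, ratio. apply cv_minus.
  - unfold Cdiv. apply cv_mult; [|apply cv_const]. rewrite spoch_inf_0 by auto.
    now apply spoch_inf_to_1.
  - apply (csum_cv (fun N k => cof (a * q ^ N) k * spoch q xi X k)).
    intros k. apply cv_mult; [apply cof_shift_cv|apply cv_const].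
Qed.

Lemma remainder_beta (n : nat) (X : C) : (Re X <= 0)%R -> remainder (S n) beta X = 0.
Proof.
  intros H. unfold remainder, ratio.
  assert (spoch_inf q beta X <> 0) by (apply spoch_inf_neq_0; auto; nra).
  assert (E : csum (fun k => cof beta k * spoch q xi X k) (S n) = 1).
  { induction n as [|n IH].
    - simpl. rewrite cof_beta_0. unfold spoch. simpl. ring.
    - simpl in *. rewrite IH, cof_beta_S. ring. }
  rewrite E. field. auto.
Qed.

End Coefficients.

(** * Integrals over the real line *)

Definition RI (h : R -> R) (l : R) : Prop :=
  is_RInt_gen (V := R_NormedModule) h (Rbar_locally m_infty) (Rbar_locally p_infty) l.

Lemma RI_plus (f g : R -> R) (a b : R) :
  RI f a -> RI g b -> RI (fun t => f t + g t)%R (a + b)%R.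
Proof. exact (is_RInt_gen_plus (V := R_NormedModule) f g a b). Qed.

Lemma RI_scal (f : R -> R) (k a : R) : RI f a -> RI (fun t => k * f t)%R (k * a)%R.
Proof. exact (is_RInt_gen_scal (V := R_NormedModule) f k a). Qed.

Lemma RI_ext (f g : R -> R) (a : R) : (forall t, f t = g t) -> RI f a -> RI g a.
Proof.
  intros H Hf.
  refine (is_RInt_gen_ext (V := R_NormedModule) (Fa := Rbar_locally m_infty)
    (Fb := Rbar_locally p_infty) f g a _ Hf).
  apply filter_forall. intros ab t _. apply H.
Qed.

Lemma RI_unique (f : R -> R) (a b : R) : RI f a -> RI f b -> a = b.
Proof.
  intros Ha Hb.
  rewrite <- (is_RInt_gen_unique (V := R_CompleteNormedModule) f a Ha).
  exact (is_RInt_gen_unique (V := R_CompleteNormedModule) f b Hb).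
Qed.

Lemma filter_prod_infty_le :
  filter_prod (Rbar_locally m_infty) (Rbar_locally p_infty)
    (fun ab : R * R => fst ab <= snd ab).
Proof.
  apply (Filter_prod _ _ _ (fun a => a < 0) (fun b => 0 < b)).
  - exists 0%R. auto.
  - exists 0%R. auto.
  - simpl. intros. lra.
Qed.

Lemma RI_primitive (G h : R -> R) (lm lp : R) :
  (forall t, is_derive G t (h t)) -> (forall t, continuous h t) ->
  filterlim G (Rbar_locally m_infty) (locally lm) ->
  filterlim G (Rbar_locally p_infty) (locally lp) -> RI h (lp - lm)%R.
Proof.
  intros HG Hh Hm Hp.
  apply RI_ext with (Derive G); [intros t; now apply is_derive_unique|].
  refine (is_RInt_gen_Derive (Fa := Rbar_locally m_infty) (Fb := Rbar_locally p_infty)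
    G lm lp _ _ Hm Hp).
  - apply filter_forall. intros ab t _. now exists (h t).
  - apply filter_forall. intros ab t _.
    apply continuous_ext with h; [|apply Hh]. intros s. symmetry. now apply is_derive_unique.
Qed.

Lemma atan_p_infty : filterlim atan (Rbar_locally p_infty) (locally (PI / 2)%R).
Proof.
  apply (filterlim_ext_loc (fun x => PI / 2 - atan (/ x))%R).
  - exists 0%R. intros x Hx. rewrite atan_inv by auto. ring.
  - assert (H : is_lim (fun x => PI / 2 - atan (/ x))%R p_infty (PI / 2 - atan 0)%R).
    { apply is_lim_minus'; [apply is_lim_const|].
      apply is_lim_comp with 0%R.
      - apply is_lim_continuity. apply derivable_continuous_pt, derivable_pt_atan.
      - replace (Finite 0) with (Rbar_inv p_infty) by reflexivity.
        apply is_lim_inv; [apply is_lim_id|discriminate].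
      - exists 0%R. intros x Hx E. injection E as E.
        assert (0 < / x) by now apply Rinv_0_lt_compat. lra. }
    rewrite atan_0, Rminus_0_r in H. exact H.
Qed.

Lemma filterlim_opp_m_infty :
  filterlim Ropp (Rbar_locally m_infty) (Rbar_locally p_infty).
Proof. exact (filterlim_Rbar_opp m_infty). Qed.

Lemma filterlim_Ropp (F : (R -> Prop) -> Prop) (FF : Filter F) (G : R -> R) (l : R) :
  filterlim G F (locally l) -> filterlim (fun t => - G t)%R F (locally (- l)%R).
Proof.
  intros H. apply filterlim_comp with (locally l); auto.
  apply (filterlim_opp (V := R_NormedModule)).
Qed.

Lemma atan_m_infty : filterlim atan (Rbar_locally m_infty) (locally (- (PI / 2))%R).
Proof.
  apply (filterlim_ext (fun x => - atan (- x))%R).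
  - intros x. rewrite atan_opp. ring.
  - apply filterlim_Ropp; [typeclasses eauto|].
    apply filterlim_comp with (Rbar_locally p_infty); [apply filterlim_opp_m_infty|].
    apply atan_p_infty.
Qed.

Lemma continuous_Rmult (f g : R -> R) (x : R) :
  continuous f x -> continuous g x -> continuous (fun t => f t * g t)%R x.
Proof. exact (continuous_mult (K := R_AbsRing) f g x). Qed.

Lemma continuous_Rplus (f g : R -> R) (x : R) :
  continuous f x -> continuous g x -> continuous (fun t => f t + g t)%R x.
Proof. exact (continuous_plus (V := R_NormedModule) f g x). Qed.

Lemma continuous_Rminus (f g : R -> R) (x : R) :
  continuous f x -> continuous g x -> continuous (fun t => f t - g t)%R x.
Proof. exact (continuous_minus (V := R_NormedModule) f g x). Qed.

Lemma continuous_Ropp (f : R -> R) (x : R) :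
  continuous f x -> continuous (fun t => - f t)%R x.
Proof. exact (continuous_opp (V := R_NormedModule) f x). Qed.

Lemma is_derive_continuous (f : R -> R) (x l : R) : is_derive f x l -> continuous f x.
Proof. intros H. apply (ex_derive_continuous (V := R_NormedModule)). now exists l. Qed.

Lemma continuous_inv_weight_sqr (C t : R) : continuous (fun t => C / (1 + t * t))%R t.
Proof.
  apply continuous_Rmult; [apply continuous_const|].
  apply continuous_Rinv_comp; [|nra].
  apply continuous_Rplus; [apply continuous_const|].
  apply continuous_Rmult; apply continuous_id.
Qed.

Lemma is_derive_scal_atan (C t : R) :
  is_derive (fun t => C * atan t)%R t (C / (1 + t * t))%R.
Proof.
  apply (is_derive_scal atan t C). apply is_derive_atan.
Qed.

Lemma RI_inv_weight_sqr (C : R) : RI (fun t => C / (1 + t * t))%R (C * PI)%R.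
Proof.
  replace (C * PI)%R with (C * (PI / 2) - C * (- (PI / 2)))%R by field.
  apply RI_primitive with (fun t => C * atan t)%R.
  - intros t. apply is_derive_scal_atan.
  - intros t. apply continuous_inv_weight_sqr.
  - apply filterlim_comp with (locally (- (PI / 2))%R); [apply atan_m_infty|].
    apply (filterlim_scal_r (V := R_NormedModule) C).
  - apply filterlim_comp with (locally (PI / 2)%R); [apply atan_p_infty|].
    apply (filterlim_scal_r (V := R_NormedModule) C).
Qed.

Lemma RI_bound (h : R -> R) (C l : R) :
  (forall t, (Rabs (h t) <= C / (1 + t * t))%R) -> RI h l -> (Rabs l <= C * PI)%R.
Proof.
  intros H Hl.
  apply (RInt_gen_norm (V := R_CompleteNormedModule)
    (Fa := Rbar_locally m_infty) (Fb := Rbar_locally p_infty) h (fun t => C / (1 + t * t))%R l (C * PI)%R); auto.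
  - apply filter_prod_infty_le.
  - apply filter_forall. intros ab t _. apply H.
  - apply RI_inv_weight_sqr.
Qed.

Lemma ex_RInt_of_continuous (h : R -> R) (a b : R) :
  (forall t, continuous h t) -> ex_RInt h a b.
Proof. intros H. apply (ex_RInt_continuous (V := R_CompleteNormedModule)). auto. Qed.

(** Increments of the integral are controlled by those of C atan. As atan has limits at both ends,
    the Cauchy criterion then yields the limits of the integral. *)
Lemma RInt_dominated_diff (h : R -> R) (C a b : R) :
  (forall t, continuous h t) -> (forall t, (Rabs (h t) <= C / (1 + t * t))%R) ->
  (Rabs (RInt h 0 b - RInt h 0 a) <= Rabs (C * atan b - C * atan a))%R.
Proof.
  intros Hc H.
  assert (main : forall a b, a <= b ->
    (Rabs (RInt h 0 b - RInt h 0 a) <= C * atan b - C * atan a)%R).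
  { clear a b. intros a b Hab.
    assert (E : (RInt h 0 a + RInt h a b)%R = RInt h 0 b)
      by (apply (RInt_Chasles (V := R_CompleteNormedModule)); now apply ex_RInt_of_continuous).
    rewrite <- E, Rplus_minus_l.
    apply (norm_RInt_le (V := R_NormedModule) h (fun t => C / (1 + t * t))%R a b); auto.
    - now apply (RInt_correct (V := R_CompleteNormedModule)), ex_RInt_of_continuous.
    - apply (is_RInt_derive (V := R_CompleteNormedModule) (fun t => C * atan t)%R).
      + intros t _. apply is_derive_scal_atan.
      + intros t _. apply continuous_inv_weight_sqr. }
  destruct (Rle_dec a b) as [Hab|Hab].
  - eapply Rle_trans; [now apply main|]. apply Rle_abs.
  - rewrite (Rabs_minus_sym (RInt h 0 b)), (Rabs_minus_sym (C * atan b)).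
    eapply Rle_trans; [apply main; lra|]. apply Rle_abs.
Qed.

Lemma filterlim_dominated_diff (F : (R -> Prop) -> Prop) (FF : ProperFilter F)
  (G A : R -> R) (l : R) :
  (forall a b, (Rabs (G b - G a) <= Rabs (A b - A a))%R) ->
  filterlim A F (locally l) -> exists l', filterlim G F (locally l').
Proof.
  intros H HA.
  apply (filterlim_locally_cauchy (U := R_CompleteSpace)). intros eps.
  assert (HC : exists l, filterlim A F (locally (T := R_CompleteSpace) l)) by now exists l.
  rewrite <- (filterlim_locally_cauchy (U := R_CompleteSpace)) in HC.
  destruct (HC eps) as [P [HP HPP]]. exists P. split; auto.
  intros u v Hu Hv. eapply Rle_lt_trans; [apply H|]. now apply HPP.
Qed.

Section Dominated.
Context (h : R -> R) (C : R) (Hc : forall t, continuous h t)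
  (H : forall t, (Rabs (h t) <= C / (1 + t * t))%R).

Lemma is_derive_RInt_0 (t : R) : is_derive (RInt h 0) t (h t).
Proof.
  apply (is_derive_RInt (V := R_NormedModule) h (RInt h 0) 0); auto.
  apply filter_forall. intros s.
  now apply (RInt_correct (V := R_CompleteNormedModule)), ex_RInt_of_continuous.
Qed.

Lemma RInt_0_lim_p : exists l, filterlim (RInt h 0) (Rbar_locally p_infty) (locally l).
Proof.
  apply filterlim_dominated_diff with (fun t => C * atan t)%R (C * (PI / 2))%R.
  - typeclasses eauto.
  - intros a b. now apply RInt_dominated_diff.
  - apply filterlim_comp with (locally (PI / 2)%R); [apply atan_p_infty|].
    apply (filterlim_scal_r (V := R_NormedModule) C).
Qed.

Lemma RInt_0_lim_m : exists l, filterlim (RInt h 0) (Rbar_locally m_infty) (locally l).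
Proof.
  apply filterlim_dominated_diff with (fun t => C * atan t)%R (C * (- (PI / 2)))%R.
  - typeclasses eauto.
  - intros a b. now apply RInt_dominated_diff.
  - apply filterlim_comp with (locally (- (PI / 2))%R); [apply atan_m_infty|].
    apply (filterlim_scal_r (V := R_NormedModule) C).
Qed.

Lemma RI_ex : exists l, RI h l.
Proof.
  destruct RInt_0_lim_p as [lp Hp]. destruct RInt_0_lim_m as [lm Hm].
  exists (lp - lm)%R. apply RI_primitive with (RInt h 0); auto.
  intros t. apply is_derive_RInt_0.
Qed.

End Dominated.

(** * The Poisson kernel and its conjugate *)

Lemma quadratic_pos (x y t : R) : x <> 0%R -> (0 < x * x + (t - y) * (t - y))%R.
Proof. intros H. assert (0 < x * x)%R by nra. assert (0 <= (t - y) * (t - y))%R by apply Rle_0_sqr. lra. Qed.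

Lemma continuous_shifted_quadratic (x y t : R) :
  continuous (fun t => x * x + (t - y) * (t - y))%R t.
Proof.
  apply continuous_Rplus; [apply continuous_const|].
  apply continuous_Rmult; (apply continuous_Rminus; [apply continuous_id|apply continuous_const]).
Qed.

Lemma filterlim_shift_scal_p (k y : R) : (0 < k)%R ->
  filterlim (fun t => k * (t - y))%R (Rbar_locally p_infty) (Rbar_locally p_infty).
Proof.
  intros Hk P [M HM]. exists (M / k + y)%R. intros t Ht. apply HM.
  assert (M / k < t - y) by lra. apply (Rmult_lt_compat_l k) in H; auto.
  replace (k * (M / k))%R with M in H by (field; lra). exact H.
Qed.

Lemma filterlim_shift_scal_m (k y : R) : (0 < k)%R ->
  filterlim (fun t => k * (t - y))%R (Rbar_locally m_infty) (Rbar_locally m_infty).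
Proof.
  intros Hk P [M HM]. exists (M / k + y)%R. intros t Ht. apply HM.
  assert (t - y < M / k) by lra. apply (Rmult_lt_compat_l k) in H; auto.
  replace (k * (M / k))%R with M in H by (field; lra). exact H.
Qed.

Lemma RI_poisson_pos (x y : R) : (0 < x)%R ->
  RI (fun t => x / (x * x + (t - y) * (t - y)))%R PI.
Proof.
  intros Hx. replace PI with (PI / 2 - - (PI / 2))%R by field.
  apply RI_primitive with (fun t => atan (/ x * (t - y)))%R.
  - intros t. assert (Q := quadratic_pos x y t ltac:(lra)). auto_derive; auto.
    field. repeat split; nra.
  - intros t. apply continuous_Rmult; [apply continuous_const|].
    apply continuous_Rinv_comp; [apply continuous_shifted_quadratic|].
    assert (Q := quadratic_pos x y t ltac:(lra)). lra.
  - apply filterlim_comp with (Rbar_locally m_infty); [|apply atan_m_infty].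
    apply filterlim_shift_scal_m. now apply Rinv_0_lt_compat.
  - apply filterlim_comp with (Rbar_locally p_infty); [|apply atan_p_infty].
    apply filterlim_shift_scal_p. now apply Rinv_0_lt_compat.
Qed.

Lemma RI_poisson_neg (x y : R) : (x < 0)%R ->
  RI (fun t => x / (x * x + (t - y) * (t - y)))%R (- PI)%R.
Proof.
  intros Hx. replace (- PI)%R with (- (1) * PI)%R by ring.
  apply RI_ext with (fun t => - (1) * ((- x) / ((- x) * (- x) + (t - y) * (t - y))))%R.
  - intros t. assert (Q := quadratic_pos x y t ltac:(lra)). field. repeat split; nra.
  - apply RI_scal, RI_poisson_pos. lra.
Qed.

Lemma inv_weight_lim (F : (R -> Prop) -> Prop) (FF : Filter F) (K : R) :
  (forall M, F (fun t => M < Rabs t)) ->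
  filterlim (fun t => K / weight t)%R F (locally 0%R).
Proof.
  intros H. apply (filterlim_locally (U := R_UniformSpace)). intros eps.
  apply (filter_imp (fun t => (Rabs K / eps < Rabs t)%R)); [|apply H].
  intros t Ht. change (Rabs (K / weight t - 0) < eps).
  assert (P := weight_pos t). assert (T := weight_ge_abs t).
  rewrite Rminus_0_r. unfold Rdiv. rewrite Rabs_mult, Rabs_inv, (Rabs_pos_eq (weight t)) by lra.
  assert (E := cond_pos eps).
  apply Rlt_div_l; auto.
  apply Rlt_div_l in Ht; auto. nra.
Qed.

Lemma abs_large_p (M : R) : Rbar_locally p_infty (fun t => M < Rabs t).
Proof. exists M. intros t Ht. eapply Rlt_le_trans; [exact Ht|apply Rle_abs]. Qed.

Lemma abs_large_m (M : R) : Rbar_locally m_infty (fun t => M < Rabs t).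
Proof. exists (- M)%R. intros t Ht. assert (H := Rle_abs (- t)). rewrite Rabs_Ropp in H. lra. Qed.

Lemma quadratic_ge (x y : R) : x <> 0%R -> exists K, (0 < K)%R /\
  forall t, (weight t * weight t <= K * (x * x + (t - y) * (t - y)))%R.
Proof.
  intros H. destruct (Cmod_axis_minus_ge (x, y) H) as [K [HK HW]].
  exists (K * K)%R. split; [nra|]. intros t.
  replace (x * x + (t - y) * (t - y))%R with (Cmod (axis t - (x, y)) * Cmod (axis t - (x, y)))%R
    by (rewrite Cmod_sqr; simpl; ring).
  assert (P := weight_pos t). specialize (HW t).
  replace (K * K * (Cmod (axis t - (x, y)) * Cmod (axis t - (x, y))))%R
    with ((K * Cmod (axis t - (x, y))) * (K * Cmod (axis t - (x, y))))%R by ring.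
  apply Rmult_le_compat; lra.
Qed.

(** From ln x <= x - 1 applied to a/b and to b/a; the sum of the reciprocals covers both cases
    without deciding which argument is larger. *)
Lemma ln_quotient_abs_le (a b : R) : (0 < a)%R -> (0 < b)%R ->
  (Rabs (ln a - ln b) <= Rabs (a - b) * (/ a + / b))%R.
Proof.
  intros Ha Hb.
  assert (main : forall a b, (0 < a)%R -> (0 < b)%R -> (ln a - ln b <= Rabs (a - b) * / b)%R).
  { clear. intros a b Ha Hb. rewrite <- ln_div by auto.
    assert (0 < a / b)%R by now apply Rdiv_lt_0_compat.
    assert (E := exp_le_1_plus (ln (a / b))). rewrite exp_ln in E by auto.
    assert (a / b - 1 <= Rabs (a - b) * / b)%R.
    { replace (a / b - 1)%R with ((a - b) * / b)%R by (field; lra).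
      apply Rmult_le_compat_r; [left; now apply Rinv_0_lt_compat|apply Rle_abs]. }
    lra. }
  assert (H1 := main a b Ha Hb). assert (H2 := main b a Hb Ha).
  rewrite Rabs_minus_sym in H2.
  assert (0 < / a) by now apply Rinv_0_lt_compat.
  assert (0 < / b) by now apply Rinv_0_lt_compat.
  assert (0 <= Rabs (a - b)) by apply Rabs_pos.
  assert (0 <= Rabs (a - b) * / a)%R by (apply Rmult_le_pos; lra).
  assert (0 <= Rabs (a - b) * / b)%R by (apply Rmult_le_pos; lra).
  rewrite Rmult_plus_distr_l. apply Rabs_le. lra.
Qed.

(** The terms t^2 cancel in the difference of the quadratics, which is therefore O(weight), while
    each reciprocal is O(1 / weight^2). *)
Lemma log_quotient_le_inv_weight (x1 y1 x2 y2 : R) : x1 <> 0%R -> x2 <> 0%R ->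
  exists K, forall t,
  (Rabs (/ 2 * (ln (x1 * x1 + (t - y1) * (t - y1)) - ln (x2 * x2 + (t - y2) * (t - y2))))
     <= K / weight t)%R.
Proof.
  intros H1 H2.
  destruct (quadratic_ge x1 y1 H1) as [K1 [HK1 HW1]].
  destruct (quadratic_ge x2 y2 H2) as [K2 [HK2 HW2]].
  set (L := (Rabs (x1 * x1 + y1 * y1 - x2 * x2 - y2 * y2) + Rabs (2 * (y2 - y1)))%R).
  exists (/ 2 * L * (K1 + K2))%R. intros t.
  assert (Q1 := quadratic_pos x1 y1 t H1). assert (Q2 := quadratic_pos x2 y2 t H2).
  specialize (HW1 t). specialize (HW2 t).
  set (D1 := (x1 * x1 + (t - y1) * (t - y1))%R) in *.
  set (D2 := (x2 * x2 + (t - y2) * (t - y2))%R) in *.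
  assert (P := weight_pos t). assert (W := weight_ge_1 t). assert (T := weight_ge_abs t).
  assert (HL : (Rabs (D1 - D2) <= L * weight t)%R).
  { replace (D1 - D2)%R with ((x1 * x1 + y1 * y1 - x2 * x2 - y2 * y2) + 2 * (y2 - y1) * t)%R
      by (unfold D1, D2; ring).
    eapply Rle_trans; [apply Rabs_triang|]. rewrite (Rabs_mult (2 * (y2 - y1))).
    unfold L. assert (0 <= Rabs (x1 * x1 + y1 * y1 - x2 * x2 - y2 * y2)) by apply Rabs_pos.
    assert (0 <= Rabs (2 * (y2 - y1))) by apply Rabs_pos. nra. }
  assert (I1 : (/ D1 <= K1 / (weight t * weight t))%R).
  { apply Rle_div_r; [nra|]. rewrite Rmult_comm. apply Rle_div_l; lra. }
  assert (I2 : (/ D2 <= K2 / (weight t * weight t))%R).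
  { apply Rle_div_r; [nra|]. rewrite Rmult_comm. apply Rle_div_l; lra. }
  rewrite Rabs_mult, (Rabs_pos_eq (/ 2)) by lra.
  assert (E := ln_quotient_abs_le D1 D2 Q1 Q2).
  assert (0 <= Rabs (D1 - D2)) by apply Rabs_pos.
  assert (0 < / D1) by now apply Rinv_0_lt_compat.
  assert (0 < / D2) by now apply Rinv_0_lt_compat.
  replace (/ 2 * L * (K1 + K2) / weight t)%R
    with (/ 2 * ((L * weight t) * (K1 / (weight t * weight t) + K2 / (weight t * weight t))))%R
    by (field; lra).
  apply Rmult_le_compat_l; [lra|].
  eapply Rle_trans; [exact E|]. apply Rmult_le_compat; lra.
Qed.

(** Each fraction alone has a logarithmically divergent integral. The difference has half the
    logarithm of the quotient of the quadratics as primitive, and this tends to 0 at both ends. *)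
Lemma RI_conjugate_poisson_diff (x1 y1 x2 y2 : R) : x1 <> 0%R -> x2 <> 0%R ->
  RI (fun t => (t - y1) / (x1 * x1 + (t - y1) * (t - y1))
             - (t - y2) / (x2 * x2 + (t - y2) * (t - y2)))%R 0%R.
Proof.
  intros H1 H2. replace 0%R with (0 - 0)%R by ring.
  destruct (log_quotient_le_inv_weight x1 y1 x2 y2 H1 H2) as [K HK].
  assert (lim : forall F : (R -> Prop) -> Prop, Filter F ->
    (forall M, F (fun t => M < Rabs t)) -> filterlim (fun t =>
    / 2 * (ln (x1 * x1 + (t - y1) * (t - y1)) - ln (x2 * x2 + (t - y2) * (t - y2))))%R
    F (locally 0%R)).
  { intros F FF HF. apply (filterlim_locally (U := R_UniformSpace)). intros eps.
    assert (L := inv_weight_lim F FF K HF).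
    rewrite (filterlim_locally (U := R_UniformSpace)) in L. specialize (L eps).
    revert L. apply filter_imp. intros t Ht.
    change (Rabs (K / weight t - 0) < eps) in Ht.
    match goal with |- ball _ _ ?x => change (Rabs (x - 0) < eps) end.
    rewrite Rminus_0_r in *. eapply Rle_lt_trans; [apply HK|].
    eapply Rle_lt_trans; [apply Rle_abs|]. exact Ht. }
  apply RI_primitive with (fun t =>
    / 2 * (ln (x1 * x1 + (t - y1) * (t - y1)) - ln (x2 * x2 + (t - y2) * (t - y2))))%R.
  - intros t. assert (Q1 := quadratic_pos x1 y1 t H1). assert (Q2 := quadratic_pos x2 y2 t H2).
    auto_derive; [repeat split; lra|]. field. lra.
  - intros t. assert (Q1 := quadratic_pos x1 y1 t H1). assert (Q2 := quadratic_pos x2 y2 t H2).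
    apply continuous_Rminus; (apply continuous_Rmult;
      [apply continuous_Rminus; [apply continuous_id|apply continuous_const]|
       apply continuous_Rinv_comp; [apply continuous_shifted_quadratic|lra]]).
  - apply lim; [typeclasses eauto|apply abs_large_m].
  - apply lim; [typeclasses eauto|apply abs_large_p].
Qed.

(** * Cauchy integral formula for rational functions *)

Definition Ccont (g : R -> C) : Prop :=
  forall t, continuous (fun s => fst (g s)) t /\ continuous (fun s => snd (g s)) t.

Lemma Ccont_const (c : C) : Ccont (fun _ => c).
Proof. intros t. split; apply continuous_const. Qed.

Lemma Ccont_axis : Ccont axis.
Proof. intros t. split; simpl; [apply continuous_const|apply continuous_id]. Qed.

Lemma Ccont_ext (g h : R -> C) : (forall t, g t = h t) -> Ccont g -> Ccont h.
Proof.
  intros E H t. destruct (H t) as [H1 H2].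
  split; [revert H1|revert H2]; apply continuous_ext; intros s; now rewrite E.
Qed.

Lemma Ccont_plus (g h : R -> C) : Ccont g -> Ccont h -> Ccont (fun t => g t + h t).
Proof.
  intros Hg Hh t. destruct (Hg t), (Hh t). split; simpl; now apply continuous_Rplus.
Qed.

Lemma Ccont_opp (g : R -> C) : Ccont g -> Ccont (fun t => - g t).
Proof. intros Hg t. destruct (Hg t). split; simpl; now apply continuous_Ropp. Qed.

Lemma Ccont_minus (g h : R -> C) : Ccont g -> Ccont h -> Ccont (fun t => g t - h t).
Proof. intros Hg Hh. apply Ccont_plus; [auto|now apply Ccont_opp]. Qed.

Lemma Ccont_mult (g h : R -> C) : Ccont g -> Ccont h -> Ccont (fun t => g t * h t).
Proof.
  intros Hg Hh t. destruct (Hg t), (Hh t). split; simpl.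
  - apply continuous_Rminus; now apply continuous_Rmult.
  - apply continuous_Rplus; now apply continuous_Rmult.
Qed.

Lemma Cmod_sqr_pos (z : C) : z <> 0 -> (0 < fst z * fst z + snd z * snd z)%R.
Proof. intros H. rewrite <- Cmod_sqr. apply Cmod_gt_0 in H. nra. Qed.

Lemma Ccont_inv (g : R -> C) : (forall t, g t <> 0) -> Ccont g -> Ccont (fun t => / g t).
Proof.
  intros H0 Hg.
  apply Ccont_ext with (fun t => (fst (g t) / (fst (g t) * fst (g t) + snd (g t) * snd (g t)),
    - snd (g t) / (fst (g t) * fst (g t) + snd (g t) * snd (g t)))%R).
  - intros t. unfold Cinv. f_equal; f_equal; simpl; ring.
  - intros t. destruct (Hg t) as [H1 H2].
    assert (P := Cmod_sqr_pos (g t) (H0 t)).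
    assert (continuous (fun s => / (fst (g s) * fst (g s) + snd (g s) * snd (g s)))%R t).
    { apply (continuous_Rinv_comp (fun s => fst (g s) * fst (g s) + snd (g s) * snd (g s))%R); [|lra].
      apply continuous_Rplus; now apply continuous_Rmult. }
    split; apply continuous_Rmult; auto. now apply continuous_Ropp.
Qed.

Lemma Ccont_div (g h : R -> C) :
  (forall t, h t <> 0) -> Ccont g -> Ccont h -> Ccont (fun t => g t / h t).
Proof. intros H0 Hg Hh. apply Ccont_mult; [auto|now apply Ccont_inv]. Qed.

Lemma Rabs_fst_le (z : C) : (Rabs (fst z) <= Cmod z)%R.
Proof. eapply Rle_trans; [|apply Rmax_Cmod]. apply Rmax_l. Qed.

Lemma Rabs_snd_le (z : C) : (Rabs (snd z) <= Cmod z)%R.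
Proof. eapply Rle_trans; [|apply Rmax_Cmod]. apply Rmax_r. Qed.

Lemma Cmod_le_abs_sum (z : C) : (Cmod z <= Rabs (fst z) + Rabs (snd z))%R.
Proof.
  assert (H := Cmod_sqr z).
  assert (0 <= Rabs (fst z)) by apply Rabs_pos. assert (0 <= Rabs (snd z)) by apply Rabs_pos.
  assert (0 <= Cmod z) by apply Cmod_ge_0.
  assert (A : forall x, (Rabs x * Rabs x = x * x)%R).
  { intros x. rewrite <- Rabs_mult. apply Rabs_pos_eq. nra. }
  assert (A1 := A (fst z)). assert (A2 := A (snd z)). nra.
Qed.

(** The approximation need not be uniform on the line: the continuous factor [w] may grow, and its
    local boundedness is enough for the usual argument with eps/3. *)
Lemma continuous_of_approx (f : nat -> R -> R) (g : R -> R) (b : nat -> R) (w : R -> R) :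
  (forall n t, continuous (f n) t) -> (forall t, continuous w t) ->
  (forall n t, (Rabs (f n t - g t) <= b n * w t)%R) ->
  is_lim_seq b 0%R -> forall t, continuous g t.
Proof.
  intros Hf Hw H Hb t.
  apply (filterlim_locally (U := R_UniformSpace)). intros eps.
  set (M := (Rabs (w t) + 1)%R).
  assert (HM : (0 < M)%R) by (unfold M; assert (0 <= Rabs (w t)) by apply Rabs_pos; lra).
  assert (He : (0 < eps / 3 / M)%R).
  { apply Rdiv_lt_0_compat; auto. assert (E := cond_pos eps). lra. }
  apply is_lim_seq_spec in Hb. destruct (Hb (mkposreal _ He)) as [N HN].
  specialize (HN N (le_n N)). simpl in HN. rewrite Rminus_0_r in HN.
  assert (He3 : (0 < eps / 3)%R) by (assert (E := cond_pos eps); lra).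
  assert (C1 := Hf N t). apply (proj1 (filterlim_locally (U := R_UniformSpace) _ _)) with (eps := mkposreal _ He3) in C1.
  assert (C2 := Hw t). apply (proj1 (filterlim_locally (U := R_UniformSpace) _ _)) with (eps := mkposreal _ Rlt_0_1) in C2.
  assert (A : forall s, (Rabs (w s) <= M)%R -> (Rabs (f N s - g s) < eps / 3)%R).
  { intros s Hs. eapply Rle_lt_trans; [apply H|].
    eapply Rle_lt_trans; [apply Rle_abs|]. rewrite Rabs_mult.
    apply Rle_lt_trans with (Rabs (b N) * M)%R; [apply Rmult_le_compat_l; auto using Rabs_pos|].
    apply Rlt_div_r in HN; auto. }
  generalize (filter_and _ _ C1 C2). apply filter_imp. intros s [B1 B2].
  change (Rabs (f N s - f N t) < eps / 3) in B1. change (Rabs (w s - w t) < 1) in B2.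
  change (Rabs (g s - g t) < eps).
  assert (Ws : (Rabs (w s) <= M)%R).
  { unfold M. replace (w s) with (w t + (w s - w t))%R by ring.
    eapply Rle_trans; [apply Rabs_triang|]. lra. }
  assert (A1 := A s Ws). assert (A2 := A t ltac:(unfold M; lra)).
  rewrite Rabs_minus_sym in A1.
  replace (g s - g t)%R with ((g s - f N s) + ((f N s - f N t) + (f N t - g t)))%R by ring.
  eapply Rle_lt_trans; [apply Rabs_triang|].
  assert (T := Rabs_triang (f N s - f N t) (f N t - g t)). lra.
Qed.

Lemma Ccont_of_approx (f : nat -> R -> C) (g : R -> C) (b : nat -> R) (w : R -> R) :
  (forall n, Ccont (f n)) -> (forall t, continuous w t) ->
  (forall n t, (Cmod (f n t - g t) <= b n * w t)%R) ->
  is_lim_seq b 0%R -> Ccont g.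
Proof.
  intros Hf Hw H Hb t. split.
  - apply (continuous_of_approx (fun n s => fst (f n s)) _ b w); auto.
    + intros n s. apply Hf.
    + intros n s. eapply Rle_trans; [|apply H]. apply (Rabs_fst_le (f n s - g s)).
  - apply (continuous_of_approx (fun n s => snd (f n s)) _ b w); auto.
    + intros n s. apply Hf.
    + intros n s. eapply Rle_trans; [|apply H]. apply (Rabs_snd_le (f n s - g s)).
Qed.

(** Real and imaginary parts are kept apart so that explicit real primitives and domination by a
    multiple of atan apply; [is_int_imag_CI] returns to the complex integral. *)
Definition CI (g : R -> C) (l : C) : Prop :=
  RI (fun t => fst (g t)) (fst l) /\ RI (fun t => snd (g t)) (snd l).

Lemma CI_ext (f g : R -> C) (a : C) : (forall t, f t = g t) -> CI f a -> CI g a.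
Proof.
  intros H [H1 H2].
  split; [revert H1|revert H2]; apply RI_ext; intros t; now rewrite H.
Qed.

Lemma CI_plus (f g : R -> C) (a b : C) : CI f a -> CI g b -> CI (fun t => f t + g t) (a + b).
Proof. intros [] []. split; simpl; now apply RI_plus. Qed.

Lemma CI_scal (f : R -> C) (c a : C) : CI f a -> CI (fun t => c * f t) (c * a).
Proof.
  intros [H1 H2]. split; simpl.
  - apply RI_ext with (fun t => fst c * fst (f t) + - snd c * snd (f t))%R; [intros; ring|].
    replace (fst c * fst a - snd c * snd a)%R with (fst c * fst a + - snd c * snd a)%R by ring.
    apply RI_plus; now apply RI_scal.
  - apply RI_plus; now apply RI_scal.
Qed.

Lemma CI_unique (f : R -> C) (a b : C) : CI f a -> CI f b -> a = b.
Proof.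
  intros [H1 H2] [H3 H4]. apply injective_projections; eapply RI_unique; eauto.
Qed.

Lemma CI_bound (g : R -> C) (K : R) (l : C) :
  (forall t, (Cmod (g t) <= K / (weight t * weight t))%R) -> CI g l ->
  (Cmod l <= K * (2 * PI))%R.
Proof.
  intros H [H1 H2]. eapply Rle_trans; [apply Cmod_le_abs_sum|].
  apply RI_bound with (C := K) in H1.
  - apply RI_bound with (C := K) in H2; [lra|].
    intros t. rewrite <- weight_sqr. eapply Rle_trans; [apply Rabs_snd_le|apply H].
  - intros t. rewrite <- weight_sqr. eapply Rle_trans; [apply Rabs_fst_le|apply H].
Qed.

Lemma CI_ex (g : R -> C) (K : R) :
  Ccont g -> (forall t, (Cmod (g t) <= K / (weight t * weight t))%R) -> exists l, CI g l.
Proof.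
  intros Hc H.
  destruct (RI_ex (fun t => fst (g t)) K) as [l1 H1].
  - intros t. apply Hc.
  - intros t. rewrite <- weight_sqr. eapply Rle_trans; [apply Rabs_fst_le|apply H].
  - destruct (RI_ex (fun t => snd (g t)) K) as [l2 H2].
    + intros t. apply Hc.
    + intros t. rewrite <- weight_sqr. eapply Rle_trans; [apply Rabs_snd_le|apply H].
    + exists (l1, l2). now split.
Qed.

Lemma CI_cv (g : nat -> R -> C) (f : R -> C) (l : nat -> C) (L : C) (K q : R) :
  (0 < q < 1)%R ->
  (forall n, CI (g n) (l n)) -> CI f L ->
  (forall n t, (Cmod (g n t - f t) <= K * q ^ n / (weight t * weight t))%R) -> cv l L.
Proof.
  intros hq Hg Hf H.
  apply cv_squeeze with (fun n => (2 * PI * K) * q ^ n)%R; [|now apply is_lim_seq_scal_geom].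
  intros n. replace ((2 * PI * K) * q ^ n)%R with (K * q ^ n * (2 * PI))%R by ring.
  apply CI_bound with (fun t => g n t + (- (1)) * f t).
  - intros t. replace (g n t + - (1) * f t) with (g n t - f t) by ring. apply H.
  - replace (l n - L) with (l n + (- (1)) * L) by ring.
    apply CI_plus; auto. now apply CI_scal.
Qed.

Definition sgn (x : R) : R := if Rlt_dec 0 x then 1%R else (-1)%R.

Lemma RI_poisson (x y : R) : x <> 0%R ->
  RI (fun t => x / (x * x + (t - y) * (t - y)))%R (sgn x * PI)%R.
Proof.
  intros H. unfold sgn. destruct (Rlt_dec 0 x) as [Hx|Hx].
  - rewrite Rmult_1_l. now apply RI_poisson_pos.
  - replace (-1 * PI)%R with (- PI)%R by ring. apply RI_poisson_neg. lra.
Qed.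

(** A single kernel decays only like 1/|t|, so the difference is integrated. Its real part consists
    of two Poisson kernels, each contributing pi times a sign; its imaginary part is the conjugate
    difference, with integral 0. *)
Lemma CI_kernel_diff (b X : C) : Re b <> 0%R -> Re X <> 0%R ->
  CI (fun t => / (axis t - X) - / (axis t - b)) (RtoC ((sgn (Re b) - sgn (Re X)) * PI)).
Proof.
  destruct b as [x1 y1], X as [x2 y2]. unfold Re. simpl. intros H1 H2.
  assert (E : forall x y t, x <> 0%R -> / (axis t - (x, y)) =
    (- (x / (x * x + (t - y) * (t - y))), - ((t - y) / (x * x + (t - y) * (t - y))))%R).
  { intros x y t Hx. assert (Q := quadratic_pos x y t Hx). unfold Cinv. simpl.
    replace ((0 + - x) * ((0 + - x) * 1) + (t + - y) * ((t + - y) * 1))%R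
      with (x * x + (t - y) * (t - y))%R by ring.
    f_equal; field; lra. }
  split.
  - apply RI_ext with (fun t => x1 / (x1 * x1 + (t - y1) * (t - y1))
      + - (1) * (x2 / (x2 * x2 + (t - y2) * (t - y2))))%R.
    + intros t. rewrite !E by auto. simpl. ring.
    + simpl. replace ((sgn x1 - sgn x2) * PI)%R with (sgn x1 * PI + - (1) * (sgn x2 * PI))%R by ring.
      apply RI_plus; [|apply RI_scal]; now apply RI_poisson.
  - apply RI_ext with (fun t => (t - y1) / (x1 * x1 + (t - y1) * (t - y1))
             - (t - y2) / (x2 * x2 + (t - y2) * (t - y2)))%R.
    + intros t. rewrite !E by auto. simpl. ring.
    + simpl. now apply RI_conjugate_poisson_diff.
Qed.

Lemma Cmod_inv_kernel_le (X : C) : Re X <> 0%R ->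
  exists K, (0 < K)%R /\ forall t, (Cmod (/ (axis t - X)) <= K / weight t)%R.
Proof.
  intros H. destruct (Cmod_axis_minus_ge X H) as [K [HK HW]]. exists K. split; auto.
  intros t. assert (N := axis_minus_neq_0 X t H). rewrite Cmod_inv by auto.
  apply Cmod_gt_0 in N. assert (P := weight_pos t). specialize (HW t).
  apply Rle_div_r; auto. rewrite Rmult_comm. apply Rle_div_l; lra.
Qed.

Lemma Ccont_kernel (X : C) : Re X <> 0%R -> Ccont (fun t => / (axis t - X)).
Proof.
  intros H. apply Ccont_inv; [intros t; now apply axis_minus_neq_0|].
  apply Ccont_minus; [apply Ccont_axis|apply Ccont_const].
Qed.

Lemma Cmod_le_all_eps (z : C) (M : R) :
  (forall eps, (0 < eps)%R -> (Cmod z <= M * eps)%R) -> z = 0.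
Proof.
  intros H. apply Cmod_eq_0.
  assert (0 <= Cmod z) by apply Cmod_ge_0.
  destruct (Rle_lt_or_eq_dec _ _ H0) as [P|P]; [|auto].
  exfalso. assert (H1 := H 1%R Rlt_0_1).
  assert (0 < M)%R by lra.
  assert (0 < Cmod z / (2 * M))%R by (apply Rdiv_lt_0_compat; lra).
  specialize (H _ H3). replace (M * (Cmod z / (2 * M)))%R with (Cmod z / 2)%R in H by (field; lra).
  lra.
Qed.

(* A double pole is reached as the limit of two simple ones. *)
Lemma CI_vanish_at_limit_point (sg : R) (h : R -> C) (K : R) (b : C) :
  (sg = 1 \/ sg = -1)%R -> Ccont h ->
  (forall t, (Cmod (h t) <= K / weight t)%R) -> (0 < sg * Re b)%R ->
  (forall X, (0 < sg * Re X)%R -> X <> b -> CI (fun t => h t * / (axis t - X)) 0) ->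
  CI (fun t => h t * / (axis t - b)) 0.
Proof.
  intros Hsg Hc HK Hb H.
  assert (Rb : Re b <> 0%R) by (intros E; rewrite E in Hb; lra).
  destruct (Cmod_inv_kernel_le b Rb) as [Kb [HKb Hkb]].
  assert (Ccont (fun t => h t * / (axis t - b))) by (apply Ccont_mult; auto using Ccont_kernel).
  assert (K0 : (0 <= K)%R).
  { specialize (HK 0%R). assert (0 <= Cmod (h 0)) by apply Cmod_ge_0.
    assert (P := weight_pos 0). apply Rle_div_r in HK; auto. nra. }
  destruct (CI_ex (fun t => h t * / (axis t - b)) (K * Kb)) as [l Hl]; auto.
  { intros t. rewrite Cmod_mult. assert (P := weight_pos t).
    replace (K * Kb / (weight t * weight t))%R with ((K / weight t) * (Kb / weight t))%R by (field; lra).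
    apply Rmult_le_compat; auto using Cmod_ge_0. }
  replace (RtoC 0) with l; [exact Hl|].
  assert (Ab : (0 < Rabs (Re b))%R) by now apply Rabs_pos_lt.
  apply Cmod_le_all_eps with (K * Kb / Rabs (Re b) * (2 * PI))%R. intros eps Heps.
  (* The second pole is moved away from the axis, so its distance to the axis is at least
     [Rabs (Re b)]. The bound on the difference of the two integrals is then linear in [eps] with a
     constant independent of [eps]. *)
  set (X := b + RtoC (sg * eps)).
  assert (ReX : Re X = (Re b + sg * eps)%R) by reflexivity.
  assert (sg * sg = 1)%R by (destruct Hsg; subst; ring).
  assert (PX : (0 < sg * Re X)%R).
  { rewrite ReX. rewrite Rmult_plus_distr_l, <- Rmult_assoc, H1. lra. }
  assert (AX : (Rabs (Re b) <= Rabs (Re X))%R).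
  { rewrite ReX. destruct Hsg as [E|E]; subst sg.
    - rewrite !Rabs_pos_eq; lra.
    - rewrite !Rabs_left; lra. }
  assert (NX : X <> b).
  { intros E. apply (f_equal Re) in E. rewrite ReX in E.
    destruct Hsg as [E'|E']; subst sg; lra. }
  specialize (H X PX NX).
  replace (K * Kb / Rabs (Re b) * (2 * PI) * eps)%R with (K * Kb / Rabs (Re b) * eps * (2 * PI))%R by ring.
  apply CI_bound with (fun t => h t * / (axis t - b) + (- (1)) * (h t * / (axis t - X))).
  2:{ replace l with (l + (- (1)) * 0) by ring. apply CI_plus; auto. now apply CI_scal. }
  intros t.
  assert (N1 := axis_minus_neq_0 b t Rb).
  assert (RX0 : Re X <> 0%R) by (intros E; rewrite E in PX; lra).
  assert (N2 := axis_minus_neq_0 X t RX0).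
  replace (h t * / (axis t - b) + - (1) * (h t * / (axis t - X)))
    with (h t * / (axis t - b) * (- RtoC (sg * eps)) * / (axis t - X)).
  2:{ unfold X in *. field. auto. }
  rewrite !Cmod_mult, Cmod_opp, Cmod_R, Rabs_mult.
  rewrite (Rabs_pos_eq eps) by lra.
  replace (Rabs sg) with 1%R by (destruct Hsg; subst; [rewrite Rabs_pos_eq|rewrite Rabs_left]; lra).
  assert (I : (Cmod (/ (axis t - X)) <= / Rabs (Re b))%R).
  { rewrite Cmod_inv by auto. apply Rinv_le_contravar; auto.
    eapply Rle_trans; [exact AX|].
    replace (Rabs (Re X)) with (Rabs (Re (axis t - X))).
    - apply re_le_Cmod.
    - rewrite <- Rabs_Ropp. f_equal. unfold Re. simpl. ring. }
  assert (P := weight_pos t).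
  replace (K * Kb / Rabs (Re b) * eps / (weight t * weight t))%R
    with ((K / weight t) * (Kb / weight t) * (1 * eps) * / Rabs (Re b))%R by (field; lra).
  apply Rmult_le_compat; auto using Cmod_ge_0.
  - repeat apply Rmult_le_pos; auto using Cmod_ge_0; lra.
  - apply Rmult_le_compat_r; [lra|]. apply Rmult_le_compat; auto using Cmod_ge_0.
Qed.

(* The poles of [h] lie in the half plane [0 < sg * Re Y]; the other one is where the Cauchy
   formula reproduces [h]. *)
Definition cauchy_class (sg : R) (h : C -> C) : Prop :=
  Ccont (fun t => h (axis t)) /\
  (exists K, forall t, (Cmod (h (axis t)) <= K / weight t)%R) /\
  (forall X, (0 < sg * Re X)%R -> CI (fun t => h (axis t) * / (axis t - X)) 0) /\
  (forall X, (sg * Re X < 0)%R ->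
     CI (fun t => h (axis t) * / (axis t - X)) (RtoC (sg * (2 * PI)) * h X)).

Section Cauchy_class.
Context (sg : R) (Hsg : (sg = 1 \/ sg = -1)%R).

Lemma cauchy_class_ext (h g : C -> C) :
  (forall Y, (sg * Re Y <= 0)%R -> h Y = g Y) -> cauchy_class sg h -> cauchy_class sg g.
Proof.
  intros E [H1 [[K H2] [H3 H4]]].
  assert (EA : forall t, h (axis t) = g (axis t)).
  { intros t. apply E. unfold Re. simpl. lra. }
  split; [|split; [exists K|split]].
  - now apply Ccont_ext with (fun t => h (axis t)).
  - intros t. now rewrite <- EA.
  - intros X HX. apply CI_ext with (2 := H3 X HX). intros t. now rewrite EA.
  - intros X HX. rewrite <- E by lra. apply CI_ext with (2 := H4 X HX).
    intros t. now rewrite EA.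
Qed.

Lemma cauchy_class_lin (h g : C -> C) (c d : C) :
  cauchy_class sg h -> cauchy_class sg g -> cauchy_class sg (fun Y => c * h Y + d * g Y).
Proof.
  intros [H1 [[K H2] [H3 H4]]] [G1 [[L G2] [G3 G4]]].
  split; [|split; [exists (Cmod c * K + Cmod d * L)%R|split]].
  - apply Ccont_plus; apply Ccont_mult; auto using Ccont_const.
  - intros t. eapply Rle_trans; [apply Cmod_triangle|]. rewrite !Cmod_mult.
    assert (P := weight_pos t).
    replace ((Cmod c * K + Cmod d * L) / weight t)%R
      with (Cmod c * (K / weight t) + Cmod d * (L / weight t))%R by (field; lra).
    apply Rplus_le_compat; apply Rmult_le_compat_l; auto using Cmod_ge_0.
  - intros X HX. replace (RtoC 0) with (c * 0 + d * 0) by ring.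
    apply CI_ext with (fun t => c * (h (axis t) * / (axis t - X)) + d * (g (axis t) * / (axis t - X))).
    { intros t. ring. }
    apply CI_plus; apply CI_scal; auto.
  - intros X HX.
    replace (RtoC (sg * (2 * PI)) * (c * h X + d * g X))
      with (c * (RtoC (sg * (2 * PI)) * h X) + d * (RtoC (sg * (2 * PI)) * g X)) by ring.
    apply CI_ext with (fun t => c * (h (axis t) * / (axis t - X)) + d * (g (axis t) * / (axis t - X))).
    { intros t. ring. }
    apply CI_plus; apply CI_scal; auto.
Qed.

Lemma sg_Re_neq_0 (X : C) : (0 < sg * Re X)%R -> Re X <> 0%R.
Proof. intros H E. rewrite E in H. lra. Qed.

Lemma sg_Re_neq_0' (X : C) : (sg * Re X < 0)%R -> Re X <> 0%R.
Proof. intros H E. rewrite E in H. lra. Qed.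

Lemma sgn_same (X : C) : (0 < sg * Re X)%R -> sgn (Re X) = sg.
Proof. intros H. unfold sgn. destruct (Rlt_dec 0 (Re X)), Hsg as [E|E]; subst sg; lra. Qed.

Lemma sgn_opposite (X : C) : (sg * Re X < 0)%R -> sgn (Re X) = (- sg)%R.
Proof. intros H. unfold sgn. destruct (Rlt_dec 0 (Re X)), Hsg as [E|E]; subst sg; lra. Qed.

Lemma neq_of_Re (b X : C) : Re b <> Re X -> X - b <> 0.
Proof.
  intros H E. apply H. apply (f_equal fst) in E. unfold Re. simpl in E. lra.
Qed.

Lemma kernel_partial_fractions (b X : C) (t : R) :
  Re b <> 0%R -> Re X <> 0%R -> X - b <> 0 ->
  / (axis t - b) * / (axis t - X) = / (X - b) * (/ (axis t - X) - / (axis t - b)).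
Proof.
  intros Hb HX H. assert (N1 := axis_minus_neq_0 b t Hb). assert (N2 := axis_minus_neq_0 X t HX).
  field. auto.
Qed.

(** Partial fractions reduce the product of two kernels to [CI_kernel_diff]: the signs cancel for
    poles on the same side of the axis and add up to 2 pi for poles on opposite sides. *)
Lemma cauchy_class_pole (b : C) : (0 < sg * Re b)%R -> cauchy_class sg (fun Y => / (Y - b)).
Proof.
  intros Hb. assert (Rb := sg_Re_neq_0 b Hb).
  assert (Hc := Ccont_kernel b Rb).
  destruct (Cmod_inv_kernel_le b Rb) as [K [HK HKW]].
  assert (Hdiff : forall X, (0 < sg * Re X)%R -> X <> b ->
    CI (fun t => / (axis t - b) * / (axis t - X)) 0).
  { intros X HX HXb. assert (RX := sg_Re_neq_0 X HX).
    assert (N : X - b <> 0) by (intros E; apply HXb; replace X with ((X - b) + b) by ring; rewrite E; ring).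
    apply CI_ext with (fun t => / (X - b) * (/ (axis t - X) - / (axis t - b))).
    { intros t. now rewrite kernel_partial_fractions. }
    replace (RtoC 0) with (/ (X - b) * RtoC ((sgn (Re b) - sgn (Re X)) * PI)).
    - now apply CI_scal, CI_kernel_diff.
    - rewrite !sgn_same by auto. rewrite Rminus_diag, Rmult_0_l. ring. }
  split; [exact Hc|split; [now exists K|split]].
  - intros X HX. destruct (Ceq_dec X b) as [->|N].
    + now apply (CI_vanish_at_limit_point sg _ K).
    + now apply Hdiff.
  - intros X HX. assert (RX := sg_Re_neq_0' X HX).
    assert (N : X - b <> 0).
    { apply neq_of_Re. intros E. rewrite E in Hb. lra. }
    apply CI_ext with (fun t => / (X - b) * (/ (axis t - X) - / (axis t - b))).
    { intros t. now rewrite kernel_partial_fractions. }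
    replace (RtoC (sg * (2 * PI)) * / (X - b))
      with (/ (X - b) * RtoC ((sgn (Re b) - sgn (Re X)) * PI)).
    + now apply CI_scal, CI_kernel_diff.
    + rewrite sgn_same, sgn_opposite by auto.
      replace ((sg - - sg) * PI)%R with (sg * (2 * PI))%R by ring. ring.
Qed.

(** By partial fractions the new integral is a combination of the integrals of [h] against the
    kernels at X and at [b]. The one at [b] is 0 because [b] lies on the side of the poles; the
    double pole X = b is reached by the limit argument. *)
Lemma cauchy_class_mul_pole (h : C -> C) (b : C) :
  (0 < sg * Re b)%R -> cauchy_class sg h -> cauchy_class sg (fun Y => h Y * / (Y - b)).
Proof.
  intros Hb [H1 [[K H2] [H3 H4]]]. assert (Rb := sg_Re_neq_0 b Hb).
  assert (Hc : Ccont (fun t => h (axis t) * / (axis t - b))) by (apply Ccont_mult; auto using Ccont_kernel).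
  destruct (Cmod_inv_kernel_le b Rb) as [L [HL HLW]].
  assert (HB : forall t, (Cmod (h (axis t) * / (axis t - b)) <= K * L / weight t)%R).
  { intros t. rewrite Cmod_mult. assert (P := weight_pos t). assert (W := weight_ge_1 t).
    apply Rle_trans with ((K / weight t) * (L / weight t))%R.
    - apply Rmult_le_compat; auto using Cmod_ge_0.
    - assert (0 <= K / weight t)%R by (eapply Rle_trans; [apply Cmod_ge_0|apply H2]).
      replace (K * L / weight t)%R with (K / weight t * L)%R by (field; lra).
      apply Rmult_le_compat_l; auto. apply Rle_div_l; nra. }
  assert (split_kernel : forall X t, Re X <> 0%R -> X - b <> 0 ->
    / (X - b) * (h (axis t) * / (axis t - X) + (- (1)) * (h (axis t) * / (axis t - b)))
    = h (axis t) * / (axis t - b) * / (axis t - X)).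
  { intros X t RX N. rewrite <- Cmult_assoc, kernel_partial_fractions by auto. ring. }
  split; [exact Hc|split; [now exists (K * L)%R|split]].
  - assert (Hdiff : forall X, (0 < sg * Re X)%R -> X <> b ->
      CI (fun t => h (axis t) * / (axis t - b) * / (axis t - X)) 0).
    { intros X HX HXb. assert (RX := sg_Re_neq_0 X HX).
      assert (N : X - b <> 0) by (intros E; apply HXb; replace X with ((X - b) + b) by ring; rewrite E; ring).
      apply CI_ext with (1 := fun t => split_kernel X t RX N).
      replace (RtoC 0) with (/ (X - b) * (0 + (- (1)) * 0)) by ring.
      apply CI_scal, CI_plus; [now apply H3|]. apply CI_scal. now apply H3. }
    intros X HX. destruct (Ceq_dec X b) as [->|N].
    + now apply (CI_vanish_at_limit_point sg _ (K * L)).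
    + now apply Hdiff.
  - intros X HX. assert (RX := sg_Re_neq_0' X HX).
    assert (N : X - b <> 0) by (apply neq_of_Re; intros E; rewrite E in Hb; lra).
    apply CI_ext with (1 := fun t => split_kernel X t RX N).
    replace (RtoC (sg * (2 * PI)) * (h X * / (X - b)))
      with (/ (X - b) * (RtoC (sg * (2 * PI)) * h X + (- (1)) * 0)) by ring.
    apply CI_scal, CI_plus; [now apply H4|]. apply CI_scal. now apply H3.
Qed.

Definition sfac_root (b : R) : C := RtoC (b + / b).

Lemma sfac_factor (b : R) (Y : C) : b <> 0%R -> sfac b Y = - RtoC b * (Y - sfac_root b).
Proof.
  intros H. unfold sfac, sfac_root. rewrite RtoC_plus, RtoC_inv by auto. field. now apply RtoC_neq_0.
Qed.

Lemma sfac_root_Re (b : R) : (0 < sg * b)%R -> (0 < sg * Re (sfac_root b))%R.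
Proof.
  intros H. unfold sfac_root, Re. simpl.
  assert (b <> 0)%R by (intros E; rewrite E in H; lra).
  replace (sg * (b + / b))%R with (sg * b + sg * b * (/ b * / b))%R by (field; auto).
  assert (0 < / b * / b)%R by (assert (/ b <> 0)%R by (now apply Rinv_neq_0_compat); nra).
  nra.
Qed.

(** A quotient of two affine functions is a constant plus a multiple of a simple pole, here at b +
    1/b, which lies in the same half plane as [b]. *)
Lemma cauchy_class_sfac_ratio (h : C -> C) (a b : R) :
  (0 < sg * b)%R -> cauchy_class sg h ->
  cauchy_class sg (fun Y => h Y * (sfac a Y / sfac b Y)).
Proof.
  intros Hb Hh. assert (Rp := sfac_root_Re b Hb).
  assert (B : b <> 0%R) by (intros E; rewrite E in Hb; lra).
  assert (B' := RtoC_neq_0 b B).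
  apply cauchy_class_ext with (fun Y => RtoC (a / b) * h Y
    + (- (sfac a (sfac_root b) / RtoC b)) * (h Y * / (Y - sfac_root b))).
  - intros Y HY. rewrite (sfac_factor b Y) by auto.
    assert (N : Y - sfac_root b <> 0) by (apply neq_of_Re; intros E; rewrite E in Rp; lra).
    replace (sfac a Y) with (sfac a (sfac_root b) - RtoC a * (Y - sfac_root b)) by (unfold sfac; ring).
    rewrite RtoC_div by auto. field. auto.
  - apply cauchy_class_lin; auto. now apply cauchy_class_mul_pole.
Qed.

Lemma cauchy_class_inv_sfac (b : R) :
  (0 < sg * b)%R -> cauchy_class sg (fun Y => / sfac b Y).
Proof.
  intros Hb. assert (Rp := sfac_root_Re b Hb).
  assert (B : b <> 0%R) by (intros E; rewrite E in Hb; lra).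
  assert (B' := RtoC_neq_0 b B).
  apply cauchy_class_ext with (fun Y => - / RtoC b * / (Y - sfac_root b) + 0 * / (Y - sfac_root b)).
  - intros Y HY. rewrite (sfac_factor b Y) by auto.
    assert (N : Y - sfac_root b <> 0) by (apply neq_of_Re; intros E; rewrite E in Rp; lra).
    field. auto.
  - apply cauchy_class_lin; now apply cauchy_class_pole.
Qed.

End Cauchy_class.

(** * Hermite form of the interpolation error *)

(** A total operator: the discrepancy in the expansion has to be named, and followed along a q^N,
    before the value of the integral is known. *)
Definition Cint (g : R -> C) : C :=
  (RInt_gen (V := R_CompleteNormedModule) (fun t => fst (g t)) (Rbar_locally m_infty) (Rbar_locally p_infty),
   RInt_gen (V := R_CompleteNormedModule) (fun t => snd (g t)) (Rbar_locally m_infty) (Rbar_locally p_infty)).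

Lemma Cint_correct (g : R -> C) (l : C) : CI g l -> CI g (Cint g).
Proof.
  intros H. replace (Cint g) with l; auto. destruct H as [H1 H2].
  unfold Cint. apply injective_projections; simpl; symmetry;
    now apply (is_RInt_gen_unique (V := R_CompleteNormedModule)
      (Fa := Rbar_locally m_infty) (Fb := Rbar_locally p_infty)).
Qed.

Lemma continuous_exp_comp (f : R -> R) (t : R) :
  continuous f t -> continuous (fun s => exp (f s)) t.
Proof.
  intros H. apply (continuous_comp f exp); auto.
  apply is_derive_continuous with (exp (f t)). apply is_derive_exp.
Qed.

(** * Products on the axis and their rational quotients *)

Section Bounds.
Context (q : R) (hq : (0 < q < 1)%R).

Let pow_q_pos (n : nat) : (0 < q ^ n)%R.
Proof. apply pow_lt; lra. Qed.

Let pow_q_le_1 (n : nat) : (q ^ n <= 1)%R.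
Proof. rewrite <- (pow1 n). apply pow_incr. lra. Qed.

Lemma Cmod_axis (t : R) : Cmod (axis t) = Rabs t.
Proof.
  unfold Cmod, axis. simpl.
  replace (0 * (0 * 1) + t * (t * 1))%R with (Rsqr t) by (unfold Rsqr; ring).
  apply sqrt_Rsqr_abs.
Qed.

Lemma Ccont_spoch (a : R) (n : nat) : Ccont (fun t => spoch q a (axis t) n).
Proof.
  induction n as [|n IH].
  - unfold spoch. simpl. apply Ccont_const.
  - apply Ccont_ext with (fun t => spoch q a (axis t) n * sfac (a * q ^ n) (axis t)).
    + intros t. now rewrite spoch_S.
    + apply Ccont_mult; auto. unfold sfac. apply Ccont_minus; [apply Ccont_const|].
      apply Ccont_mult; [apply Ccont_const|apply Ccont_axis].
Qed.

Lemma Ccont_spoch_inf (a : R) : Ccont (fun t => spoch_inf q a (axis t)).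
Proof.
  set (D := (a * a + Rabs a)%R).
  assert (HD : (0 <= D)%R) by (unfold D; assert (0 <= Rabs a) by apply Rabs_pos; nra).
  (* The growth factor is the step bound of [cprod_step_le] with c = D (1 + t^2); |t| <= 1 + t^2
     makes it smooth in t. *)
  apply (Ccont_of_approx (fun n t => spoch q a (axis t) n) _ (fun n => / (1 - q) * q ^ n)%R
    (fun t => exp (D / (1 - q) * (1 + t * t)) * (D * (1 + t * t)))%R).
  - intros n. apply Ccont_spoch.
  - intros t.
    assert (Q : forall c, continuous (fun s => c * (1 + s * s))%R t).
    { intros c. apply continuous_Rmult; [apply continuous_const|].
      apply continuous_Rplus; [apply continuous_const|].
      apply continuous_Rmult; apply continuous_id. }
    apply continuous_Rmult; auto. now apply continuous_exp_comp.
  - intros n t.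
    replace (/ (1 - q) * q ^ n * (exp (D / (1 - q) * (1 + t * t)) * (D * (1 + t * t))))%R
      with (exp (D / (1 - q) * (1 + t * t)) * (D * (1 + t * t)) / (1 - q) * q ^ n)%R
      by (field; lra).
    apply geometric_rate; auto; [|now apply spoch_cv].
    intros k. replace (D / (1 - q) * (1 + t * t))%R with (D * (1 + t * t) / (1 - q))%R by (field; lra).
    apply (cprod_step_le q hq).
    + apply Rmult_le_pos; nra.
    + intros j. eapply Rle_trans; [now apply sfac_minus_1_le|].
      apply Rmult_le_compat_r; [left; apply pow_q_pos|].
      rewrite Cmod_axis. unfold D.
      assert (0 <= Rabs a) by apply Rabs_pos.
      assert (Rabs t <= 1 + t * t)%R by (apply Rabs_le; nra). nra.
  - now apply is_lim_seq_scal_geom.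
Qed.

Lemma axis_Re_mul (a t : R) : (a * Re (axis t) <= 0)%R.
Proof. unfold Re, axis. simpl. lra. Qed.

Lemma spoch_axis_neq_0 (a t : R) (n : nat) : spoch q a (axis t) n <> 0.
Proof. apply spoch_neq_0; auto. apply axis_Re_mul. Qed.

Lemma spoch_inf_axis_neq_0 (a t : R) : spoch_inf q a (axis t) <> 0.
Proof. apply spoch_inf_neq_0; auto. apply axis_Re_mul. Qed.

Lemma spoch_axis_mono (a b t : R) (n : nat) : (Rabs a <= b)%R ->
  (Cmod (spoch q a (axis t) n) <= Cmod (spoch q b (axis t) n))%R.
Proof.
  intros H. induction n as [|n IH]; [apply Rle_refl|].
  rewrite !spoch_S, !Cmod_mult. apply Rmult_le_compat; auto using Cmod_ge_0.
  apply sfac_axis_mono. rewrite Rabs_mult, (Rabs_pos_eq (q ^ n)) by (left; apply pow_q_pos).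
  apply Rmult_le_compat_r; auto. left; apply pow_q_pos.
Qed.

Lemma spoch_inf_axis_mono (a b t : R) : (Rabs a <= b)%R ->
  (Cmod (spoch_inf q a (axis t)) <= Cmod (spoch_inf q b (axis t)))%R.
Proof.
  intros H. apply (cv_le (spoch q a (axis t)) (spoch q b (axis t))); auto using spoch_cv.
  intros n. now apply spoch_axis_mono.
Qed.

Lemma spoch_axis_le (a : R) (n : nat) : exists K, (0 < K)%R /\
  forall t, (Cmod (spoch q a (axis t) n) <= K * weight t ^ n)%R.
Proof.
  induction n as [|n [K [HK IH]]].
  - exists 1%R. split; [lra|]. intros t. unfold spoch. simpl. rewrite Cmod_1. lra.
  - set (b := (a * q ^ n)%R).
    assert (0 <= Rabs b) by apply Rabs_pos.
    exists (K * (1 + b * b + Rabs b))%R. split; [apply Rmult_lt_0_compat; nra|].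
    intros t. rewrite spoch_S, Cmod_mult. fold b.
    replace (K * (1 + b * b + Rabs b) * weight t ^ S n)%R
      with ((K * weight t ^ n) * ((1 + b * b + Rabs b) * weight t))%R by (simpl; ring).
    apply Rmult_le_compat; auto using Cmod_ge_0, sfac_axis_le.
Qed.

Lemma spoch_axis_ge (a : R) (n : nat) : a <> 0%R -> exists K, (0 < K)%R /\
  forall t, (K * weight t ^ n <= Cmod (spoch q a (axis t) n))%R.
Proof.
  intros Ha. induction n as [|n [K [HK IH]]].
  - exists 1%R. split; [lra|]. intros t. unfold spoch. simpl. rewrite Cmod_1. lra.
  - set (b := (a * q ^ n)%R).
    assert (b <> 0%R) by (unfold b; assert (P := pow_q_pos n); apply Rmult_integral_contrapositive; split; lra).
    assert (0 < Rmin 1 (Rabs b))%R by (apply Rmin_glb_lt; [lra|now apply Rabs_pos_lt]).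
    exists (K * Rmin 1 (Rabs b))%R. split; [now apply Rmult_lt_0_compat|].
    intros t. rewrite spoch_S, Cmod_mult. fold b. assert (P := weight_pos t).
    replace (K * Rmin 1 (Rabs b) * weight t ^ S n)%R
      with ((K * weight t ^ n) * (Rmin 1 (Rabs b) * weight t))%R by (simpl; ring).
    apply Rmult_le_compat; auto using sfac_axis_ge.
    + apply Rmult_le_pos; [lra|apply pow_le; lra].
    + apply Rmult_le_pos; lra.
Qed.

(** Every factor has modulus at least 1 on the axis. Consequently any partial product bounds the
    later ones, and the infinite product, from below. *)
Lemma spoch_axis_incr (a t : R) (m k : nat) :
  (Cmod (spoch q a (axis t) m) <= Cmod (spoch q a (axis t) (m + k)))%R.
Proof.
  induction k as [|k IH]; [rewrite Nat.add_0_r; apply Rle_refl|].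
  rewrite Nat.add_succ_r, spoch_S, Cmod_mult.
  assert (1 <= Cmod (sfac (a * q ^ (m + k)) (axis t)))%R by (apply sfac_ge_1, axis_Re_mul).
  assert (0 <= Cmod (spoch q a (axis t) (m + k))) by apply Cmod_ge_0. nra.
Qed.

Lemma spoch_inf_axis_ge (a t : R) (m : nat) :
  (Cmod (spoch q a (axis t) m) <= Cmod (spoch_inf q a (axis t)))%R.
Proof.
  apply (cv_ge_const (fun k => spoch q a (axis t) (k + m)%nat)).
  - intros k. rewrite Nat.add_comm. apply spoch_axis_incr.
  - apply (cv_incr_n (spoch q a (axis t))). now apply spoch_cv.
Qed.

(** Used with [sg = 1] for [beta] and [sg = -1] for [xi]. At least one factor is present because the
    constant 1 does not decay; further ones enter as [sfac 0 / sfac b], whose numerator is 1. *)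
Lemma cauchy_class_inv_spoch (sg b : R) (n : nat) : (sg = 1 \/ sg = -1)%R -> (0 < sg * b)%R ->
  cauchy_class sg (fun Y => / spoch q b Y (S n)).
Proof.
  intros Hsg Hb.
  assert (HY : forall Y, (sg * Re Y <= 0)%R -> (b * Re Y <= 0)%R).
  { intros Y H. destruct Hsg; subst sg; nra. }
  induction n as [|n IH].
  - apply cauchy_class_ext with (fun Y => / sfac b Y).
    + intros Y H. f_equal. rewrite spoch_S. unfold spoch. simpl. rewrite Rmult_1_r. ring.
    + now apply cauchy_class_inv_sfac.
  - apply cauchy_class_ext with (fun Y => / spoch q b Y (S n) * (sfac 0 Y / sfac (b * q ^ S n) Y)).
    + intros Y H. rewrite (spoch_S q b Y (S n)), sfac_0.
      assert (N1 := spoch_neq_0 q hq b Y (S n) (HY Y H)).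
      assert (N2 := spoch_neq_0 q hq b Y (S (S n)) (HY Y H)).
      rewrite (spoch_S q b Y (S n)) in N2.
      assert (sfac (b * q ^ S n) Y <> 0) by (intros E; apply N2; rewrite E; ring).
      field. auto.
    + apply cauchy_class_sfac_ratio; auto.
      rewrite <- Rmult_assoc. apply Rmult_lt_0_compat; auto.
Qed.

(** Rational approximants of [ratio a] when [b = beta]. The two surplus denominator factors give the
    decay weight^(-2) and match the threshold beta q^2. *)
Lemma cauchy_class_spoch_ratio (a b : R) (m : nat) : (0 < b)%R ->
  cauchy_class 1 (fun Y => spoch q a Y m / spoch q b Y (m + 2)).
Proof.
  intros Hb.
  assert (HY : forall Y, (1 * Re Y <= 0)%R -> (b * Re Y <= 0)%R) by (intros Y H; nra).
  induction m as [|m IH].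
  - apply cauchy_class_ext with (fun Y => / spoch q b Y 2).
    + intros Y H. unfold spoch at 2. simpl cprod. unfold Cdiv. simpl. ring.
    + apply (cauchy_class_inv_spoch 1 b 1); lra.
  - apply cauchy_class_ext with
      (fun Y => spoch q a Y m / spoch q b Y (m + 2) * (sfac (a * q ^ m) Y / sfac (b * q ^ (m + 2)) Y)).
    + intros Y H. replace (S m + 2)%nat with (S (m + 2)) by lia. rewrite !(spoch_S q).
      assert (N1 := spoch_neq_0 q hq b Y (m + 2) (HY Y H)).
      assert (N2 := spoch_neq_0 q hq b Y (S (m + 2)) (HY Y H)).
      rewrite spoch_S in N2.
      assert (sfac (b * q ^ (m + 2)) Y <> 0) by (intros E; apply N2; rewrite E; ring).
      field. auto.
    + apply cauchy_class_sfac_ratio; auto.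
      rewrite Rmult_1_l. apply Rmult_lt_0_compat; auto.
Qed.

End Bounds.

(** * The Hermite formula for each number of nodes *)

Section Newton.
Context (q beta xi : R) (hq : (0 < q < 1)%R) (hbeta : (0 < beta)%R) (hxi : (xi < 0)%R).
Context (X : C) (HX : (Re X < 0)%R).

Let pow_q_pos (n : nat) : (0 < q ^ n)%R.
Proof. apply pow_lt; lra. Qed.

Let pow_q_le_1 (n : nat) : (q ^ n <= 1)%R.
Proof. rewrite <- (pow1 n). apply pow_incr. lra. Qed.

Let ReX_neq_0 : Re X <> 0%R.
Proof. lra. Qed.

Let rat := ratio q beta.

Definition newton_kernel (n : nat) (t : R) : C :=
  spoch q xi X n / spoch q xi (axis t) n * / (axis t - X).

(** Along the axis dY = i dt, which turns the Cauchy factor 2 pi i into 2 pi. The upward direction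
    has X and the nodes on its left, so the sign is positive. *)
Definition hermite (n : nat) (a : R) : Prop :=
  CI (fun t => rat a (axis t) * newton_kernel n t)
     (RtoC (2 * PI) * remainder q beta xi n a X).

(** In the expansion of [sfac a] at the n-th node, the linear term cancels the last factor of the
    denominator, leaving the kernel with [n] nodes. The coefficients are those of
    [remainder_rec]. *)
Lemma newton_integrand_rec (n : nat) (a t : R) :
  rat a (axis t) * newton_kernel (S n) t =
    RtoC (a / node q xi n) * sfac (node q xi n) X * (rat (a * q) (axis t) * newton_kernel n t)
    + RtoC (sfac_node q xi a n) * (rat (a * q) (axis t) * newton_kernel (S n) t).
Proof.
  unfold newton_kernel, rat. rewrite (ratio_head q beta hq a).
  rewrite (sfac_expand_node q xi hq hxi a n (axis t)).
  rewrite !(spoch_S q xi). fold (node q xi n).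
  assert (N1 := spoch_axis_neq_0 q hq xi t n).
  assert (N2 := spoch_axis_neq_0 q hq xi t (S n)).
  rewrite spoch_S in N2. fold (node q xi n) in N2.
  assert (sfac (node q xi n) (axis t) <> 0) by (intros E; apply N2; rewrite E; ring).
  assert (N3 := axis_minus_neq_0 X t ReX_neq_0).
  field. auto.
Qed.

Lemma hermite_up (n : nat) (a : R) :
  hermite n (a * q) -> hermite (S n) (a * q) -> hermite (S n) a.
Proof.
  intros H1 H2. unfold hermite. rewrite remainder_rec by auto.
  apply CI_ext with (1 := fun t => eq_sym (newton_integrand_rec n a t)).
  replace (RtoC (2 * PI) * (RtoC (a / node q xi n) * sfac (node q xi n) X * remainder q beta xi n (a * q) X
      + RtoC (sfac_node q xi a n) * remainder q beta xi (S n) (a * q) X))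
    with (RtoC (a / node q xi n) * sfac (node q xi n) X * (RtoC (2 * PI) * remainder q beta xi n (a * q) X)
      + RtoC (sfac_node q xi a n) * (RtoC (2 * PI) * remainder q beta xi (S n) (a * q) X)) by ring.
  apply CI_plus; now apply CI_scal.
Qed.

Lemma hermite_down (n : nat) (a : R) : sfac_node q xi a n <> 0%R ->
  hermite (S n) a -> hermite n (a * q) -> hermite (S n) (a * q).
Proof.
  intros N H1 H2. unfold hermite in *. rewrite remainder_rec in H1 by auto.
  assert (N' := RtoC_neq_0 _ N).
  apply CI_ext with (fun t => / RtoC (sfac_node q xi a n) *
    (rat a (axis t) * newton_kernel (S n) t
     + (- (RtoC (a / node q xi n) * sfac (node q xi n) X)) * (rat (a * q) (axis t) * newton_kernel n t))).
  { intros t. rewrite (newton_integrand_rec n a). field. auto. }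
  replace (RtoC (2 * PI) * remainder q beta xi (S n) (a * q) X) with
    (/ RtoC (sfac_node q xi a n) *
    (RtoC (2 * PI) * (RtoC (a / node q xi n) * sfac (node q xi n) X * remainder q beta xi n (a * q) X
      + RtoC (sfac_node q xi a n) * remainder q beta xi (S n) (a * q) X)
     + (- (RtoC (a / node q xi n) * sfac (node q xi n) X)) * (RtoC (2 * PI) * remainder q beta xi n (a * q) X)))
    by (field; auto).
  apply CI_scal, CI_plus; auto. now apply CI_scal.
Qed.

(* For [a = beta] the interpolated function is constant, and the contour can be closed on the
   right, where the integrand has no pole. *)
Lemma hermite_beta (n : nat) : hermite (S n) beta.
Proof.
  unfold hermite. rewrite remainder_beta by (auto; lra).
  assert (K := cauchy_class_inv_spoch q hq (-1) xi n ltac:(lra) ltac:(lra)).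
  destruct K as [_ [_ [K _]]]. specialize (K X ltac:(lra)).
  apply CI_ext with (fun t => spoch q xi X (S n) * (/ spoch q xi (axis t) (S n) * / (axis t - X))).
  - intros t. unfold newton_kernel, rat, ratio.
    assert (spoch_inf q beta (axis t) <> 0) by now apply spoch_inf_axis_neq_0.
    unfold Cdiv. rewrite Cinv_r by auto. ring.
  - replace (RtoC (2 * PI) * 0) with (spoch q xi X (S n) * 0) by ring. now apply CI_scal.
Qed.

Lemma ratio_beta_pow (j : nat) (Y : C) : (Re Y <= 0)%R -> rat (beta * q ^ j) Y = / spoch q beta Y j.
Proof.
  intros H. unfold rat, ratio. rewrite (spoch_inf_split q hq beta Y j).
  assert (N := spoch_inf_neq_0 q hq beta Y ltac:(nra)).
  assert (N1 := spoch_neq_0 q hq beta Y j ltac:(nra)).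
  rewrite (spoch_inf_split q hq beta Y j) in N.
  assert (spoch_inf q (beta * q ^ j) Y <> 0) by (intros E; apply N; rewrite E; ring).
  field. auto.
Qed.

Lemma axis_Re_nonpos (t : R) : (Re (axis t) <= 0)%R.
Proof. unfold Re, axis. simpl. lra. Qed.

Lemma newton_kernel_0 (t : R) : newton_kernel 0 t = / (axis t - X).
Proof. unfold newton_kernel, spoch. simpl. unfold Cdiv. rewrite Cinv_r by apply C1_nz. ring. Qed.

Lemma remainder_0 (a : R) : remainder q beta xi 0 a X = rat a X.
Proof. unfold remainder. simpl. unfold rat. ring. Qed.

(** Cauchy's formula for the reciprocal of a finite product. The exponent is at least 1: for [beta]
    itself the integrand would be the bare kernel, whose integral diverges. *)
Lemma hermite_0_beta_pow (j : nat) : hermite 0 (beta * q ^ S j).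
Proof.
  unfold hermite. rewrite remainder_0, ratio_beta_pow by lra.
  assert (K := cauchy_class_inv_spoch q hq 1 beta j ltac:(lra) ltac:(lra)).
  destruct K as [_ [_ [_ K]]]. specialize (K X ltac:(lra)).
  rewrite Rmult_1_l in K. apply CI_ext with (2 := K).
  intros t. now rewrite newton_kernel_0, ratio_beta_pow by apply axis_Re_nonpos.
Qed.

Lemma sfac_node_beta_neq_0 (j n : nat) : sfac_node q xi (beta * q ^ j) n <> 0%R.
Proof.
  unfold sfac_node. assert (N := node_neg q xi hq hxi n).
  assert (0 < beta * q ^ j)%R by (apply Rmult_lt_0_compat; auto).
  assert (/ node q xi n < 0)%R by now apply Rinv_lt_0_compat.
  unfold Rdiv. apply Rmult_integral_contrapositive. split; nra.
Qed.

Lemma hermite_beta_pow (n j : nat) : hermite n (beta * q ^ S j).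
Proof.
  revert j. induction n as [|n IHn]; [apply hermite_0_beta_pow|].
  (* Here exponent 0 is allowed, and is the start of the induction, because a positive number of
     nodes makes the integrand decay. *)
  assert (forall j, hermite (S n) (beta * q ^ j)).
  { intros j. induction j as [|j IHj].
    - rewrite pow_O, Rmult_1_r. apply hermite_beta.
    - assert (IH := IHn j).
      replace (beta * q ^ S j)%R with (beta * q ^ j * q)%R in * by (simpl; ring).
      apply hermite_down; auto. apply sfac_node_beta_neq_0. }
  auto.
Qed.

(** Split [m] factors off the numerator, at the cost weight^m, and two off the denominator, gaining
    weight^(-2). The quotient of the remaining infinite products is at most 1 by monotonicity in the
    parameter. *)
Lemma ratio_axis_le (a : R) (m : nat) : (Rabs a * q ^ m <= beta * q ^ 2)%R ->
  exists K, (0 < K)%R /\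
  forall t, (Cmod (rat a (axis t)) <= K * weight t ^ m / (weight t * weight t))%R.
Proof.
  intros Ha.
  destruct (spoch_axis_le q hq a m) as [K1 [HK1 H1]].
  destruct (spoch_axis_ge q hq beta 2 ltac:(lra)) as [K2 [HK2 H2]].
  exists (K1 / K2)%R. split; [now apply Rdiv_lt_0_compat|]. intros t.
  assert (P := weight_pos t).
  unfold rat, ratio. rewrite Cmod_div by now apply spoch_inf_axis_neq_0.
  rewrite (spoch_inf_split q hq a (axis t) m), (spoch_inf_split q hq beta (axis t) 2), !Cmod_mult.
  assert (H3 : (Cmod (spoch_inf q (a * q ^ m) (axis t)) <= Cmod (spoch_inf q (beta * q ^ 2) (axis t)))%R).
  { apply spoch_inf_axis_mono; auto. rewrite Rabs_mult, (Rabs_pos_eq (q ^ m)); auto.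
    left; apply pow_q_pos. }
  assert (P3 : (0 < Cmod (spoch_inf q (beta * q ^ 2) (axis t)))%R)
    by (apply Cmod_gt_0; now apply spoch_inf_axis_neq_0).
  specialize (H1 t). specialize (H2 t).
  set (A := Cmod (spoch q a (axis t) m)) in *. set (B := Cmod (spoch q beta (axis t) 2)) in *.
  set (c := Cmod (spoch_inf q (a * q ^ m) (axis t))) in *.
  set (d := Cmod (spoch_inf q (beta * q ^ 2) (axis t))) in *.
  replace (weight t ^ 2)%R with (weight t * weight t)%R in H2 by ring.
  assert (W2 : (0 < K2 * (weight t * weight t))%R) by (repeat apply Rmult_lt_0_compat; auto).
  replace (K1 / K2 * weight t ^ m / (weight t * weight t))%R
    with ((K1 * weight t ^ m) * / (K2 * (weight t * weight t)))%R by (field; lra).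
  replace (A * c / (B * d))%R with ((A * / B) * (c / d))%R by (field; lra).
  rewrite <- (Rmult_1_r (K1 * weight t ^ m * _)).
  assert (0 <= A) by apply Cmod_ge_0.
  assert (0 < / B) by (apply Rinv_0_lt_compat; lra).
  apply Rmult_le_compat.
  - apply Rmult_le_pos; lra.
  - apply Rmult_le_pos; [apply Cmod_ge_0|left; now apply Rinv_0_lt_compat].
  - apply Rmult_le_compat; try lra. apply Rinv_le_contravar; lra.
  - apply Rle_div_l; lra.
Qed.

(** One [K] serves all small [a], by comparison with the parameter beta q^2. This uniformity is what
    the limits along a q^N require. *)
Lemma ratio_axis_small_le : exists K, (0 < K)%R /\
  forall a t, (Rabs a <= beta * q ^ 2)%R -> (Cmod (rat a (axis t)) <= K / (weight t * weight t))%R.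
Proof.
  destruct (ratio_axis_le (beta * q ^ 2) 0) as [K [HK H]].
  { assert (P := pow_q_pos 2). rewrite Rabs_pos_eq by nra. rewrite pow_O. lra. }
  exists K. split; auto. intros a t Ha. specialize (H t). rewrite pow_O, Rmult_1_r in H.
  eapply Rle_trans; [|exact H]. unfold rat, ratio.
  rewrite !Cmod_div by now apply spoch_inf_axis_neq_0.
  apply Rmult_le_compat_r; [|now apply spoch_inf_axis_mono].
  left. apply Rinv_0_lt_compat, Cmod_gt_0. now apply spoch_inf_axis_neq_0.
Qed.

Lemma Ccont_ratio (a : R) : Ccont (fun t => rat a (axis t)).
Proof.
  apply Ccont_div; [intros t; now apply spoch_inf_axis_neq_0| |]; now apply Ccont_spoch_inf.
Qed.

Lemma Ccont_newton_kernel (n : nat) : Ccont (newton_kernel n).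
Proof.
  unfold newton_kernel. apply Ccont_mult; [|now apply Ccont_kernel].
  apply Ccont_div; [intros t; now apply spoch_axis_neq_0|apply Ccont_const|now apply Ccont_spoch].
Qed.

Lemma newton_kernel_le (n : nat) : exists K, (0 < K)%R /\
  forall t, (Cmod (newton_kernel n t) <= K / weight t)%R.
Proof.
  destruct (Cmod_inv_kernel_le X ReX_neq_0) as [K [HK H]].
  exists ((Cmod (spoch q xi X n) + 1) * K)%R.
  assert (P0 := Cmod_ge_0 (spoch q xi X n)). split; [nra|].
  intros t. unfold newton_kernel. rewrite Cmod_mult, Cmod_div by now apply spoch_axis_neq_0.
  unfold Rdiv at 2. rewrite Rmult_assoc.
  apply Rmult_le_compat; auto using Cmod_ge_0.
  - apply Rmult_le_pos; [auto|]. left. apply Rinv_0_lt_compat, Cmod_gt_0. now apply spoch_axis_neq_0.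
  - assert (E := spoch_ge_1 q hq xi (axis t) n (axis_Re_mul xi t)).
    apply Rle_div_l; nra.
Qed.

Lemma sfac_axis_pow_minus_1_le (a t : R) (n : nat) :
  (Cmod (sfac (a * q ^ n) (axis t) - 1) <= (a * a + Rabs a) * q ^ n * weight t)%R.
Proof.
  eapply Rle_trans; [apply sfac_axis_minus_1_le|].
  apply Rmult_le_compat_r; [left; apply weight_pos|].
  assert (P := pow_q_pos n). assert (L := pow_q_le_1 n).
  rewrite Rabs_mult, (Rabs_pos_eq (q ^ n)) by lra.
  assert (0 <= a * a)%R by apply Rle_0_sqr.
  assert (a * a * (q ^ n * q ^ n) <= a * a * q ^ n)%R by (apply Rmult_le_compat_l; nra).
  nra.
Qed.

Lemma kernel_dominated_cv (f : nat -> R -> C) (g : R -> C) (l : nat -> C) (L : C) (K : R) (n : nat) :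
  (forall k t, (Cmod (f k t - g t) <= K * q ^ k / weight t)%R) ->
  (forall k, CI (fun t => f k t * newton_kernel n t) (l k)) ->
  CI (fun t => g t * newton_kernel n t) L -> cv l L.
Proof.
  intros H Hf Hg. destruct (newton_kernel_le n) as [Kn [HKn Hn]].
  apply (CI_cv (fun k t => f k t * newton_kernel n t) (fun t => g t * newton_kernel n t) l L (K * Kn) q hq Hf Hg).
  intros k t.
  replace (f k t * newton_kernel n t - g t * newton_kernel n t)
    with ((f k t - g t) * newton_kernel n t) by ring.
  rewrite Cmod_mult. assert (P := weight_pos t).
  replace (K * Kn * q ^ k / (weight t * weight t))%R
    with ((K * q ^ k / weight t) * (Kn / weight t))%R by (field; lra).
  apply Rmult_le_compat; auto using Cmod_ge_0.
Qed.

Lemma hermite_integral_ex (n : nat) (a : R) : (Rabs a <= beta * q ^ 2)%R ->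
  CI (fun t => rat a (axis t) * newton_kernel n t)
     (Cint (fun t => rat a (axis t) * newton_kernel n t)).
Proof.
  intros Ha. destruct (newton_kernel_le n) as [Kn [HKn Hn]].
  destruct ratio_axis_small_le as [K [HK H]].
  destruct (CI_ex (fun t => rat a (axis t) * newton_kernel n t) (K * Kn)) as [l Hl].
  - apply Ccont_mult; [apply Ccont_ratio|apply Ccont_newton_kernel].
  - intros t. rewrite Cmod_mult. assert (P := weight_pos t). assert (W := weight_ge_1 t).
    specialize (Hn t). specialize (H a t Ha).
    apply Rle_trans with ((K / (weight t * weight t)) * (Kn / weight t))%R;
      [apply Rmult_le_compat; auto using Cmod_ge_0|].
    assert (0 < K / (weight t * weight t))%R by (apply Rdiv_lt_0_compat; nra).
    replace (K * Kn / (weight t * weight t))%R with ((K / (weight t * weight t)) * Kn)%R by (field; lra).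
    apply Rmult_le_compat_l; [lra|]. apply Rle_div_l; nra.
  - now apply Cint_correct with l.
Qed.

Lemma spoch_ratio_axis_le (a t : R) (m : nat) (K : R) : (0 < K)%R ->
  (K * weight t ^ 2 <= Cmod (spoch q beta (axis t) 2))%R ->
  (Rabs a <= beta * q ^ 2)%R ->
  (Cmod (spoch q a (axis t) m / spoch q beta (axis t) (m + 2)) <= / K / (weight t * weight t))%R.
Proof.
  intros HK H Ha. assert (P := weight_pos t).
  rewrite Cmod_div by now apply spoch_axis_neq_0.
  assert (E : spoch q beta (axis t) (m + 2) = spoch q beta (axis t) 2 * spoch q (beta * q ^ 2) (axis t) m).
  { rewrite Nat.add_comm. unfold spoch. rewrite cprod_split. f_equal. apply cprod_ext.
    intros j. now rewrite pow_add, Rmult_assoc. }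
  rewrite E, Cmod_mult.
  assert (H1 := spoch_axis_mono q hq a (beta * q ^ 2) t m Ha).
  assert (P1 : (0 < Cmod (spoch q (beta * q ^ 2) (axis t) m))%R)
    by (apply Cmod_gt_0; now apply spoch_axis_neq_0).
  assert (W2 : (0 < K * weight t ^ 2)%R) by (apply Rmult_lt_0_compat; [lra|apply pow_lt; lra]).
  replace (/ K / (weight t * weight t))%R with (1 * / (K * weight t ^ 2))%R by (field; lra).
  replace (Cmod (spoch q a (axis t) m) / (Cmod (spoch q beta (axis t) 2) * Cmod (spoch q (beta * q ^ 2) (axis t) m)))%R
    with (Cmod (spoch q a (axis t) m) / Cmod (spoch q (beta * q ^ 2) (axis t) m) * / Cmod (spoch q beta (axis t) 2))%R
    by (field; lra).
  apply Rmult_le_compat.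
  - apply Rmult_le_pos; [apply Cmod_ge_0|left; now apply Rinv_0_lt_compat].
  - left. apply Rinv_0_lt_compat. lra.
  - apply Rle_div_l; lra.
  - apply Rinv_le_contravar; lra.
Qed.

Lemma spoch_ratio_cv (a : R) (Y : C) : (Re Y <= 0)%R ->
  cv (fun m => spoch q a Y m / spoch q beta Y (m + 2)) (rat a Y).
Proof.
  intros H. unfold rat, ratio, Cdiv. apply cv_mult; [now apply spoch_cv|].
  apply cv_inv.
  - intros n. apply spoch_ge_1; auto. nra.
  - apply (cv_incr_n (spoch q beta Y)). now apply spoch_cv.
Qed.

(** With no nodes there is no recursion, so [ratio a] is approximated by quotients of finite
    products, for which Cauchy's formula is known, and the limit is taken under the integral. *)
Lemma hermite_0_small (a : R) : (Rabs a <= beta * q ^ 2)%R -> hermite 0 a.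
Proof.
  intros Ha. unfold hermite. rewrite remainder_0.
  destruct (spoch_axis_ge q hq beta 2 ltac:(lra)) as [K2 [HK2 H2]].
  (* One bracket bounds the deviation from 1 of the new numerator factor, the other that of the new
     denominator factor, whose index is ahead by 2. *)
  set (D := ((a * a + Rabs a) + (beta * q ^ 2 * (beta * q ^ 2) + Rabs (beta * q ^ 2)))%R).
  assert (L : cv (fun m => RtoC (2 * PI) * (spoch q a X m / spoch q beta X (m + 2)))
     (Cint (fun t => rat a (axis t) * newton_kernel 0 t))).
  { apply (kernel_dominated_cv (fun m t => spoch q a (axis t) m / spoch q beta (axis t) (m + 2))
      (fun t => rat a (axis t)) _ _ (/ K2 * D / (1 - q)) 0).
    - intros k t. assert (P := weight_pos t).
      replace (/ K2 * D / (1 - q) * q ^ k / weight t)%R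
        with ((/ K2 * D / weight t) / (1 - q) * q ^ k)%R by (field; lra).
      apply (geometric_rate (fun k => spoch q a (axis t) k / spoch q beta (axis t) (k + 2)));
        auto; [|apply spoch_ratio_cv, axis_Re_nonpos].
      clear k. intros k. replace (S k + 2)%nat with (S (k + 2)) by lia. rewrite !(spoch_S q).
      assert (N1 := spoch_axis_neq_0 q hq beta t (k + 2)).
      assert (N2 : (1 <= Cmod (sfac (beta * q ^ (k + 2)) (axis t)))%R)
        by (apply sfac_ge_1, axis_Re_mul).
      assert (N3 : sfac (beta * q ^ (k + 2)) (axis t) <> 0) by (apply Cmod_gt_0; lra).
      replace (spoch q a (axis t) k * sfac (a * q ^ k) (axis t)
          / (spoch q beta (axis t) (k + 2) * sfac (beta * q ^ (k + 2)) (axis t))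
          - spoch q a (axis t) k / spoch q beta (axis t) (k + 2))
        with (spoch q a (axis t) k / spoch q beta (axis t) (k + 2) *
          (((sfac (a * q ^ k) (axis t) - 1) + - (sfac (beta * q ^ (k + 2)) (axis t) - 1))
            / sfac (beta * q ^ (k + 2)) (axis t)))
        by (field; auto).
      rewrite Cmod_mult, (Cmod_div _ (sfac _ _)) by auto.
      replace (/ K2 * D / weight t * q ^ k)%R
        with ((/ K2 / (weight t * weight t)) * (D * q ^ k * weight t))%R by (field; lra).
      apply Rmult_le_compat; auto using Cmod_ge_0.
      + apply Rmult_le_pos; [apply Cmod_ge_0|]. left. apply Rinv_0_lt_compat. lra.
      + now apply spoch_ratio_axis_le.
      + assert (B : (Cmod (sfac (a * q ^ k) (axis t) - 1 + - (sfac (beta * q ^ (k + 2)) (axis t) - 1))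
          <= D * q ^ k * weight t)%R).
        { eapply Rle_trans; [apply Cmod_triangle|]. rewrite Cmod_opp.
          assert (B1 := sfac_axis_pow_minus_1_le a t k).
          assert (B2 := sfac_axis_pow_minus_1_le (beta * q ^ 2) t k).
          replace (beta * q ^ 2 * q ^ k)%R with (beta * q ^ (k + 2))%R in B2 by (rewrite pow_add; ring).
          unfold D. lra. }
        apply Rle_div_l; [lra|]. assert (B0 := Cmod_ge_0 (sfac (a * q ^ k) (axis t) - 1 + - (sfac (beta * q ^ (k + 2)) (axis t) - 1))).
        nra.
    - intros m. destruct (cauchy_class_spoch_ratio q hq a beta m hbeta) as [_ [_ [_ E]]].
      specialize (E X ltac:(lra)). rewrite Rmult_1_l in E. apply CI_ext with (2 := E).
      intros t. now rewrite newton_kernel_0.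
    - now apply hermite_integral_ex. }
  replace (RtoC (2 * PI) * rat a X) with (Cint (fun t => rat a (axis t) * newton_kernel 0 t)).
  - now apply hermite_integral_ex.
  - apply (cv_unique _ _ _ L). apply cv_scal, spoch_ratio_cv. lra.
Qed.

Lemma small_shift (a : R) (N : nat) : (Rabs a <= beta * q ^ 2)%R -> (Rabs (a * q ^ N) <= beta * q ^ 2)%R.
Proof.
  intros H. rewrite Rabs_mult, (Rabs_pos_eq (q ^ N)) by (left; apply pow_q_pos).
  assert (0 <= Rabs a) by apply Rabs_pos. assert (L := pow_q_le_1 N). assert (P := pow_q_pos N). nra.
Qed.

Lemma small_0 : (Rabs 0 <= beta * q ^ 2)%R.
Proof. rewrite Rabs_R0. assert (P := pow_q_pos 2). nra. Qed.

(** Consecutive quotients differ by ([sfac] - 1) times the later one: O(q^N weight) against the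
    uniform O(weight^(-2)), and the kernel supplies the last power. *)
Lemma hermite_integral_shift_cv (n : nat) (a : R) : (Rabs a <= beta * q ^ 2)%R ->
  cv (fun N => Cint (fun t => rat (a * q ^ N) (axis t) * newton_kernel n t))
     (Cint (fun t => rat 0 (axis t) * newton_kernel n t)).
Proof.
  intros Ha. destruct ratio_axis_small_le as [K [HK H]].
  apply (kernel_dominated_cv (fun N t => rat (a * q ^ N) (axis t)) (fun t => rat 0 (axis t)) _ _
    (K * (a * a + Rabs a) / (1 - q)) n).
  - intros N t. assert (P := weight_pos t).
    replace (K * (a * a + Rabs a) / (1 - q) * q ^ N / weight t)%R
      with (K * (a * a + Rabs a) / weight t / (1 - q) * q ^ N)%R by (field; lra).
    apply (geometric_rate (fun N => rat (a * q ^ N) (axis t))); auto.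
    + clear N. intros N. rewrite <- (Cmod_opp (_ - _)).
      replace (- (rat (a * q ^ S N) (axis t) - rat (a * q ^ N) (axis t)))
        with ((sfac (a * q ^ N) (axis t) - 1) * rat (a * q ^ S N) (axis t)).
      2:{ unfold rat. rewrite (ratio_head q beta hq (a * q ^ N)).
          replace (a * q ^ N * q)%R with (a * q ^ S N)%R by (simpl; ring). ring. }
      rewrite Cmod_mult.
      replace (K * (a * a + Rabs a) / weight t * q ^ N)%R
        with (((a * a + Rabs a) * q ^ N * weight t) * (K / (weight t * weight t)))%R by (field; lra).
      apply Rmult_le_compat; auto using Cmod_ge_0, sfac_axis_pow_minus_1_le, small_shift.
    + unfold rat, ratio, Cdiv. apply cv_mult; [|apply cv_const].
      rewrite spoch_inf_0 by auto. now apply spoch_inf_to_1.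
  - intros N. apply hermite_integral_ex. now apply small_shift.
  - apply hermite_integral_ex, small_0.
Qed.

(** Both sides are continuous along beta q^(N+2) as N grows, and the formula is already known at
    each of these parameters. *)
Lemma hermite_at_0 (n : nat) : hermite n 0.
Proof.
  unfold hermite.
  assert (Hb : (Rabs (beta * q ^ 2) <= beta * q ^ 2)%R).
  { assert (P := pow_q_pos 2). rewrite Rabs_pos_eq; nra. }
  replace (RtoC (2 * PI) * remainder q beta xi n 0 X)
    with (Cint (fun t => rat 0 (axis t) * newton_kernel n t)).
  - apply hermite_integral_ex, small_0.
  - apply (cv_unique _ _ _ (hermite_integral_shift_cv n _ Hb)).
    apply cv_ext with (fun N => RtoC (2 * PI) * remainder q beta xi n (beta * q ^ 2 * q ^ N) X).
    + intros N. assert (HN := hermite_integral_ex n (beta * q ^ 2 * q ^ N) (small_shift _ N Hb)).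
      apply (CI_unique _ _ _) with (2 := HN).
      replace (beta * q ^ 2 * q ^ N)%R with (beta * q ^ S (S N))%R by (simpl; ring).
      apply hermite_beta_pow.
    + apply cv_scal. now apply remainder_shift_cv.
Qed.

(** Identifies the multipliers collected along a, a q, a q^2, ... as the factors of [spoch q a] at
    the n-th node, so their product converges. *)
Lemma sfac_node_spoch (a : R) (n : nat) :
  RtoC (sfac_node q xi a n) = sfac a (RtoC (node q xi n) + / RtoC (node q xi n)).
Proof.
  assert (N := node_neg q xi hq hxi n).
  rewrite sfac_joukowski by (apply RtoC_neq_0; lra).
  unfold sfac_node. rewrite RtoC_mult, !RtoC_minus, RtoC_mult, RtoC_div by lra. reflexivity.
Qed.

(* The error of the formula is multiplied by a convergent product along [a, a q, a q^2, ...],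
   and tends to its value 0 at [a = 0]. *)
Lemma hermite_small (n : nat) (a : R) : (Rabs a <= beta * q ^ 2)%R -> hermite n a.
Proof.
  revert a. induction n as [|n IH]; [exact hermite_0_small|].
  intros a Ha.
  set (e := fun a => Cint (fun t => rat a (axis t) * newton_kernel (S n) t)).
  set (L := fun a => RtoC (2 * PI) * remainder q beta xi (S n) a X - e a).
  assert (step : forall N, L (a * q ^ N)%R = RtoC (sfac_node q xi (a * q ^ N) n) * L (a * q ^ S N)%R).
  { intros N.
    assert (E : e (a * q ^ N)%R =
      RtoC (a * q ^ N / node q xi n) * sfac (node q xi n) X
        * (RtoC (2 * PI) * remainder q beta xi n (a * q ^ S N) X)
      + RtoC (sfac_node q xi (a * q ^ N) n) * e (a * q ^ S N)%R).
    { eapply CI_unique; [apply hermite_integral_ex; now apply small_shift|].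
      apply CI_ext with (1 := fun t => eq_sym (newton_integrand_rec n (a * q ^ N) t)).
      replace (a * q ^ N * q)%R with (a * q ^ S N)%R by (simpl; ring).
      apply CI_plus; apply CI_scal; [apply IH|apply hermite_integral_ex]; now apply small_shift. }
    unfold L. rewrite E, (remainder_rec q beta xi hq hbeta hxi n (a * q ^ N)).
    replace (a * q ^ N * q)%R with (a * q ^ S N)%R by (simpl; ring). ring. }
  set (Y := RtoC (node q xi n) + / RtoC (node q xi n)).
  assert (prod : forall N, L a = spoch q a Y N * L (a * q ^ N)%R).
  { intros N. induction N as [|N IHN].
    - rewrite pow_O, Rmult_1_r. unfold spoch. simpl. ring.
    - rewrite IHN, step, spoch_S, sfac_node_spoch. fold Y. ring. }
  assert (L0 : L a = 0).
  { apply (cv_unique (fun _ => L a)); [apply cv_const|].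
    apply cv_ext with (fun N => spoch q a Y N * L (a * q ^ N)%R); [intros N; now rewrite <- prod|].
    replace (RtoC 0) with (spoch_inf q a Y *
      (RtoC (2 * PI) * remainder q beta xi (S n) 0 X - Cint (fun t => rat 0 (axis t) * newton_kernel (S n) t))).
    - apply cv_mult; [now apply spoch_cv|].
      apply cv_minus; [apply cv_scal; now apply remainder_shift_cv|].
      now apply hermite_integral_shift_cv.
    - rewrite (CI_unique _ _ _ (hermite_integral_ex (S n) 0 small_0) (hermite_at_0 (S n))). ring. }
  unfold hermite. replace (RtoC (2 * PI) * remainder q beta xi (S n) a X) with (L a + e a)
    by (unfold L; ring).
  rewrite L0. replace (0 + e a) with (e a) by ring. now apply hermite_integral_ex.
Qed.

(** [m] counts the shifts that make [a] small. Each step up spends one shift and may lower the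
    number of nodes by one, so [m <= n] keeps the induction away from n = 0 with a large [a], where
    the integral may diverge. *)
Lemma hermite_general (m n : nat) (a : R) :
  (Rabs a * q ^ m <= beta * q ^ 2)%R -> (m <= n)%nat -> hermite n a.
Proof.
  revert n a. induction m as [|m IH]; intros n a Ha Hn.
  - apply hermite_small. rewrite pow_O, Rmult_1_r in Ha. exact Ha.
  - destruct n as [|n]; [lia|].
    assert (Haq : (Rabs (a * q) * q ^ m <= beta * q ^ 2)%R).
    { rewrite Rabs_mult, (Rabs_pos_eq q) by lra. simpl in Ha |- *. lra. }
    apply hermite_up; apply IH; auto; lia.
Qed.

(** * Passage to infinitely many nodes *)

Definition limit_integrand (a t : R) : C :=
  rat a (axis t) * (spoch_inf q xi X / spoch_inf q xi (axis t)) * / (axis t - X).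

Lemma Ccont_limit_integrand (a : R) : Ccont (limit_integrand a).
Proof.
  unfold limit_integrand. apply Ccont_mult; [|now apply Ccont_kernel].
  apply Ccont_mult; [apply Ccont_ratio|].
  apply Ccont_div; [intros t; now apply spoch_inf_axis_neq_0|apply Ccont_const|now apply Ccont_spoch_inf].
Qed.

Lemma exists_shift (a : R) : exists m, (Rabs a * q ^ m <= beta * q ^ 2)%R.
Proof.
  assert (H := is_lim_seq_scal_geom (Rabs a) q hq).
  apply is_lim_seq_spec in H.
  assert (P : (0 < beta * q ^ 2)%R) by (apply Rmult_lt_0_compat; auto).
  destruct (H (mkposreal _ P)) as [m Hm]. exists m. specialize (Hm m (le_n m)).
  simpl in Hm. rewrite Rminus_0_r in Hm. apply Rabs_lt_between in Hm. simpl. lra.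
Qed.

(** The growth weight^(m-2) of [ratio a] is absorbed by [m] factors of the product in the
    denominator, and the kernel gives one more power. The cubic decay is what the change of
    variables needs at t = 0. *)
Lemma limit_integrand_le (a : R) : exists K, (0 < K)%R /\
  forall t, (Cmod (limit_integrand a t) <= K / (weight t * weight t * weight t))%R.
Proof.
  destruct (exists_shift a) as [m Hm].
  destruct (ratio_axis_le a m Hm) as [K1 [HK1 H1]].
  destruct (spoch_axis_ge q hq xi m ltac:(lra)) as [K2 [HK2 H2]].
  destruct (Cmod_inv_kernel_le X ReX_neq_0) as [K3 [HK3 H3]].
  set (M := (Cmod (spoch_inf q xi X) + 1)%R).
  assert (HM : (0 < M)%R) by (unfold M; assert (P := Cmod_ge_0 (spoch_inf q xi X)); lra).
  exists (K1 * (M / K2) * K3)%R. split.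
  { repeat apply Rmult_lt_0_compat; auto. now apply Rinv_0_lt_compat. }
  intros t. assert (P := weight_pos t). assert (Pm : (0 < weight t ^ m)%R) by now apply pow_lt.
  unfold limit_integrand. rewrite !Cmod_mult, Cmod_div by now apply spoch_inf_axis_neq_0.
  replace (K1 * (M / K2) * K3 / (weight t * weight t * weight t))%R
    with ((K1 * weight t ^ m / (weight t * weight t)) * (M * / (K2 * weight t ^ m)) * (K3 / weight t))%R
    by (field; lra).
  assert (Q := Rmult_lt_0_compat _ _ HK2 Pm).
  specialize (H2 t). assert (G := spoch_inf_axis_ge q hq xi t m).
  assert (I : (0 < / Cmod (spoch_inf q xi (axis t)))%R) by (apply Rinv_0_lt_compat; lra).
  apply Rmult_le_compat; auto using Cmod_ge_0.
  - apply Rmult_le_pos; [apply Cmod_ge_0|]. apply Rmult_le_pos; [apply Cmod_ge_0|lra].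
  - apply Rmult_le_compat; auto using Cmod_ge_0.
    + apply Rmult_le_pos; [apply Cmod_ge_0|lra].
    + apply Rmult_le_compat; auto using Cmod_ge_0; [lra|unfold M; lra|].
      apply Rinv_le_contravar; lra.
Qed.

Lemma spoch_bounded : exists M, (0 < M)%R /\ forall n, (Cmod (spoch q xi X n) <= M)%R.
Proof.
  exists (exp ((xi * xi + Rabs xi * Cmod X) / (1 - q))). split; [apply exp_pos|].
  intros n. apply (cprod_le q hq).
  - assert (0 <= Rabs xi) by apply Rabs_pos. assert (0 <= Cmod X) by apply Cmod_ge_0. nra.
  - intros j. now apply sfac_minus_1_le.
Qed.

Lemma newton_kernel_step_le (m : nat) : exists K, (0 < K)%R /\ forall t n, (m <= S n)%nat ->
  (Cmod (spoch q xi X (S n) / spoch q xi (axis t) (S n) - spoch q xi X n / spoch q xi (axis t) n)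
   <= K * q ^ n * weight t / weight t ^ m)%R.
Proof.
  destruct spoch_bounded as [M [HM HB]].
  destruct (spoch_axis_ge q hq xi m ltac:(lra)) as [K2 [HK2 H2]].
  set (D := ((xi * xi + Rabs xi * Cmod X) + (xi * xi + Rabs xi))%R).
  assert (0 < Rabs xi) by (apply Rabs_pos_lt; lra).
  assert (0 <= Cmod X) by apply Cmod_ge_0.
  assert (HD : (0 < D)%R) by (unfold D; nra).
  exists (M * D / K2)%R. split; [apply Rdiv_lt_0_compat; nra|].
  intros t n Hn. assert (P := weight_pos t). assert (W := weight_ge_1 t).
  assert (Pm : (0 < weight t ^ m)%R) by now apply pow_lt.
  assert (N1 := spoch_axis_neq_0 q hq xi t n). assert (N2 := spoch_axis_neq_0 q hq xi t (S n)).
  replace (spoch q xi X (S n) / spoch q xi (axis t) (S n) - spoch q xi X n / spoch q xi (axis t) n)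
    with (spoch q xi X n * ((sfac (xi * q ^ n) X - 1) + - (sfac (xi * q ^ n) (axis t) - 1))
      / spoch q xi (axis t) (S n)).
  2:{ rewrite !spoch_S in *.
      assert (sfac (xi * q ^ n) (axis t) <> 0) by (intros E; apply N2; rewrite E; ring).
      field. auto. }
  rewrite Cmod_div, Cmod_mult by auto.
  assert (G := spoch_axis_incr q xi t m (S n - m)).
  replace (m + (S n - m))%nat with (S n) in G by lia.
  specialize (H2 t). assert (Q := Rmult_lt_0_compat _ _ HK2 Pm).
  replace (M * D / K2 * q ^ n * weight t / weight t ^ m)%R
    with (M * (D * q ^ n * weight t) * / (K2 * weight t ^ m))%R by (field; lra).
  apply Rmult_le_compat.
  - apply Rmult_le_pos; apply Cmod_ge_0.
  - left. apply Rinv_0_lt_compat. lra.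
  - apply Rmult_le_compat; auto using Cmod_ge_0.
    eapply Rle_trans; [apply Cmod_triangle|]. rewrite Cmod_opp.
    assert (B1 := sfac_minus_1_le xi q X n hq). assert (B2 := sfac_axis_pow_minus_1_le xi t n).
    assert (B3 : ((xi * xi + Rabs xi * Cmod X) * q ^ n <= (xi * xi + Rabs xi * Cmod X) * q ^ n * weight t)%R).
    { assert (0 <= (xi * xi + Rabs xi * Cmod X) * q ^ n)%R by (apply Rmult_le_pos; [nra|left; apply pow_q_pos]). nra. }
    unfold D. lra.
  - apply Rinv_le_contravar; lra.
Qed.

Theorem newton_series (a : R) : exists L,
  CI (limit_integrand a) L /\
  cv (csum (fun k => cof q beta xi a k * spoch q xi X k)) (rat a X - L / RtoC (2 * PI)).
Proof.
  destruct (exists_shift a) as [m Hm].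
  destruct (limit_integrand_le a) as [K0 [HK0 H0]].
  destruct (CI_ex (limit_integrand a) K0 (Ccont_limit_integrand a)) as [L HL].
  { intros t. eapply Rle_trans; [apply H0|].
    assert (P := weight_pos t). assert (W := weight_ge_1 t).
    apply Rmult_le_compat_l; [lra|]. apply Rinv_le_contravar; nra. }
  exists L. split; auto.
  (* The formula is available from [m] nodes on, hence the shift. The powers of the weight are m - 2
     from the quotient, 1 - m from the difference of the kernels and -1 from the Cauchy kernel: -2
     in total. *)
  assert (E : cv (fun k => RtoC (2 * PI) * remainder q beta xi (k + m) a X) L).
  { destruct (ratio_axis_le a m Hm) as [K1 [HK1 H1]].
    destruct (newton_kernel_step_le m) as [K2 [HK2 H2]].
    destruct (Cmod_inv_kernel_le X ReX_neq_0) as [K3 [HK3 H3]].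
    apply (CI_cv (fun k t => rat a (axis t) * newton_kernel (k + m) t) (limit_integrand a) _ L
      (K1 * (K2 * q ^ m / (1 - q)) * K3) q hq); auto.
    - intros k. apply hermite_general with m; auto. lia.
    - intros k t. assert (P := weight_pos t). assert (Pm : (0 < weight t ^ m)%R) by now apply pow_lt.
      replace (rat a (axis t) * newton_kernel (k + m) t - limit_integrand a t)
        with (rat a (axis t) * (spoch q xi X (k + m) / spoch q xi (axis t) (k + m)
           - spoch_inf q xi X / spoch_inf q xi (axis t)) * / (axis t - X))
        by (unfold newton_kernel, limit_integrand; ring).
      rewrite !Cmod_mult.
      replace (K1 * (K2 * q ^ m / (1 - q)) * K3 * q ^ k / (weight t * weight t))%R
        with ((K1 * weight t ^ m / (weight t * weight t))
           * ((K2 * q ^ m * weight t / weight t ^ m) / (1 - q) * q ^ k) * (K3 / weight t))%R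
        by (field; lra).
      apply Rmult_le_compat; auto using Cmod_ge_0; [apply Rmult_le_pos; apply Cmod_ge_0|].
      apply Rmult_le_compat; auto using Cmod_ge_0.
      apply (geometric_rate (fun k => spoch q xi X (k + m) / spoch q xi (axis t) (k + m))); auto.
      + intros j. change (S j + m)%nat with (S (j + m)).
        eapply Rle_trans; [apply (H2 t (j + m)%nat); lia|]. rewrite pow_add.
        right. field. lra.
      + unfold Cdiv. apply cv_mult.
        * apply (cv_incr_n (spoch q xi X)). now apply spoch_cv.
        * apply cv_inv.
          -- intros n. apply spoch_ge_1; auto. apply axis_Re_mul.
          -- apply (cv_incr_n (spoch q xi (axis t))). now apply spoch_cv. }
  assert (PI0 : RtoC (2 * PI) <> 0) by (apply RtoC_neq_0; assert (PP := PI_RGT_0); lra).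
  apply (cv_incr_n _ _ m).
  apply cv_ext with (fun k => rat a X - / RtoC (2 * PI) * (RtoC (2 * PI) * remainder q beta xi (k + m) a X)).
  - intros k. unfold remainder. fold rat. rewrite Cmult_assoc, Cinv_l by auto. ring.
  - apply cv_minus; [apply cv_const|].
    replace (L / RtoC (2 * PI)) with (/ RtoC (2 * PI) * L) by (unfold Cdiv; ring).
    now apply cv_scal.
Qed.

End Newton.

(** * Change of variables *)

Lemma filterlim_const_minus (F : (R -> Prop) -> Prop) (f : R -> R) (a l : R) :
  filterlim f F (locally l) -> filterlim (fun t => a - f t)%R F (locally (a - l)%R).
Proof.
  intros H. apply (filterlim_comp _ _ _ f (fun x => a - x)%R _ (locally l)); auto.
  apply (continuous_Rminus (fun _ => a) (fun x => x)); [apply continuous_const|apply continuous_id].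
Qed.

Section Change_of_variables.
Context (k g : R -> R) (M : R).
Context (Hk : forall s, continuous k s)
  (HC : forall s, (Rabs (k s) <= M / (weight s * weight s * weight s))%R)
  (Hg : forall t, t <> 0%R -> g t = ((1 + / (t * t)) * k (t - / t))%R).

(** With z = t^2 and y = 1/z the claim is 3 z + 2 y >= 4, which holds because z y = 1. *)
Lemma weight_joukowski (t : R) : t <> 0%R ->
  (1 + / (t * t) <= 3 * (weight (t - / t) * weight (t - / t)))%R.
Proof.
  intros H. rewrite weight_sqr.
  assert (Z : (0 < t * t)%R) by nra.
  assert (P : (0 < / (t * t))%R) by now apply Rinv_0_lt_compat.
  replace ((t - / t) * (t - / t))%R with (t * t + / (t * t) - 2)%R by (field; auto).
  assert (E : (t * t * / (t * t) = 1)%R) by (field; auto).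
  set (z := (t * t)%R) in *. set (y := (/ z)%R) in *. nra.
Qed.

(** With w the weight at t - 1/t, the Jacobian is at most 3 w^2, so the cubic decay leaves 3 M / w.
    The same inequality gives 1 <= 3 w^2 t^2, hence 1/w <= 2 |t|. Thus the integrand extends
    continuously by 0 to t = 0. *)
Lemma transformed_small (t : R) : t <> 0%R -> (Rabs (g t) <= 6 * M * Rabs t)%R.
Proof.
  intros H. rewrite Hg by auto. rewrite Rabs_mult.
  assert (W := weight_pos (t - / t)). assert (B := weight_joukowski t H). specialize (HC (t - / t)%R).
  assert (M0 : (0 <= M)%R).
  { assert (0 <= Rabs (k (t - / t))) by apply Rabs_pos.
    assert (W3 : (0 < weight (t - / t) * weight (t - / t) * weight (t - / t))%R)
      by (repeat apply Rmult_lt_0_compat; auto).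
    apply Rle_div_r in HC; auto. nra. }
  assert (Z : (0 < t * t)%R) by nra.
  assert (P : (0 < / (t * t))%R) by now apply Rinv_0_lt_compat.
  rewrite (Rabs_pos_eq (1 + _)) by lra.
  set (w := weight (t - / t)) in *.
  assert (T : (0 < Rabs t)%R) by now apply Rabs_pos_lt.
  assert (TT : (Rabs t * Rabs t = t * t)%R) by (rewrite <- Rabs_mult; apply Rabs_pos_eq; lra).
  assert (L : (1 <= 2 * Rabs t * w)%R).
  { assert (1 <= 3 * (w * w) * (t * t))%R.
    { assert (E : ((1 + / (t * t)) * (t * t) = t * t + 1)%R) by (field; auto).
      assert ((1 + / (t * t)) * (t * t) <= 3 * (w * w) * (t * t))%R by (apply Rmult_le_compat_r; lra). lra. }
    assert (0 < Rabs t * w)%R by now apply Rmult_lt_0_compat.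
    rewrite <- TT in H0. nra. }
  apply Rle_trans with ((3 * (w * w)) * (M / (w * w * w)))%R.
  - apply Rmult_le_compat; auto using Rabs_pos; lra.
  - replace (3 * (w * w) * (M / (w * w * w)))%R with (3 * M * / w)%R by (field; lra).
    replace (6 * M * Rabs t)%R with (3 * M * (2 * Rabs t))%R by ring.
    apply Rmult_le_compat_l; [lra|].
    apply Rmult_le_reg_r with w; auto. rewrite Rinv_l by lra. lra.
Qed.

Definition transformed (t : R) : R := if Req_dec_T t 0 then 0%R else g t.

Lemma transformed_eq (t : R) : t <> 0%R -> transformed t = g t.
Proof. intros H. unfold transformed. now destruct (Req_dec_T t 0). Qed.

Lemma transformed_0 : transformed 0 = 0%R.
Proof. unfold transformed. now destruct (Req_dec_T 0 0). Qed.

Lemma locally_neq_0 (t : R) : t <> 0%R -> locally t (fun s => s <> 0%R).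
Proof.
  intros H. assert (P : (0 < Rabs t)%R) by now apply Rabs_pos_lt.
  exists (mkposreal _ P). intros s Hs E. change (Rabs (s - t) < Rabs t) in Hs.
  rewrite E, Rminus_0_l, Rabs_Ropp in Hs. lra.
Qed.

Lemma transformed_continuous (t : R) : continuous transformed t.
Proof.
  destruct (Req_dec_T t 0) as [->|H].
  - apply (filterlim_locally (U := R_UniformSpace)). intros eps.
    assert (M0 : (0 <= M)%R).
    { specialize (HC 0%R). assert (W := weight_pos 0).
      assert (W3 : (0 < weight 0 * weight 0 * weight 0)%R) by (repeat apply Rmult_lt_0_compat; auto).
      assert (0 <= Rabs (k 0)) by apply Rabs_pos.
      apply Rle_div_r in HC; auto. nra. }
    assert (E := cond_pos eps).
    assert (P : (0 < eps / (6 * M + 1))%R) by (apply Rdiv_lt_0_compat; lra).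
    exists (mkposreal _ P). intros s Hs. change (Rabs (s - 0) < eps / (6 * M + 1)) in Hs.
    rewrite Rminus_0_r in Hs.
    change (Rabs (transformed s - transformed 0) < eps). rewrite transformed_0, Rminus_0_r.
    destruct (Req_dec_T s 0) as [->|N].
    + rewrite transformed_0, Rabs_R0. lra.
    + rewrite transformed_eq by auto. eapply Rle_lt_trans; [now apply transformed_small|].
      apply Rlt_div_r in Hs; [|lra]. assert (0 <= Rabs s) by apply Rabs_pos. nra.
  - apply continuous_ext_loc with (fun s => (1 + / (s * s)) * k (s - / s))%R.
    + generalize (locally_neq_0 t H). apply filter_imp. intros s Hs.
      now rewrite transformed_eq, Hg.
    + apply continuous_Rmult.
      * apply continuous_Rplus; [apply continuous_const|].
        apply (continuous_Rinv_comp (fun s => s * s)%R); [|nra].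
        apply continuous_Rmult; apply continuous_id.
      * apply (continuous_comp (fun s => s - / s)%R k); auto.
        apply continuous_Rminus; [apply continuous_id|now apply continuous_Rinv].
Qed.

Let K := RInt k 0.
Let Phi := RInt transformed 0.

Lemma is_derive_Phi (t : R) : is_derive Phi t (transformed t).
Proof. apply is_derive_RInt_0. apply transformed_continuous. Qed.

Lemma is_derive_joukowski_primitive (t : R) : t <> 0%R ->
  is_derive (fun s => K (s - / s)) t (transformed t).
Proof.
  intros H. rewrite transformed_eq, Hg by auto.
  apply (is_derive_comp K (fun s => s - / s)%R).
  - now apply is_derive_RInt_0.
  - auto_derive; auto. field. auto.
Qed.

Lemma Phi_diff (a b : R) : (0 < a * b)%R ->
  (Phi b - Phi a = K (b - / b) - K (a - / a))%R.
Proof.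
  intros Hab.
  assert (N : forall t, Rmin a b <= t <= Rmax a b -> t <> 0%R).
  { intros t Ht E. subst t. unfold Rmin, Rmax in Ht. destruct (Rle_dec a b); nra. }
  assert (I1 := is_RInt_derive (V := R_CompleteNormedModule) Phi transformed a b
    (fun t _ => is_derive_Phi t) (fun t _ => transformed_continuous t)).
  assert (I2 := is_RInt_derive (V := R_CompleteNormedModule) (fun s => K (s - / s)) transformed a b
    (fun t Ht => is_derive_joukowski_primitive t (N t Ht)) (fun t _ => transformed_continuous t)).
  apply (is_RInt_unique (V := R_CompleteNormedModule)) in I1.
  apply (is_RInt_unique (V := R_CompleteNormedModule)) in I2.
  rewrite I1 in I2. exact I2.
Qed.

Lemma Phi_0 : Phi 0 = 0%R.
Proof. apply (RInt_point (V := R_CompleteNormedModule)). Qed.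

Lemma Phi_lim_0 (F : (R -> Prop) -> Prop) : filter_le F (locally 0%R) ->
  filterlim Phi F (locally 0%R).
Proof.
  intros HF. apply filterlim_filter_le_1 with (1 := HF).
  assert (H := is_derive_continuous _ _ _ (is_derive_Phi 0)).
  unfold continuous in H. rewrite Phi_0 in H. exact H.
Qed.

Lemma joukowski_at_right_0 :
  filterlim (fun t => t - / t)%R (at_right 0) (Rbar_locally m_infty).
Proof.
  intros P [B HB].
  assert (D : (0 < / (Rabs B + 1))%R) by (apply Rinv_0_lt_compat; assert (A := Rabs_pos B); lra).
  assert (D1 : (/ (Rabs B + 1) <= 1)%R).
  { rewrite <- Rinv_1. apply Rinv_le_contravar; [lra|]. assert (A := Rabs_pos B); lra. }
  exists (mkposreal _ D). intros t Ht H0. apply HB.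
  change (Rabs (t - 0) < / (Rabs B + 1)) in Ht. rewrite Rminus_0_r, Rabs_pos_eq in Ht by lra.
  assert (I : (Rabs B + 1 < / t)%R).
  { rewrite <- (Rinv_inv (Rabs B + 1)). apply Rinv_lt_contravar; auto. now apply Rmult_lt_0_compat. }
  assert (A := Rle_abs (- B)). rewrite Rabs_Ropp in A. lra.
Qed.

Lemma joukowski_at_left_0 :
  filterlim (fun t => t - / t)%R (at_left 0) (Rbar_locally p_infty).
Proof.
  intros P [B HB].
  assert (D : (0 < / (Rabs B + 1))%R) by (apply Rinv_0_lt_compat; assert (A := Rabs_pos B); lra).
  assert (D1 : (/ (Rabs B + 1) <= 1)%R).
  { rewrite <- Rinv_1. apply Rinv_le_contravar; [lra|]. assert (A := Rabs_pos B); lra. }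
  exists (mkposreal _ D). intros t Ht H0. apply HB.
  change (Rabs (t - 0) < / (Rabs B + 1)) in Ht. rewrite Rminus_0_r, Rabs_left in Ht by lra.
  assert (I : (Rabs B + 1 < / (- t))%R).
  { rewrite <- (Rinv_inv (Rabs B + 1)). apply Rinv_lt_contravar; auto. apply Rmult_lt_0_compat; lra. }
  rewrite Rinv_opp in I. assert (A := Rle_abs B). lra.
Qed.

Lemma joukowski_p_infty :
  filterlim (fun t => t - / t)%R (Rbar_locally p_infty) (Rbar_locally p_infty).
Proof.
  intros P [B HB]. exists (Rabs B + 1)%R. intros t Ht. apply HB.
  assert (A := Rabs_pos B). assert (A' := Rle_abs B).
  assert (I : (/ t <= 1)%R) by (rewrite <- Rinv_1; apply Rinv_le_contravar; lra). lra.
Qed.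

Lemma joukowski_m_infty :
  filterlim (fun t => t - / t)%R (Rbar_locally m_infty) (Rbar_locally m_infty).
Proof.
  intros P [B HB]. exists (- (Rabs B + 1))%R. intros t Ht. apply HB.
  assert (A := Rabs_pos B). assert (A' := Rle_abs (- B)). rewrite Rabs_Ropp in A'.
  assert (I : (/ (- t) <= 1)%R) by (rewrite <- Rinv_1; apply Rinv_le_contravar; lra).
  rewrite Rinv_opp in I. lra.
Qed.

(** In [Phi_diff] the end point [a] tends to 0 from the side of [b]; there [Phi a] tends to 0, while
    a - 1/a runs off to infinity. *)
Lemma Phi_from_limit (F : (R -> Prop) -> Prop) (FF : ProperFilter F) (b l : R) :
  filter_le F (locally 0%R) -> F (fun a => (0 < a * b)%R) ->
  filterlim (fun a => K (a - / a)) F (locally l) -> Phi b = (K (b - / b) - l)%R.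
Proof.
  intros HF Hs HK.
  assert (E : (Phi b - 0 = K (b - / b) - l)%R).
  { apply (filterlim_locally_unique (F := F) (V := R_NormedModule) (fun a => Phi b - Phi a)%R).
    - now apply filterlim_const_minus, Phi_lim_0.
    - apply (filterlim_ext_loc (fun a => K (b - / b) - K (a - / a))%R).
      + revert Hs. apply filter_imp. intros a Ha. symmetry. now apply Phi_diff.
      + apply (filterlim_const_minus F (fun a => K (a - / a)) (K (b - / b)) l HK). }
  lra.
Qed.

Lemma RI_transformed (l : R) : RI k l -> RI transformed (2 * l)%R.
Proof.
  intros Hl.
  assert (HB : forall t, (Rabs (k t) <= M / (1 + t * t))%R).
  { intros t. eapply Rle_trans; [apply HC|]. rewrite <- weight_sqr.
    assert (W := weight_ge_1 t).
    assert (0 <= M)%R.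
    { specialize (HC t). assert (0 <= Rabs (k t)) by apply Rabs_pos.
      assert (W3 : (0 < weight t * weight t * weight t)%R) by (repeat apply Rmult_lt_0_compat; lra).
      apply Rle_div_r in HC; auto. nra. }
    apply Rmult_le_compat_l; auto. apply Rinv_le_contravar; nra. }
  destruct (RInt_0_lim_p k M Hk HB) as [lp Hp].
  destruct (RInt_0_lim_m k M Hk HB) as [lm Hm].
  assert (E : l = (lp - lm)%R).
  { apply (RI_unique k); auto. apply RI_primitive with (RInt k 0); auto.
    intros t. now apply is_derive_RInt_0. }
  (* The limits of [Phi] at plus and minus infinity: t - 1/t runs through the whole line over t > 0
     and once more over t < 0, while [Phi] starts from 0 at t = 0. *)
  replace (2 * l)%R with ((lp - lm) - (lm - lp))%R by (rewrite E; ring).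
  apply RI_primitive with Phi.
  - apply is_derive_Phi.
  - apply transformed_continuous.
  - apply (filterlim_ext_loc (fun b => K (b - / b) - lp)%R).
    + exists 0%R. intros b Hb. symmetry.
      apply (Phi_from_limit (at_left 0) _ b lp).
      * intros Q. unfold at_left, at_right, within. apply filter_imp. auto.
      * exists (mkposreal _ Rlt_0_1). intros a _ Ha. nra.
      * apply filterlim_comp with (Rbar_locally p_infty); [apply joukowski_at_left_0|exact Hp].
    + apply (filterlim_comp _ _ _ (fun b => K (b - / b)) (fun x => x - lp)%R _ (locally lm)).
      * apply filterlim_comp with (Rbar_locally m_infty); [apply joukowski_m_infty|exact Hm].
      * apply (continuous_Rminus (fun x => x) (fun _ => lp)); [apply continuous_id|apply continuous_const].
  - apply (filterlim_ext_loc (fun b => K (b - / b) - lm)%R).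
    + exists 0%R. intros b Hb. symmetry.
      apply (Phi_from_limit (at_right 0) _ b lm).
      * intros Q. unfold at_left, at_right, within. apply filter_imp. auto.
      * exists (mkposreal _ Rlt_0_1). intros a _ Ha. nra.
      * apply filterlim_comp with (Rbar_locally m_infty); [apply joukowski_at_right_0|exact Hm].
    + apply (filterlim_comp _ _ _ (fun b => K (b - / b)) (fun x => x - lm)%R _ (locally lp)).
      * apply filterlim_comp with (Rbar_locally p_infty); [apply joukowski_p_infty|exact Hp].
      * apply (continuous_Rminus (fun x => x) (fun _ => lm)); [apply continuous_id|apply continuous_const].
Qed.

(* [t - 1/t] maps each of the two half lines onto the whole line. *)
Lemma RI_joukowski (l : R) : RI k l -> RI g (2 * l)%R.
Proof.
  intros Hl P HP. apply RI_transformed in Hl. specialize (Hl P HP).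
  unfold filtermapi in *. revert Hl. apply filter_imp. intros [a b] [y [Hy Py]]. exists y. split; auto. simpl in *.
  (* [g] may differ from the continuous version at 0 only. Cutting there makes 0 an end point, and
     the integral depends only on values in the open interval. *)
  assert (main : forall c d, (c = 0 \/ d = 0)%R -> is_RInt (V := R_NormedModule) g c d (RInt transformed c d)).
  { intros c d Hcd. apply (is_RInt_ext (V := R_NormedModule) transformed).
    - intros t Ht. apply transformed_eq. intros E. subst t.
      unfold Rmin, Rmax in Ht. destruct (Rle_dec c d), Hcd; lra.
    - apply (RInt_correct (V := R_CompleteNormedModule)).
      apply ex_RInt_of_continuous, transformed_continuous. }
  assert (J := is_RInt_Chasles (V := R_NormedModule) g a 0 b _ _
    (main a 0%R (or_intror eq_refl)) (main 0%R b (or_introl eq_refl))).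
  assert (E : plus (RInt transformed a 0) (RInt transformed 0 b) = y).
  { transitivity (RInt transformed a b).
    - apply (RInt_Chasles (V := R_CompleteNormedModule));
        apply ex_RInt_of_continuous, transformed_continuous.
    - now apply (is_RInt_unique (V := R_CompleteNormedModule)). }
  rewrite <- E. exact J.
Qed.

End Change_of_variables.

Lemma is_int_imag_CI (F : C -> C) (l : C) :
  CI (fun t => Ci * F (Ci * RtoC t)) l -> is_int_imag F l.
Proof.
  intros [H1 H2]. unfold is_int_imag, is_RInt_gen.
  apply (filterlimi_locally (U := C_R_NormedModule)). intros eps.
  unfold RI, is_RInt_gen in H1, H2.
  rewrite (filterlimi_locally (U := R_NormedModule)) in H1.
  rewrite (filterlimi_locally (U := R_NormedModule)) in H2.
  generalize (filter_and _ _ (H1 eps) (H2 eps)). apply filter_imp.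
  intros ab [[x [Ix Bx]] [y [Iy By]]]. exists (x, y). split.
  - now apply (is_RInt_fct_extend_pair (U := R_NormedModule) (V := R_NormedModule)).
  - now split.
Qed.

(** * The expansion *)

Lemma fst_RtoC_mult (r : R) (z : C) : fst (RtoC r * z) = (r * fst z)%R.
Proof. simpl. ring. Qed.

Lemma snd_RtoC_mult (r : R) (z : C) : snd (RtoC r * z) = (r * snd z)%R.
Proof. simpl. ring. Qed.

Section Final.
Context (q alpha beta xi : R) (u : C)
  (hq : (0 < q < 1)%R) (hbeta : (0 < beta)%R) (hxi : (xi < 0)%R) (hu : (Re u < 0)%R).

Let X : C := u + / u.

Lemma Re_neg_neq_0 : u <> 0.
Proof. intros E. rewrite E in hu. unfold Re in hu. simpl in hu. lra. Qed.

Lemma Re_joukowski_neg : (Re X < 0)%R.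
Proof.
  assert (N := Cmod_sqr_pos u Re_neg_neq_0).
  unfold X, Re in *. simpl.
  replace (fst u * (fst u * 1) + snd u * (snd u * 1))%R
    with (fst u * fst u + snd u * snd u)%R by ring.
  assert (P : (0 < / (fst u * fst u + snd u * snd u))%R) by now apply Rinv_0_lt_compat.
  unfold Rdiv. nra.
Qed.

Lemma ratio_joukowski (v : C) : v <> 0 ->
  ratio q beta alpha (v + / v)
  = qpochs_inf q [alpha * v; alpha / v] / qpochs_inf q [beta * v; beta / v].
Proof.
  intros H. unfold ratio. rewrite !spoch_inf_joukowski by auto.
  unfold qpochs_inf. simpl. now rewrite !Cmult_1_r.
Qed.

(** Since (u - v)(u v - 1) = - u v (Y - X), the rational factor is (1 - 1/v^2) / (Y - X). For v = i
    t its numerator is 1 + 1/t^2, the derivative of t - 1/t. *)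
Lemma integrand_joukowski (t : R) : t <> 0%R ->
  integrand q alpha beta xi u (Ci * RtoC t)
  = RtoC (1 + / (t * t)) * limit_integrand q beta xi X alpha (t - / t).
Proof.
  intros Ht. set (v := Ci * RtoC t).
  assert (Ht' := RtoC_neq_0 t Ht).
  assert (Hu := Re_neg_neq_0).
  assert (HCi : Ci * Ci = - (1)) by (apply injective_projections; simpl; ring).
  assert (Hi : Ci <> 0) by (intros E; apply (f_equal snd) in E; simpl in E; lra).
  assert (Hv : v <> 0) by (now apply Cmult_neq_0).
  assert (Ev : axis (t - / t) = v + / v).
  { transitivity (Ci * RtoC t - Ci * RtoC (/ t)).
    - apply injective_projections; simpl; ring.
    - unfold v. rewrite RtoC_inv by auto.
      transitivity (Ci * RtoC t + - (Ci * Ci) * / (Ci * RtoC t)); [|rewrite HCi]; field; auto. }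
  assert (Et : RtoC (1 + / (t * t)) = 1 - / (v * v)).
  { rewrite RtoC_plus, RtoC_inv, RtoC_mult by nra. unfold v.
    replace (Ci * t * (Ci * t)) with ((Ci * Ci) * (t * t)) by ring.
    rewrite HCi. field. auto. }
  assert (N := axis_minus_neq_0 X (t - / t) ltac:(assert (R := Re_joukowski_neg); lra)).
  rewrite Ev in N.
  assert (E : (u - v) * (u * v - 1) = - (u * v * (v + / v - X))) by (unfold X; field; auto).
  assert (NE : (u - v) * (u * v - 1) <> 0).
  { rewrite E. intros E0. apply N.
    transitivity ((- / (u * v)) * - (u * v * (v + / v - X))); [field; auto|].
    rewrite E0. ring. }
  unfold integrand, limit_integrand. rewrite Ev, Et, E.
  assert (EX : spoch_inf q xi X = qpoch_inf q (xi * u) * qpoch_inf q (xi / u))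
    by now apply spoch_inf_joukowski.
  rewrite ratio_joukowski, EX, spoch_inf_joukowski by auto.
  unfold qpochs_inf. simpl.
  assert (B := spoch_inf_axis_neq_0 q hq beta (t - / t)).
  assert (D := spoch_inf_axis_neq_0 q hq xi (t - / t)).
  rewrite Ev, spoch_inf_joukowski in B, D by auto.
  assert (B1 : qpoch_inf q (beta * v) <> 0) by (intros E0; apply B; rewrite E0; ring).
  assert (B2 : qpoch_inf q (beta / v) <> 0) by (intros E0; apply B; rewrite E0; ring).
  assert (D1 : qpoch_inf q (xi * v) <> 0) by (intros E0; apply D; rewrite E0; ring).
  assert (D2 : qpoch_inf q (xi / v) <> 0) by (intros E0; apply D; rewrite E0; ring).
  generalize dependent (qpoch_inf q (beta * v)). generalize dependent (qpoch_inf q (beta / v)).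
  generalize dependent (qpoch_inf q (xi * v)). generalize dependent (qpoch_inf q (xi / v)).
  intros. clear EX E NE Et Ev. generalize dependent (v + / v - X). intros Z HZ. field.
  repeat split; auto.
Qed.

(** The factor [Ci] comes from dv = i dt and the factor 2 from the double covering of the axis by t
    - 1/t. *)
Lemma is_int_imag_integrand (L : C) :
  CI (limit_integrand q beta xi X alpha) L ->
  is_int_imag (integrand q alpha beta xi u) (Ci * (RtoC 2 * L)).
Proof.
  intros [H1 H2]. apply is_int_imag_CI, CI_scal.
  destruct (limit_integrand_le q beta xi hq hbeta hxi X Re_joukowski_neg alpha) as [K [_ HK]].
  assert (Hc := Ccont_limit_integrand q beta xi hq X Re_joukowski_neg alpha).
  split.
  - rewrite fst_RtoC_mult.
    apply (RI_joukowski (fun s => fst (limit_integrand q beta xi X alpha s)) _ K); auto.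
    + intros s. exact (proj1 (Hc s)).
    + intros s. eapply Rle_trans; [apply Rabs_fst_le|apply HK].
    + intros t Ht. rewrite integrand_joukowski by auto. apply fst_RtoC_mult.
  - rewrite snd_RtoC_mult.
    apply (RI_joukowski (fun s => snd (limit_integrand q beta xi X alpha s)) _ K); auto.
    + intros s. exact (proj2 (Hc s)).
    + intros s. eapply Rle_trans; [apply Rabs_snd_le|apply HK].
    + intros t Ht. rewrite integrand_joukowski by auto. apply snd_RtoC_mult.
Qed.

(** * The regularised hypergeometric series *)

Definition reg_term (k : nat) : C :=
  qpochs q [RtoC alpha / RtoC beta; xi * u; xi / u] k
  / qpochs q [RtoC q; q * xi / beta] k
  * qpoch_inf q (alpha * xi * RtoC (q ^ k)) * Cpow q k.

Lemma qxi_div_beta_C : RtoC q * xi / beta = RtoC (q * xi / beta).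
Proof. rewrite RtoC_div, RtoC_mult by lra. reflexivity. Qed.

Lemma beta_factors_neq_0 :
  qpoch_inf q (beta * xi) <> 0 /\ qpoch_inf q (beta / xi) <> 0.
Proof.
  rewrite <- RtoC_mult, <- RtoC_div by lra. split; apply qpoch_inf_nonpos_neq_0; auto; left.
  - now apply beta_mul_xi_neg.
  - now apply beta_div_xi_neg.
Qed.

Lemma cof_reg_term (k : nat) :
  cof q beta xi alpha k * spoch q xi X k
  = qpoch_inf q (alpha / xi) / (qpoch_inf q (beta * xi) * qpoch_inf q (beta / xi)) * reg_term k.
Proof.
  unfold cof, reg_term, X. rewrite spoch_joukowski by apply Re_neg_neq_0.
  unfold qpochs. simpl. rewrite qxi_div_beta_C.
  rewrite <- RtoC_pow.
  replace (RtoC alpha * RtoC xi * RtoC (q ^ k)) with (RtoC (alpha * xi * q ^ k))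
    by (rewrite !RtoC_mult; ring).
  rewrite !(RtoC_div _ xi), (RtoC_mult beta xi), (RtoC_div alpha beta) by lra.
  destruct beta_factors_neq_0 as [B1 B2].
  assert (Q1 := qpoch_q_neq_0 q hq k).
  assert (Q2 : qpoch q (RtoC (q * xi / beta)) k <> 0).
  { apply qpoch_nonpos_neq_0; auto. left. now apply qxi_div_beta_neg. }
  field. auto.
Qed.

(** All factors lie in (0, 1), so the partial products decrease to (q; q)_oo, which is nonzero. *)
Lemma qpoch_q_ge : exists m, (0 < m)%R /\ forall n, (m <= Cmod (qpoch q q n))%R.
Proof.
  exists (Cmod (qpoch_inf q q)). split.
  - apply Cmod_gt_0, qpoch_inf_neq_0; auto. intros j.
    rewrite <- RtoC_mult, <- RtoC_minus. apply RtoC_neq_0.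
    assert (0 < q ^ j) by (apply pow_lt; lra).
    assert (q ^ j <= 1) by (rewrite <- (pow1 j); apply pow_incr; lra). nra.
  - intros n. apply (cv_le_const (fun k => qpoch q q (k + n)%nat)).
    + intros k. induction k as [|k IH]; [apply Rle_refl|].
      simpl. rewrite Cmod_mult, <- RtoC_mult, <- RtoC_minus, Cmod_R.
      assert (0 < q ^ (k + n)) by (apply pow_lt; lra).
      assert (q ^ (k + n) <= 1) by (rewrite <- (pow1 (k + n)); apply pow_incr; lra).
      rewrite Rabs_pos_eq by nra.
      assert (0 <= Cmod (qpoch q q (k + n))) by apply Cmod_ge_0.
      assert (0 <= Cmod (qpoch q q (k + n)) * (q ^ (k + n) * q))%R
        by (repeat apply Rmult_le_pos; lra).
      lra.
    + apply (cv_incr_n (qpoch q q)). now apply qpoch_cv.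
Qed.

Lemma qpoch_nonpos_ge_1 (x : R) (n : nat) : (x <= 0)%R -> (1 <= Cmod (qpoch q x n))%R.
Proof.
  intros Hx. induction n as [|n IH]; simpl; [rewrite Cmod_1; lra|].
  rewrite Cmod_mult, <- RtoC_mult, <- RtoC_minus, Cmod_R.
  assert (0 < q ^ n) by (apply pow_lt; lra).
  assert (q ^ n * x <= 0)%R by nra.
  rewrite Rabs_pos_eq by lra.
  assert (1 * 1 <= Cmod (qpoch q x n) * (1 - q ^ n * x))%R by (apply Rmult_le_compat; lra).
  lra.
Qed.

Lemma qpoch_inf_le (x : C) (B : R) : (Cmod x <= B)%R ->
  (Cmod (qpoch_inf q x) <= exp (B / (1 - q)))%R.
Proof.
  intros H. apply (cv_le_const (qpoch q x)); [|now apply qpoch_cv].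
  intros n. eapply Rle_trans; [now apply qpoch_le|].
  assert (E : (Cmod x / (1 - q) <= B / (1 - q))%R)
    by (apply Rmult_le_compat_r; [left; apply Rinv_0_lt_compat; lra|auto]).
  destruct E as [E| ->]; [left; now apply exp_increasing|apply Rle_refl].
Qed.

(** Convergence of this series cannot be read off from [newton_series]: the prefactor in
    [cof_reg_term] contains (alpha/xi; q)_oo, which may be 0. Hence a direct bound, with the factor
    q^k coming from the argument of the series. *)
Lemma reg_term_le : exists K, forall k, (Cmod (reg_term k) <= K * q ^ k)%R.
Proof.
  destruct qpoch_q_ge as [m [Hm Hqm]].
  set (E := fun z : C => exp (Cmod z / (1 - q))).
  exists (E (RtoC alpha / beta)%C * (E (xi * u)%C * E (xi / u)%C) * (/ m * 1)
    * E (RtoC alpha * RtoC xi)%C)%R.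
  intros k. unfold reg_term, qpochs. simpl. rewrite !Cmult_1_r, qxi_div_beta_C.
  assert (Q1 := qpoch_q_neq_0 q hq k). specialize (Hqm k).
  assert (Hn : (q * xi / beta <= 0)%R) by (left; now apply qxi_div_beta_neg).
  assert (Q2 := qpoch_nonpos_neq_0 q hq _ k Hn).
  assert (G := qpoch_nonpos_ge_1 _ k Hn).
  rewrite !(Cmod_mult _ (Cpow _ _)), (Cmod_mult _ (qpoch_inf _ _)).
  rewrite Cmod_div by now apply Cmult_neq_0.
  rewrite !(Cmod_mult (qpoch _ _ _)). unfold Rdiv at 1. rewrite Rinv_mult.
  rewrite <- RtoC_pow, Cmod_R, (Rabs_pos_eq (q ^ k)) by (apply pow_le; lra).
  apply Rmult_le_compat_r; [apply pow_le; lra|].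
  assert (I1 : (0 < / Cmod (qpoch q q k))%R) by (apply Rinv_0_lt_compat; lra).
  assert (I2 : (0 < / Cmod (qpoch q (RtoC (q * xi / beta)) k))%R) by (apply Rinv_0_lt_compat; lra).
  apply Rmult_le_compat; auto using Cmod_ge_0.
  - repeat apply Rmult_le_pos; auto using Cmod_ge_0; lra.
  - apply Rmult_le_compat.
    + repeat apply Rmult_le_pos; auto using Cmod_ge_0.
    + apply Rmult_le_pos; lra.
    + repeat apply Rmult_le_compat; try (now apply qpoch_le);
        repeat apply Rmult_le_pos; auto using Cmod_ge_0.
    + apply Rmult_le_compat; try lra; [apply Rinv_le_contravar; lra|].
      rewrite <- Rinv_1. apply Rinv_le_contravar; lra.
  - apply qpoch_inf_le. rewrite Cmod_mult, Cmod_R, (Rabs_pos_eq (q ^ k)) by (apply pow_le; lra).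
    assert (q ^ k <= 1) by (rewrite <- (pow1 k); apply pow_incr; lra).
    assert (0 <= Cmod (alpha * xi)) by apply Cmod_ge_0.
    assert (0 <= q ^ k) by (apply pow_le; lra). nra.
Qed.

Lemma is_series_csum (f : nat -> C) (s : C) :
  cv (csum f) s -> is_series (K := C_AbsRing) (V := C_NormedModule) f s.
Proof.
  intros H. unfold is_series. apply cv_filterlim.
  apply cv_ext with (fun n => csum f (S n)); [|now apply (cv_incr_1 (csum f))].
  intros n. induction n as [|n IH].
  - rewrite sum_O. simpl. ring.
  - rewrite sum_Sn, <- IH. reflexivity.
Qed.

Lemma csum_scal (c : C) (f : nat -> C) (n : nat) : csum (fun k => c * f k) n = c * csum f n.
Proof. induction n as [|n IH]; simpl; [ring|]. rewrite IH. ring. Qed.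

(** One sum serves both cases of the theorem: as it stands when alpha xi = q^(-j), and divided by
    (alpha xi; q)_oo otherwise. *)
Lemma reg_series : exists s L,
  CI (limit_integrand q beta xi X alpha) L /\
  cv (csum reg_term) s /\
  qpoch_inf q (alpha / xi) / (qpoch_inf q (beta * xi) * qpoch_inf q (beta / xi)) * s
  = ratio q beta alpha X - L / RtoC (2 * PI).
Proof.
  destruct (newton_series q beta xi hq hbeta hxi X Re_joukowski_neg alpha) as [L [HL Hcv]].
  destruct reg_term_le as [K HK].
  assert (Hs : cv (csum reg_term) (clim (csum reg_term))).
  { apply geometric_cv with K q; auto. intros n. simpl.
    replace (csum reg_term n + reg_term n - csum reg_term n) with (reg_term n) by ring. apply HK. }
  exists (clim (csum reg_term)), L. split; [auto|split; [auto|]].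
  apply (cv_unique (csum (fun k => cof q beta xi alpha k * spoch q xi X k))); auto.
  apply cv_ext with (fun n => qpoch_inf q (alpha / xi)
    / (qpoch_inf q (beta * xi) * qpoch_inf q (beta / xi)) * csum reg_term n).
  - intros n. rewrite <- csum_scal. apply csum_ext. intros k. now rewrite cof_reg_term.
  - now apply cv_scal.
Qed.

Lemma reg_term_phi32 (k : nat) : qpoch_inf q (alpha * xi) <> 0 ->
  qpochs q [RtoC alpha / RtoC beta; xi * u; xi / u] k
    / qpochs q [RtoC q; alpha * xi; q * xi / beta] k * Cpow q k
  = / qpoch_inf q (alpha * xi) * reg_term k.
Proof.
  intros H. unfold reg_term, qpochs. simpl. rewrite !Cmult_1_r, qxi_div_beta_C.
  rewrite (qpoch_inf_split q hq (alpha * xi) k) in *.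
  assert (Q1 := qpoch_q_neq_0 q hq k).
  assert (Q2 : qpoch q (RtoC (q * xi / beta)) k <> 0).
  { apply qpoch_nonpos_neq_0; auto. left. now apply qxi_div_beta_neg. }
  assert (A1 : qpoch q (alpha * xi) k <> 0) by (intros E; apply H; rewrite E; ring).
  assert (A2 : qpoch_inf q (alpha * xi * RtoC (q ^ k)) <> 0) by (intros E; apply H; rewrite E; ring).
  field. auto.
Qed.

End Final.

Theorem mainTheorem4 (q alpha beta xi : R) (u : C)
  (hq : (0 < q < 1)%R) (hbeta : (0 < beta)%R) (hxi : (xi < 0)%R)
  (hu : (Re u < 0)%R) :
  exists J : C,
    is_int_imag (integrand q alpha beta xi u) J /\
    ((forall j : nat, alpha * xi <> / RtoC (q ^ j)%R) ->
     exists s : C,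
       is_phi32 (alpha / beta) (xi * u) (xi / u)
                (alpha * xi) (q * xi / beta) q q s /\
       qpochs_inf q [alpha * u; alpha / u] / qpochs_inf q [beta * u; beta / u]
       = qpochs_inf q [alpha * xi; alpha / xi]
           / qpochs_inf q [beta * xi; beta / xi] * s
         + / (4 * PI * Ci) * J) /\
    ((exists j : nat, alpha * xi = / RtoC (q ^ j)%R) ->
     exists s : C,
       is_phi32_reg (alpha / beta) (xi * u) (xi / u)
                    (alpha * xi) (q * xi / beta) q q s /\
       qpochs_inf q [alpha * u; alpha / u] / qpochs_inf q [beta * u; beta / u]
       = qpochs_inf q [RtoC alpha / xi]
           / qpochs_inf q [beta * xi; beta / xi] * s
         + / (4 * PI * Ci) * J).
Proof.
  destruct (reg_series q alpha beta xi u hq hbeta hxi hu) as [s [L [HL [Hs E]]]].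
  exists (Ci * (RtoC 2 * L)).
  assert (PI0 : RtoC PI <> 0) by (apply RtoC_neq_0; assert (P := PI_RGT_0); lra).
  assert (Hi : Ci <> 0) by (intros E0; apply (f_equal snd) in E0; simpl in E0; lra).
  assert (H2 : RtoC 2 <> 0) by (apply RtoC_neq_0; lra).
  (* The double covering in v turns the factor 1/(2 pi) of the Hermite form into 1/(4 pi i). *)
  assert (EJ : / (4 * PI * Ci) * (Ci * (RtoC 2 * L)) = L / RtoC (2 * PI)).
  { rewrite RtoC_mult. replace (RtoC 4) with (RtoC 2 * RtoC 2) by (rewrite <- RtoC_mult; f_equal; ring).
    field. auto. }
  rewrite EJ.
  assert (ER : qpochs_inf q [alpha * u; alpha / u] / qpochs_inf q [beta * u; beta / u]
    = qpoch_inf q (alpha / xi) / (qpoch_inf q (beta * xi) * qpoch_inf q (beta / xi)) * s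
      + L / RtoC (2 * PI)).
  { rewrite E, <- ratio_joukowski by (auto; now apply Re_neg_neq_0). ring. }
  rewrite ER.
  destruct (beta_factors_neq_0 q beta xi hq hbeta hxi) as [B1 B2].
  split; [now apply is_int_imag_integrand|split].
  - intros Hreg.
    assert (A : qpoch_inf q (alpha * xi) <> 0).
    { apply qpoch_inf_neq_0; auto. intros j E0. apply (Hreg j).
      assert (Q : RtoC (q ^ j) <> 0) by (apply RtoC_neq_0, pow_nonzero; lra).
      transitivity (/ RtoC (q ^ j) * (1 - (1 - RtoC (q ^ j) * (alpha * xi)))); [field; auto|].
      rewrite E0. field. auto. }
    exists (/ qpoch_inf q (alpha * xi) * s). split.
    + apply is_series_csum.
      apply cv_ext with (fun n => / qpoch_inf q (alpha * xi) * csum (reg_term q alpha beta xi u) n).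
      * intros n. rewrite <- csum_scal. apply csum_ext. intros k. symmetry. now apply reg_term_phi32.
      * now apply cv_scal.
    + f_equal. unfold qpochs_inf. simpl. field. auto.
  - intros _. exists s. split.
    + now apply is_series_csum.
    + f_equal. unfold qpochs_inf. simpl. now rewrite !Cmult_1_r.
Qed.
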